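(* Let $G$ be a finite group, let $\Bbbk$ be a field of characteristic $p>0$ dividing the order of $G$, and let $M$ be a finite-dimensional $\Bbbk G$-module. Then there exists a finite-dimensional $\Bbbk G$-module $N$ such that $M\oplus N$ admits a finite resolution by permutation modules, i.e. there exist an integer $n\geq 0$ and an exact sequence of $\Bbbk G$-modules $$0\to P_n\to P_{n-1}\to\cdots\to P_1\to P_0\to M\oplus N\to 0$$ in which every $P_i$ is a permutation module.
   Context: A permutation module over $\Bbbk G$ is a $\Bbbk G$-module isomorphic to $\Bbbk X$ (the $\Bbbk$-vector space with basis $X$ and $G$ acting by permuting the basis) for some finite $G$-set $X$; equivalently, a finite direct sum of modules of the form $\Bbbk(G/H)$ with $H\leq G$ a subgroup. *)

(* Defs.v *)
From mathcomp Require Import all_boot all_fingroup all_algebra all_character.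

Set Implicit Arguments.
Unset Strict Implicit.
Unset Printing Implicit Defensive.

Import GRing.Theory.
Local Open Scope ring_scope.

(* A finite-dimensional kG-module is a matrix representation of G, acting on
   row vectors by v |-> v *m rG g; it is thus a right module, and G-sets are
   right G-sets accordingly.  Inversion in G identifies this convention with
   the left-handed one.  The degree 0 (zero module) is allowed. *)

Section PermutationModule.

Variables (F : fieldType) (gT : finGroupType) (G : {group gT}).
Variables (X : finType) (to : action G X).

(* The basis vectors of kX are indexed by enum_rank x, for x in X. *)
Definition perm_module_mx (g : gT) : 'M[F]_#|X| :=
  \matrix_i delta_mx 0 (enum_rank (to (enum_val i) g)).

Lemma perm_module_mx_repr : mx_repr G perm_module_mx.
Proof.
split=> [|g h Gg Gh]; apply/row_matrixP=> i; rewrite !rowK.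
  by rewrite act1 row1 enum_valK.
by rewrite row_mul rowK -rowE rowK enum_rankK actMin.
Qed.

Canonical perm_module_repr := MxRepresentation perm_module_mx_repr.

End PermutationModule.

Section Resolutions.

Variables (F : fieldType) (gT : finGroupType) (G : {group gT}).
Local Notation module := (representation F G).

Definition is_permutation_module (V : module) : Prop :=
  exists (X : finType) (to : action G X), mx_rsim V (perm_module_repr F to).

Definition module_hom (U V : module) (f : 'M[F]_(rdegree U, rdegree V)) : Prop :=
  forall g, g \in G -> U g *m f = f *m V g.

(* Exactness of U --f--> V --h--> W at V: the image of f is its row space. *)
Definition exact_at (U V W : module) (f : 'M[F]_(rdegree U, rdegree V))
    (h : 'M[F]_(rdegree V, rdegree W)) : Prop :=
  (f == kermx h)%MS.

(* The sequence 0 -> P_n -> ... -> P_0 -> V -> 0 is extended to the left by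
   zero modules P_i, i > n, so that exactness of d at P_n says that
   P_n -> P_(n-1) (or P_0 -> V, when n = 0) is injective. *)
Definition has_finite_permutation_resolution (V : module) : Prop :=
  exists (n : nat) (P : nat -> module)
         (d : forall i, 'M[F]_(rdegree (P i.+1), rdegree (P i)))
         (eps : 'M[F]_(rdegree (P 0), rdegree V)),
    [/\ (forall i, (i <= n)%N -> is_permutation_module (P i))
          /\ (forall i, (n < i)%N -> rdegree (P i) = 0%N),
        module_hom eps /\ (forall i, module_hom (d i)),
        row_full eps,
        exact_at (d 0%N) eps
      & forall i, exact_at (d i.+1) (d i)].

End Resolutions.

(* Main.v *)
(* Let W be the class of the modules M such that, for every m, some sum M + N has
   a finite permutation resolution starting with m free terms. By the horseshoe
   lemma, W satisfies the two-out-of-three property for short exact sequences. As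
   M is a summand of the module induced from its restriction to a Sylow
   p-subgroup, and as modules for p-groups are iterated extensions of the trivial
   module k, it is enough to prove that k lies in W when G is a p-group, by
   induction on |G|. Then modules that are sums of blocks permuted by G without
   fixed block lie in W, being summands of sums of induced modules.

   If G = B x C is abelian, with C cyclic, then the exact sequence
   0 -> k -> Ind_B k -> Ind_B k -> k -> 0 shows that every even syzygy of k has,
   up to a summand, a finite permutation resolution, as k itself does by inflation
   from G/C. Splicing it with the free terms below the syzygy puts k in W.

   If G is not abelian, choose N normal in G and of index p in the derived group,
   and a, g in G with [a, g] not in N. The exponent lam h of [h, g] in terms of
   [a, g], modulo N, is a character of G with lam a = 1. Let eps be the Bockstein
   of lam, seen as an invariant vector of Y = C^1 / d C^0, and let A be <a> if
   a^p <> 1, and <a> G' otherwise. Then there are h in G normalizing A and an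
   A-invariant y in Y such that y h - y - eps is a trace from 1 to A. Let tau(Y)
   be the tensor induction of Y from A to G. Expanding the tensor induction of
   y h shows that the copy of k spanned by that of eps in tau(Y) is the image of a
   map that factors through a module in W. As tau(Y)/k lies in W, so does k. *)

From HB Require Import structures.
Require Import Defs.
From mathcomp Require Import all_boot all_fingroup all_order all_algebra.
From mathcomp Require Import all_solvable all_character ring.

Set Implicit Arguments.
Unset Strict Implicit.
Unset Printing Implicit Defensive.

Import GRing.Theory.
Local Open Scope group_scope.
Local Open Scope ring_scope.

(** [C0] and [C1] are free over G and 0 -> k -> C0 -> C1 -> Y -> 0 is exact. So Y is a second
    cosyzygy of k, and for A <> 1 the A-invariants of Y modulo traces from 1 are H^2(A, k). The
    condition on y h - y - eps thus says that the Bockstein class of lam, restricted to A, has the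
    form y h - y in H^2(A, k). If a^p <> 1, this class is 0 on <a>, where lam lifts to a character
    with values in Z/p^2, so h = 1 and y = 0 will do. If a^p = 1, then <a> G' has a character chi
    whose translate by h is chi + lam, and y is its Bockstein; a^p = 1 is what makes chi well
    defined. Tensor induction sends k to k, so it cannot by itself bring k into W. Y is chosen so
    that Y/k is built from permutation modules without A-fixed points, whose tensor inductions
    permute their bases without G-fixed vector. Even then only tau(Y)/k is known to lie in W; the
    factorization of k -> tau(Y) through a module in W makes up for the lack of information on
    tau(Y) itself. *)

Section LinearMaps.

Variable F : fieldType.

Definition mklin (U V : lmodType F) (f : U -> V) (Hf : linear f) :
    {linear U -> V} :=
  HB.pack f (GRing.isLinear.Build F U V *:%R f Hf).

Lemma mklinE (U V : lmodType F) (f : U -> V) (Hf : linear f) u :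
  mklin Hf u = f u.
Proof. by []. Qed.

Variables U V W : vectType F.

Lemma linear_factor_inj (i : {linear U -> V}) (f : {linear W -> V}) :
  injective i -> (forall w, exists u, i u = f w) ->
  exists g : {linear W -> U}, forall w, i (g w) = f w.
Proof.
move=> inj_i im_f; pose g w := ((linfun i)^-1)%VF (f w).
have lin_g : linear g by move=> a u v; rewrite /g !linearP.
exists (mklin lin_g) => w; rewrite mklinE /g.
have [u <-] := im_f w; rewrite -[i u in LHS]lfunE lker0_lfunK //.
by apply/lker0P => x y; rewrite !lfunE; apply: inj_i.
Qed.

Lemma linear_section (s : {linear V -> W}) :
  (forall w, exists v, s v = w) ->
  exists t : {linear W -> V}, forall w, s (t w) = w.
Proof.
move=> sur_s; pose g w := ((linfun s)^-1)%VF w.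
have lin_g : linear g by move=> a u v; rewrite /g !linearP.
exists (mklin lin_g) => w; rewrite mklinE /g -[s _]lfunE limg_lfunVK //.
by have [v <-] := sur_s w; rewrite -[s v]lfunE memv_img ?memvf.
Qed.

End LinearMaps.

(** * Modules, their homomorphisms, submodules and quotients *)

Section Modules.

Variables (F : fieldType) (gT : finGroupType) (G : {group gT}).

(* Right modules, as in [Defs]; only the action of elements of G matters. *)
Record gmod := Gmod {
  gV :> vectType F;
  gmact : gT -> {linear gV -> gV};
  gmact1 : forall v, gmact 1%g v = v;
  gmactM : {in G &, forall g h v, gmact (g * h)%g v = gmact h (gmact g v)} }.

Record ghom (U V : gmod) := Ghom {
  gfun :> {linear U -> V};
  ghomE : {in G, forall g u, gfun (gmact U g u) = gmact V g (gfun u)} }.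

Definition mkgmod (V : vectType F) (a : gT -> V -> V)
    (lin_a : forall g, linear (a g)) (a1 : forall v, a 1%g v = v)
    (aM : {in G &, forall g h v, a (g * h)%g v = a h (a g v)}) : gmod :=
  @Gmod V (fun g => mklin (lin_a g)) a1 aM.

Definition mkghom (U V : gmod) (f : U -> V) (lin_f : linear f)
    (f_eq : {in G, forall g u, f (gmact U g u) = gmact V g (f u)}) : ghom U V :=
  @Ghom U V (mklin lin_f) f_eq.

Lemma mkghomE (U V : gmod) (f : U -> V) (lin_f : linear f)
    (f_eq : {in G, forall g u, f (gmact U g u) = gmact V g (f u)}) u :
  mkghom lin_f f_eq u = f u.
Proof. by []. Qed.

Lemma gmactKV (V : gmod) g : g \in G -> cancel (gmact V g^-1) (gmact V g).
Proof. by move=> Gg v; rewrite -gmactM ?groupV // mulVg gmact1. Qed.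

Lemma comp_linear (U V W : lmodType F) (f : {linear V -> W})
  (h : {linear U -> V}) : linear (fun u => f (h u)).
Proof. by move=> a u v; rewrite !linearP. Qed.

Definition gcomp (U V W : gmod) (f : ghom V W) (h : ghom U V) : ghom U W.
Proof.
apply: (@mkghom U W (fun u => f (h u)) (comp_linear f h)).
by move=> g Gg u; rewrite !ghomE.
Defined.

Definition gid (U : gmod) : ghom U U.
Proof. by apply: (@mkghom U U (fun u => u)) => // a u v. Defined.

Definition gprod (U V : gmod) : gmod.
Proof.
apply: (@mkgmod (U * V)%type (fun g x => (gmact U g x.1, gmact V g x.2))).
- by move=> g a x y; rewrite /= !linearP.
- by move=> [u v]; rewrite /= !gmact1.
- by move=> g h Gg Gh [u v]; rewrite /= !gmactM.
Defined.

Lemma gprod_actE (U V : gmod) g (x : gprod U V) :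
  gmact (gprod U V) g x = (gmact U g x.1, gmact V g x.2).
Proof. by []. Qed.

Definition gpair (W U V : gmod) (f : ghom W U) (h : ghom W V) :
  ghom W (gprod U V).
Proof.
apply: (@mkghom W (gprod U V) (fun w => (f w, h w))).
- by move=> a x y; rewrite !linearP.
- by move=> g Gg w; rewrite !ghomE.
Defined.

Definition gcopair (U V W : gmod) (f : ghom U W) (h : ghom V W) :
  ghom (gprod U V) W.
Proof.
apply: (@mkghom (gprod U V) W (fun x => f x.1 + h x.2)).
- by move=> a [u v] [u' v'] /=; rewrite !linearP scalerDr addrACA.
- by move=> g Gg [u v]; rewrite /= linearD !ghomE.
Defined.

Definition gfst (U V : gmod) : ghom (gprod U V) U.
Proof. by apply: (@mkghom (gprod U V) U fst) => [a [u v] [u' v']|g Gg [u v]]. Defined.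

Definition gsnd (U V : gmod) : ghom (gprod U V) V.
Proof. by apply: (@mkghom (gprod U V) V snd) => [a [u v] [u' v']|g Gg [u v]]. Defined.

Definition ginl (U V : gmod) : ghom U (gprod U V).
Proof.
apply: (@mkghom U (gprod U V) (fun u => (u, 0))).
  by move=> a u v; apply: injective_projections; rewrite /= ?scaler0 ?addr0.
by move=> g Gg u; rewrite gprod_actE /= linear0.
Defined.

Definition ginr (U V : gmod) : ghom V (gprod U V).
Proof.
apply: (@mkghom V (gprod U V) (fun u => (0, u))).
  by move=> a u v; apply: injective_projections; rewrite /= ?scaler0 ?addr0.
by move=> g Gg u; rewrite gprod_actE /= linear0.
Defined.

Definition gopp (U V : gmod) (f : ghom U V) : ghom U V.
Proof.
apply: (@mkghom U V (fun u => - f u)).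
  by move=> a u v; rewrite linearP opprD scalerN.
by move=> g Gg u; rewrite ghomE // linearN.
Defined.

Definition gexact (U V W : gmod) (i : ghom U V) (s : ghom V W) : Prop :=
  [/\ injective i, forall w, exists v, s v = w
    & forall v, s v = 0 <-> exists u, i u = v].

Definition ses (U V W : gmod) : Prop :=
  exists (i : ghom U V) (s : ghom V W), gexact i s.

Definition giso (U V : gmod) : Prop :=
  exists (f : ghom U V) (h : ghom V U), cancel f h /\ cancel h f.

Lemma giso_refl U : giso U U.
Proof. by exists (gid U), (gid U). Qed.

Lemma giso_sym U V : giso U V -> giso V U.
Proof. by case=> f [h [fK hK]]; exists h, f. Qed.

Lemma giso_trans U V W : giso U V -> giso V W -> giso U W.
Proof.
case=> f [h [fK hK]] [f' [h' [fK' hK']]].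
exists (gcomp f' f), (gcomp h h'); split=> x.
  by rewrite /= fK' fK.
by rewrite /= hK hK'.
Qed.

Lemma giso_bij (U V : gmod) (f : ghom U V) :
  injective f -> (forall v, exists u, f u = v) -> giso U V.
Proof.
move=> inj_f sur_f.
have [h hK] := @linear_section _ _ _ f sur_f.
have h_eq : {in G, forall g v, h (gmact V g v) = gmact U g (h v)}.
  by move=> g Gg v; apply: inj_f; rewrite ghomE // !hK.
by exists f, (Ghom h_eq); split=> x //; apply: inj_f; rewrite hK.
Qed.

Lemma gfactor_inj (U V W : gmod) (i : ghom U V) (f : ghom W V) :
  injective i -> (forall w, exists u, i u = f w) ->
  exists g : ghom W U, forall w, i (g w) = f w.
Proof.
move=> inj_i im_f; have [h hK] := @linear_factor_inj _ _ _ _ i f inj_i im_f.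
have h_eq : {in G, forall g v, h (gmact W g v) = gmact U g (h v)}.
  by move=> g Gg v; apply: inj_i; rewrite ghomE // !hK ghomE.
by exists (Ghom h_eq).
Qed.

Lemma gfactor_surj (U V W : gmod) (s : ghom U V) (f : ghom U W) :
  (forall v, exists u, s u = v) -> (forall u, s u = 0 -> f u = 0) ->
  exists g : ghom V W, forall u, g (s u) = f u.
Proof.
move=> sur_s ker_f; have [t tK] := @linear_section _ _ _ s sur_s.
have fE u v : s u = s v -> f u = f v.
  move=> E; apply/eqP; rewrite -subr_eq0 -linearB; apply/eqP/ker_f.
  by rewrite linearB E subrr.
have h_eq : {in G, forall g v, f (t (gmact V g v)) = gmact W g (f (t v))}.
  by move=> g Gg v; rewrite -ghomE //; apply: fE; rewrite ghomE // !tK.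
by exists (mkghom (comp_linear f t) h_eq) => u; apply: fE; rewrite tK.
Qed.

Section Sub.
Variables (V : gmod) (U : {vspace V}).
Hypothesis modU : {in G, forall g u, u \in U -> gmact V g u \in U}.

Definition gsub : gmod.
Proof.
apply: (@mkgmod (subvs_of U) (fun g u => vsproj U (gmact V g (vsval u)))).
- by move=> g a x y; rewrite !linearP.
- by move=> u; rewrite gmact1 vsvalK.
- move=> g h Gg Gh u /=; apply: val_inj.
  by rewrite /= gmactM // !vsprojK // ?modU ?modU ?subvsP.
Defined.

Definition gsub_val : ghom gsub V.
Proof.
apply: (@mkghom gsub V (@vsval _ _ U)) => [a x y | g Gg u]; first by rewrite linearP.
by rewrite /= vsprojK // modU ?subvsP.
Defined.

Lemma gsub_val_inj : injective gsub_val.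
Proof. exact: subvs_inj. Qed.

Lemma gsub_valP u : gsub_val u \in U.
Proof. exact: subvsP. Qed.

Lemma gsub_val_im v : v \in U -> exists u, gsub_val u = v.
Proof. by move=> Uv; exists (vsproj U v); rewrite mkghomE vsprojK. Qed.

(** The quotient V/U is modelled on the complement [U^C]. As G need not preserve this complement,
    the action is corrected by the projection along U. *)
Let pq := daddv_pi (U^C)%VS U.

Let capCU : (U^C :&: U = 0)%VS.
Proof. by rewrite capvC capv_compl. Qed.

Let addCU : (U^C + U = fullv)%VS.
Proof. by rewrite addvC addv_complf. Qed.

Let pq_sub v : v - pq v \in U.
Proof.
have E : v = pq v + daddv_pi U (U^C)%VS v.
  by rewrite (daddv_pi_add capCU) // addCU memvf.
by rewrite {1}E addrC addKr memv_pi.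
Qed.

Let pq_ker v : (pq v == 0) = (v \in U).
Proof.
apply/eqP/idP => [E | Uv]; first by rewrite -[v]subr0 -E pq_sub.
have := pq_sub v; rewrite -[v - _ \in U]/(_) => H.
have : pq v \in (U :&: U^C)%VS.
  rewrite memv_cap memv_pi andbT.
  by rewrite -[pq v](subKr v) memvB.
by rewrite capv_compl memv0 => /eqP.
Qed.

Let pqE u v : u - v \in U -> pq u = pq v.
Proof. by rewrite -pq_ker linearB subr_eq0 => /eqP. Qed.

Definition gquo : gmod.
Proof.
apply: (@mkgmod (subvs_of (U^C)%VS)
  (fun g w => vsproj (U^C)%VS (pq (gmact V g (vsval w))))).
- by move=> g a x y; rewrite !linearP.
- move=> w; apply: val_inj; rewrite /= vsprojK ?memv_pi // gmact1.
  by rewrite /pq (daddv_pi_id capCU) // subvsP.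
- move=> g h Gg Gh w; apply: val_inj; rewrite /= !vsprojK ?memv_pi //.
  rewrite gmactM //; apply: pqE; rewrite -linearB; apply: modU => //.
Defined.

Definition gquo_map : ghom V gquo.
Proof.
apply: (@mkghom V gquo (fun v => vsproj (U^C)%VS (pq v))) => [a x y | g Gg v].
  by rewrite !linearP.
apply: val_inj; rewrite /= !vsprojK ?memv_pi //.
by apply: pqE; rewrite -linearB modU.
Defined.

Lemma gquo_map_eq0 v : gquo_map v = 0 <-> v \in U.
Proof.
rewrite -pq_ker; split=> [/(congr1 val)|/eqP E].
  by rewrite /= vsprojK ?memv_pi // => ->.
by rewrite mkghomE E linear0.
Qed.

Lemma gquo_map_surj w : exists v, gquo_map v = w.
Proof.
exists (vsval w); apply: val_inj; rewrite /= vsprojK ?memv_pi //.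
by rewrite /pq (daddv_pi_id capCU) // subvsP.
Qed.

End Sub.

Lemma ker_exact (V W : gmod) (s : ghom V W) :
  (forall w, exists v, s v = w) ->
  exists (U : gmod) (i : ghom U V), gexact i s.
Proof.
move=> sur_s; pose K := lker (linfun s).
have memK v : (v \in K) = (s v == 0) by rewrite memv_ker lfunE.
have modK : {in G, forall g u, u \in K -> gmact V g u \in K}.
  by move=> g Gg u; rewrite !memK ghomE // => /eqP->; rewrite linear0.
exists (gsub modK), (gsub_val modK); split=> // [|v]; first exact: gsub_val_inj.
split=> [/eqP|[u <-]]; first by rewrite -memK => /(gsub_val_im modK).
by apply/eqP; rewrite -memK gsub_valP.
Qed.

Lemma coker_exists (U V : gmod) (i : ghom U V) :
  exists (W : gmod) (s : ghom V W), (forall w, exists v, s v = w) /\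
    forall v, s v = 0 <-> exists u, i u = v.
Proof.
pose K := limg (linfun i).
have memK v : reflect (exists u, i u = v) (v \in K).
  apply: (iffP memv_imgP) => [[u _ ->]|[u <-]]; exists u; rewrite ?lfunE ?memvf //.
have modK : {in G, forall g u, u \in K -> gmact V g u \in K}.
  by move=> g Gg _ /memK[u <-]; apply/memK; exists (gmact U g u); rewrite ghomE.
exists (gquo modK), (gquo_map modK); split=> [|v]; first exact: gquo_map_surj.
by split=> [/gquo_map_eq0/memK|/memK/gquo_map_eq0].
Qed.

Lemma coker_exact (U V : gmod) (i : ghom U V) :
  injective i -> exists (W : gmod) (s : ghom V W), gexact i s.
Proof. by move=> inj_i; have [W [s []]] := coker_exists i; exists W, s. Qed.

End Modules.

(** * Short exact sequences: pullbacks, horseshoe lemma, splittings *)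

Section ExactSequences.

Variables (F : fieldType) (gT : finGroupType) (G : {group gT}).
Implicit Types A B C M N U V W X Y Z : gmod F G.

Lemma exact0 U V W (i : ghom U V) (s : ghom V W) u : gexact i s -> s (i u) = 0.
Proof. by case=> _ _ ex; apply/ex; exists u. Qed.

Lemma ses_iso U V W U' V' W' :
  giso U U' -> giso V V' -> giso W W' -> ses U V W -> ses U' V' W'.
Proof.
case=> [fU [hU [fhU hfU]]] [fV [hV [fhV hfV]]] [fW [hW [fhW hfW]]].
case=> i [s [inj_i sur_s ex]].
exists (gcomp fV (gcomp i hU)), (gcomp fW (gcomp s hV)); split.
- move=> x y /= /(can_inj fhV)/inj_i; exact: (can_inj hfU).
- move=> w; have [v sv] := sur_s (hW w); exists (fV v).
  by rewrite /= fhV sv hfW.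
move=> v; split=> /= [E|[u <-]].
  have /ex[u iu] : s (hV v) = 0 by rewrite -[s _]fhW E linear0.
  by exists (fU u); rewrite /= fhU iu hfV.
by rewrite fhV (exact0 _ (And3 inj_i sur_s ex)) linear0.
Qed.

Lemma ses_prod U V W U' V' W' :
  ses U V W -> ses U' V' W' -> ses (gprod U U') (gprod V V') (gprod W W').
Proof.
case=> i [s [inj_i sur_s ex]] [i' [s' [inj_i' sur_s' ex']]].
exists (gpair (gcomp i (gfst U U')) (gcomp i' (gsnd U U'))).
exists (gpair (gcomp s (gfst V V')) (gcomp s' (gsnd V V'))); split.
- by move=> [u u'] [v v'] /= [/inj_i-> /inj_i'->].
- move=> [w w']; have [v <-] := sur_s w; have [v' <-] := sur_s' w'.
  by exists (v, v').
move=> [v v']; split=> [[/ex[u <-] /ex'[u' <-]]|[[u u'] [<- <-]]].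
  by exists (u, u').
by rewrite /= (exact0 _ (And3 inj_i sur_s ex))
           (exact0 _ (And3 inj_i' sur_s' ex')).
Qed.

Lemma giso_prod U V U' V' :
  giso U U' -> giso V V' -> giso (gprod U V) (gprod U' V').
Proof.
case=> [f [h [fh hf]]] [f' [h' [fh' hf']]].
exists (gpair (gcomp f (gfst U V)) (gcomp f' (gsnd U V))).
exists (gpair (gcomp h (gfst U' V')) (gcomp h' (gsnd U' V'))).
by split=> -[u v] /=; rewrite ?fh ?fh' ?hf ?hf'.
Qed.

Lemma giso_prodC U V : giso (gprod U V) (gprod V U).
Proof.
exists (gpair (gsnd U V) (gfst U V)), (gpair (gsnd V U) (gfst V U)).
by split=> -[u v].
Qed.

Lemma giso_prodA U V W : giso (gprod U (gprod V W)) (gprod (gprod U V) W).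
Proof.
exists (gpair (gpair (gfst U (gprod V W))
               (gcomp (gfst V W) (gsnd U (gprod V W))))
              (gcomp (gsnd V W) (gsnd U (gprod V W)))).
exists (gpair (gcomp (gfst U V) (gfst (gprod U V) W))
         (gpair (gcomp (gsnd U V) (gfst (gprod U V) W)) (gsnd (gprod U V) W))).
by split=> [[u [v w]]|[[u v] w]].
Qed.

Lemma ses_addl U V : ses U (gprod U V) V.
Proof.
exists (ginl U V), (gsnd U V); split=> [u u' [] //|v|[u v]].
  by exists (0, v).
by split=> [/= ->|[u' [_ <-]]//]; exists u.
Qed.

Definition gzero : gmod F G.
Proof.
by apply: (@mkgmod F gT G 'rV[F]_0 (fun _ v => v)).
Defined.

Definition is_zero M : Prop := forall v : M, v = 0.

Lemma gzero0 : is_zero gzero.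
Proof. by move=> v; apply/rowP => [[]]. Qed.

Definition g0map U V : ghom U V.
Proof.
by apply: (@mkghom _ _ _ U V (fun=> 0)) => [a u v|g Gg u]; rewrite ?scaler0 ?addr0 ?linear0.
Defined.

Lemma ses_zerol Z M : is_zero Z -> ses Z M M.
Proof.
move=> Z0; exists (g0map Z M), (gid M).
split=> [u v _|w|v]; first by rewrite [u]Z0 [v]Z0.
  by exists w.
by split=> [E|[u <-] //]; exists 0; rewrite -[v]/(gid M v) E.
Qed.

Lemma giso_zeror U Z : is_zero Z -> giso U (gprod U Z).
Proof.
move=> Z0; exists (ginl U Z), (gfst U Z); split=> [u //|[u z]] /=.
by rewrite [z]Z0.
Qed.

Lemma ses_zerol_iso Z U V : is_zero Z -> ses Z U V -> giso U V.
Proof.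
move=> Z0 [i [s [inj_i sur_s ex]]]; apply: (giso_bij (f := s)) => // x y E.
apply/eqP; rewrite -subr_eq0; apply/eqP.
have /ex[u <-] : s (x - y) = 0 by rewrite linearB E subrr.
by rewrite [u]Z0 linear0.
Qed.

Lemma zero_iso M N : giso M N -> is_zero M -> is_zero N.
Proof. by case=> f [h [_ hf]] M0 n; rewrite -[n]hf [h n]M0 linear0. Qed.

Lemma surj_ses V W (s : ghom V W) :
  (forall w, exists v, s v = w) -> exists U, ses U V W.
Proof. by case/ker_exact=> U [i ex]; exists U, i, s. Qed.

Lemma inj_ses U V (i : ghom U V) : injective i -> exists W, ses U V W.
Proof. by case/coker_exact=> W [s ex]; exists W, i, s. Qed.

(** X is the fibre product of U and V over M, cut out of U x V by f = g; its projection to V has the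
    kernel of f, its projection to U that of g. *)
Lemma pullback_ses A U B V M : ses A U M -> ses B V M ->
  exists X, ses A X V /\ ses B X U.
Proof.
case=> i [f exf] [j [g exg]].
have [inj_i sur_f kf] := exf; have [inj_j sur_g kg] := exg.
pose d := gcopair f (gopp g).
have sur_d w : exists v, d v = w.
  by have [u <-] := sur_f w; exists (u, 0); rewrite /= linear0 subr0.
have [X [e exe]] := ker_exact sur_d; exists X.
have [inj_e _ ke] := exe.
have dE x : f (e x).1 = g (e x).2.
  by apply/eqP; rewrite -subr_eq0; apply/eqP; apply: (exact0 x exe).
have [a aE] : exists a : ghom A X, forall w, e (a w) = (i w, 0).
  apply: (gfactor_inj (f := gcomp (ginl U V) i)) => // w.
  by apply/ke; rewrite /= linear0 subr0 (exact0 _ exf).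
have [b bE] : exists b : ghom B X, forall w, e (b w) = (0, j w).
  apply: (gfactor_inj (f := gcomp (ginr U V) j)) => // w.
  by apply/ke; rewrite /= linear0 add0r (exact0 _ exg) oppr0.
split.
  exists a, (gcomp (gsnd U V) e); split=> [x y E|v|x].
  - by apply: inj_i; have := congr1 (fun z => (e z).1) E; rewrite !aE.
  - have [u fu] := sur_f (g v).
    have /ke[x ex] : d (u, v) = 0 by rewrite /= fu subrr.
    by exists x; rewrite /= ex.
  split=> [/= E|[w <-]]; last by rewrite /= aE.
  have /kf[w iw] : f (e x).1 = 0 by rewrite dE E linear0.
  by exists w; apply: inj_e; rewrite aE iw -E; case: (e x).
exists b, (gcomp (gfst U V) e); split=> [x y E|v|x].
- by apply: inj_j; have := congr1 (fun z => (e z).2) E; rewrite !bE.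
- have [u fu] := sur_g (f v).
  have /ke[x ex] : d (v, u) = 0 by rewrite /= fu subrr.
  by exists x; rewrite /= ex.
split=> [/= E|[w <-]]; last by rewrite /= bE.
have /kg[w iw] : g (e x).2 = 0 by rewrite -dE E linear0.
by exists w; apply: inj_e; rewrite bE iw -E; case: (e x).
Qed.

(** X is the kernel of U -> V -> W, that is, the preimage of K in U. *)
Lemma comp_ses A U V K W : ses A U V -> ses K V W ->
  exists X, ses A X K /\ ses X U W.
Proof.
case=> i [f exf] [j [g exg]].
have [inj_i sur_f kf] := exf; have [inj_j sur_g kg] := exg.
have sur_d w : exists u, gcomp g f u = w.
  by have [v <-] := sur_g w; have [u <-] := sur_f v; exists u.
have [X [e exe]] := ker_exact sur_d; have [inj_e _ ke] := exe.
exists X; split; last by exists e, (gcomp g f).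
have [a aE] : exists a : ghom A X, forall w, e (a w) = i w.
  apply: gfactor_inj => // w; apply/ke.
  by rewrite /= (exact0 _ exf) linear0.
have [b bE] : exists b : ghom X K, forall w, j (b w) = f (e w).
  apply: (gfactor_inj (f := gcomp f e)) => // w; apply/kg.
  exact: (exact0 w exe).
exists a, b; split=> [x y E|k|x].
- by apply: inj_i; rewrite -!aE E.
- have [u fu] := sur_f (j k).
  have /ke[x ex] : gcomp g f u = 0 by rewrite /= fu (exact0 _ exg).
  by exists x; apply: inj_j; rewrite bE ex.
split=> [E|[w <-]]; last by apply: inj_j; rewrite bE aE (exact0 _ exf) linear0.
have /kf[w iw] : f (e x) = 0 by rewrite -bE E linear0.
by exists w; apply: inj_e; rewrite aE.
Qed.

(** The lift l of q is an assumption because Q will be a permutation module, which lifts only if A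
    is suitably acyclic. *)
Lemma horseshoe A B C P Q ZA ZC (i : ghom A B) (s : ghom B C)
    (q : ghom Q C) (l : ghom Q B) (z : ghom ZC Q) :
  gexact i s -> ses ZA P A -> gexact z q -> (forall x, s (l x) = q x) ->
  exists ZB, ses ZA ZB ZC /\ ses ZB (gprod P Q) B.
Proof.
move=> exs [y [p exp]] exq lE.
have [inj_i sur_s ks] := exs; have [inj_y sur_p kp] := exp.
have [inj_z sur_q kq] := exq.
pose d := gcopair (gcomp i p) l.
have sur_d b : exists x, d x = b.
  have [x qx] := sur_q (s b).
  have /ks[a ia] : s (b - l x) = 0 by rewrite linearB lE qx subrr.
  have [w pw] := sur_p a; exists (w, x).
  by rewrite /= pw ia subrK.
have [ZB [e exe]] := ker_exact sur_d; have [inj_e _ ke] := exe.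
exists ZB; split; last by exists e, d.
have [a aE] : exists a : ghom ZA ZB, forall w, e (a w) = (y w, 0).
  apply: (gfactor_inj (f := gcomp (ginl P Q) y)) => // w; apply/ke.
  by rewrite /= (exact0 _ exp) !linear0 addr0.
have dE x : i (p (e x).1) + l (e x).2 = 0 by exact: (exact0 x exe).
have [b bE] : exists b : ghom ZB ZC, forall w, z (b w) = (e w).2.
  apply: (gfactor_inj (f := gcomp (gsnd P Q) e)) => // w; apply/kq.
  by rewrite /= -lE -[LHS]add0r -{1}(exact0 (p (e w).1) exs) -linearD dE linear0.
exists a, b; split=> [x x' E|k|x].
- by apply: inj_y; have := congr1 (fun z => (e z).1) E; rewrite !aE.
- have /ks[w iw] : s (- l (z k)) = 0 by rewrite linearN lE (exact0 _ exq) oppr0.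
  have [u pu] := sur_p w.
  have /ke[x ex] : d (u, z k) = 0 by rewrite /= pu iw addNr.
  by exists x; apply: inj_z; rewrite bE ex.
split=> [E|[w <-]]; last by apply: inj_z; rewrite bE aE linear0.
have e2 : (e x).2 = 0 by rewrite -bE E linear0.
have /kp[w iw] : p (e x).1 = 0.
  by apply: inj_i; rewrite linear0 -[RHS](dE x) e2 linear0 addr0.
by exists w; apply: inj_e; rewrite aE iw -e2; case: (e x).
Qed.

Lemma retract_summand M Z (s : ghom M Z) (r : ghom Z M) :
  (forall m, r (s m) = m) -> exists N, giso Z (gprod M N).
Proof.
move=> rs.
have sur_r m : exists z, r z = m by exists (s m).
have [N [i exi]] := ker_exact sur_r; have [inj_i _ ki] := exi.
exists N; apply: giso_sym.
apply: (giso_bij (f := gcopair s i)) => [[m n] [m' n'] /= E|z].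
  have Em : m = m'.
    have := congr1 r E; rewrite !linearD !rs.
    by rewrite !(exact0 _ exi) !addr0.
  by move: E; rewrite Em => /addrI/inj_i->.
have /ki[n iz] : r (z - s (r z)) = 0 by rewrite linearB rs subrr.
by exists (r z, n); rewrite /= iz addrC subrK.
Qed.

Lemma split_ses A B C (t : ghom C B) (i : ghom A B) (s : ghom B C) :
  gexact i s -> (forall c, s (t c) = c) -> giso B (gprod C A).
Proof.
move=> exs st; have [inj_i sur_s ks] := exs.
apply: giso_sym.
apply: (giso_bij (f := gcopair t i)) => [[m n] [m' n'] /= E|z].
  have Em : m = m'.
    by have := congr1 s E; rewrite !linearD !st !(exact0 _ exs) !addr0.
  by move: E; rewrite Em => /addrI/inj_i->.
have /ks[n iz] : s (z - t (s z)) = 0 by rewrite linearB st subrr.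
by exists (s z, n); rewrite /= iz addrC subrK.
Qed.

End ExactSequences.

(** * Permutation modules and the lifting of maps defined on them *)

Section PermModules.

Variables (F : fieldType) (gT : finGroupType) (G : {group gT}).
Implicit Types (M N P Q : gmod F G).

Section KSet.
Variables (X : finType) (to : action G X).

Lemma toM g h x : g \in G -> h \in G -> to x (g * h)%g = to (to x g) h.
Proof. by move=> Gg Gh; rewrite actMin. Qed.

Lemma toK g x : g \in G -> to (to x g) g^-1%g = x.
Proof. by move=> Gg; rewrite -toM ?groupV // mulgV act1. Qed.

Lemma toKV g x : g \in G -> to (to x g^-1%g) g = x.
Proof. by move=> Gg; rewrite -toM ?groupV // mulVg act1. Qed.

Definition gstab (x : X) : {set gT} := [set g in G | to x g == x].

Lemma gstabP x g : reflect (g \in G /\ to x g = x) (g \in gstab x).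
Proof. by rewrite inE; apply: (iffP andP) => -[Gg /eqP]. Qed.

Definition kset : gmod F G.
Proof.
apply: (@mkgmod F gT G {ffun X -> F^o}
  (fun g f => [ffun x => f (to x g^-1%g)])).
- by move=> g a f h; apply/ffunP => x; rewrite !ffunE.
- by move=> f; apply/ffunP => x; rewrite ffunE invg1 act1.
- by move=> g h Gg Gh f; apply/ffunP => x; rewrite !ffunE invMg toM ?groupV.
Defined.

Lemma orbit_rep : exists2 r : X -> X, {in G, forall g x, r (to x g) = r x}
  & forall x, exists g, g \in G /\ to (r x) g = x.
Proof.
pose e x y := [exists g in G, to x g == y].
have e_refl x : e x x by apply/exists_inP; exists 1%g; rewrite ?act1.
exists (fun x => odflt x [pick y | e x y]) => [g Gg x|x].
  have E : e (to x g) =1 e x.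
    move=> y; apply/exists_inP/exists_inP => -[h Gh /eqP <-].
      by exists (g * h)%g; rewrite ?groupM ?toM.
    by exists (g^-1 * h)%g; rewrite ?groupM ?toM ?groupV ?toK.
  by rewrite (eq_pick E); case: pickP => //= /(_ x); rewrite e_refl.
have : e x (odflt x [pick y | e x y]) by case: pickP => //= /(_ x); rewrite e_refl.
by case/exists_inP=> g Gg /eqP <-; exists g^-1%g; rewrite groupV toK.
Qed.

Lemma kset_actE g (f : kset) x : gmact kset g f x = f (to x g^-1%g).
Proof. by rewrite [LHS]ffunE. Qed.

Definition kdelta (x : X) : kset := [ffun y => (y == x)%:R : F^o].

Lemma kdelta_act g x : g \in G -> gmact kset g (kdelta x) = kdelta (to x g).
Proof.
move=> Gg; apply/ffunP => y; rewrite kset_actE !ffunE.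
by congr ((nat_of_bool _) %:R); apply/idP/idP => /eqP E; apply/eqP; rewrite -?E ?toKV ?toK ?E ?toKV ?toK.
Qed.

Lemma kset_sum (f : kset) : f = \sum_x f x *: kdelta x.
Proof.
apply/ffunP => y; rewrite sum_ffunE (bigD1 y) //= big1 ?addr0 => [|x /negPf nxy].
  by rewrite !ffunE eqxx -[RHS]/(f y * 1) mulr1.
by rewrite !ffunE eq_sym nxy -[LHS]/(f x * 0) mulr0.
Qed.

Lemma kset_hom_lin M (b : X -> M) :
  linear (fun f : kset => \sum_x f x *: b x).
Proof.
move=> a f h; rewrite scaler_sumr -big_split /=; apply: eq_bigr => x _.
by rewrite !ffunE scalerDl scalerA.
Qed.

Lemma kset_hom_eq M (b : X -> M) :
  {in G, forall g x, gmact M g (b x) = b (to x g)} ->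
  {in G, forall g (f : kset), \sum_x gmact kset g f x *: b x
                              = gmact M g (\sum_x f x *: b x)}.
Proof.
move=> b_eq g Gg f; rewrite linear_sum (reindex (to^~ g)) /=; last first.
  exists (to^~ g^-1%g) => x _; by rewrite ?toK ?toKV.
by apply: eq_bigr => x _; rewrite kset_actE toK // linearZ /= b_eq.
Qed.

Lemma kset_hom M (b : X -> M) :
  {in G, forall g x, gmact M g (b x) = b (to x g)} ->
  exists f : ghom kset M, forall x, f (kdelta x) = b x.
Proof.
move=> b_eq; exists (mkghom (kset_hom_lin b) (kset_hom_eq b_eq)) => x.
rewrite mkghomE (bigD1 x) //= big1 ?addr0 => [|y /negPf nyx].
  by rewrite ffunE eqxx scale1r.
by rewrite ffunE nyx scale0r.
Qed.

Lemma kset_hom_ext M (f h : ghom kset M) :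
  (forall x, f (kdelta x) = h (kdelta x)) -> f =1 h.
Proof.
move=> E v; rewrite [v]kset_sum !linear_sum /=; apply: eq_bigr => x _.
by rewrite !linearZ /= E.
Qed.

End KSet.

Definition permmod (S : {set gT} -> Prop) (P : gmod F G) : Prop :=
  exists (X : finType) (to : action G X),
    (forall x, S (gstab to x)) /\ giso P (kset to).

Definition any_stab (_ : {set gT}) : Prop := True.
(** For C = 1 the action is free. In general the second kind of orbit arises by inflating free
    modules of a quotient by C. *)
Definition stab1 (C : {set gT}) (H : {set gT}) : Prop := H = 1%g \/ H = C.

Lemma permmod_iso S P Q : giso P Q -> permmod S P -> permmod S Q.
Proof.
move=> PQ [X [to [St iP]]]; exists X, to; split=> //.
exact: giso_trans (giso_sym PQ) iP.
Qed.

Lemma permmod_any S P : permmod S P -> permmod any_stab P.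
Proof. by case=> X [to [_ iP]]; exists X, to. Qed.

Lemma permmod_sub (S S' : {set gT} -> Prop) P :
  (forall H, S H -> S' H) -> permmod S P -> permmod S' P.
Proof.
by move=> SS [X [to [St iP]]]; exists X, to; split=> // x; apply/SS/St.
Qed.

Definition sum_act (X Y : finType) (toX : action G X) (toY : action G Y)
    (z : X + Y) (g : gT) : X + Y :=
  match z with inl x => inl (toX x g) | inr y => inr (toY y g) end.

Lemma sum_is_action (X Y : finType) (toX : action G X) (toY : action G Y) :
  is_action G (sum_act toX toY).
Proof.
split=> [g [x|y] [x'|y'] //= [/act_inj->]//|z g h Gg Gh].
by case: z => x /=; rewrite toM.
Qed.

Lemma kset_sum_iso (X Y : finType) (toX : action G X) (toY : action G Y) :
  giso (gprod (kset toX) (kset toY)) (kset (Action (sum_is_action toX toY))).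
Proof.
pose f (x : gprod (kset toX) (kset toY)) : kset (Action (sum_is_action toX toY)) :=
  [ffun z => match z with inl a => x.1 a | inr b => x.2 b end].
have lin_f : linear f.
  by move=> a [u v] [u' v']; apply/ffunP => [[x|y]]; rewrite !ffunE.
have f_eq : {in G, forall g u, f (gmact _ g u) = gmact _ g (f u)}.
  move=> g Gg [u v]; apply/ffunP => z; rewrite kset_actE !ffunE.
  by case: z => x; rewrite /= ?kset_actE.
apply: (giso_bij (f := mkghom lin_f f_eq)) => [[u v] [u' v'] /ffunP E|v].
  by congr pair; apply/ffunP => x;
     [have := E (inl x) | have := E (inr x)]; rewrite !ffunE.
exists ([ffun x => v (inl x)], [ffun x => v (inr x)]).
by apply/ffunP => [[x|y]]; rewrite !ffunE.
Qed.

Lemma permmod_prod S P Q : permmod S P -> permmod S Q -> permmod S (gprod P Q).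
Proof.
case=> X [toX [SX iX]] [Y [toY [SY iY]]].
exists (X + Y)%type, (Action (sum_is_action toX toY)); split; last first.
  exact: giso_trans (giso_prod iX iY) (kset_sum_iso _ _).
have fix_sum z : gstab (Action (sum_is_action toX toY)) z =
    match z with inl x => gstab toX x | inr y => gstab toY y end.
  by case: z => x; apply/setP => g; apply/gstabP/gstabP => -[Gg E];
     split=> //; first [by case: E | by rewrite /= E].
by move=> z; rewrite fix_sum; case: z.
Qed.

Lemma permmod_zero S M : is_zero M -> permmod S M.
Proof.
move=> M0; have ax : is_action G (fun (x : void) (_ : gT) => x) by split; [move=> g [] | case].
exists void, (Action ax); split; first by case.
apply: (giso_bij (f := g0map _ _)) => [u v _|v]; first by rewrite [u]M0 [v]M0.
by exists 0; apply/ffunP => [[]].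
Qed.

(* This says that H^1(C, N) = 0. *)
Definition acyclic (C : {set gT}) (N : gmod F G) : Prop :=
  forall (B M : gmod F G) (i : ghom N B) (s : ghom B M), gexact i s ->
  forall m, {in C, forall g, gmact M g m = m} ->
  exists b, s b = m /\ {in C, forall g, gmact B g b = b}.

Lemma acyclic1 N : acyclic 1%g N.
Proof.
move=> B M i s [_ sur _] m _; have [b <-] := sur m; exists b; split=> // g /set1P->.
by rewrite gmact1.
Qed.

(** A map on kX amounts to one vector per orbit, fixed by the stabilizer of a point. Such a vector
    lifts to a fixed vector of B when the stabilizer is 1, and also when it is C since H^1(C, N) =
    0. *)
Lemma permmod_lift (C : {set gT}) N (B M P : gmod F G) (i : ghom N B) (s : ghom B M) (f : ghom P M) :
  gexact i s -> acyclic C N -> permmod (stab1 C) P ->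
  exists l : ghom P B, forall x, s (l x) = f x.
Proof.
move=> exs acN [X [to [SX [iP [jP [ij ji]]]]]].
have /fin_all_exists[b bP] : forall x : X, exists b,
    s b = f (jP (kdelta to x)) /\ {in gstab to x, forall g, gmact B g b = b}.
  move=> x; have fix_m : {in gstab to x, forall g,
      gmact M g (f (jP (kdelta to x))) = f (jP (kdelta to x))}.
    move=> g /gstabP[Gg xg].
    by rewrite -!ghomE // kdelta_act // xg.
  case: (SX x) => E; rewrite E in fix_m *; last exact: acN exs _ fix_m.
  exact: acyclic1 exs _ fix_m.
have [r r_act rP] := orbit_rep to; have /fin_all_exists[t tP] := rP.
(* The lift chosen at the orbit representative is carried to x; which [t x] carries it does not
   matter, as the lift is fixed by the stabilizer. *)
pose c x := gmact B (t x) (b (r x)).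
have c_eq : {in G, forall g x, gmact B g (c x) = c (to x g)}.
  move=> g Gg x; have [Gt tx] := tP x; have [Gt' tx'] := tP (to x g).
  rewrite /c -gmactM // r_act //.
  have Gu : (t x * g * (t (to x g))^-1)%g \in gstab to (r x).
    apply/gstabP; rewrite !groupM ?groupV //; split=> //.
    rewrite toM ?groupM ?groupV // toM // tx.
    by have := toK to (r (to x g)) Gt'; rewrite tx' r_act.
  have [_ fb] := bP (r x).
  by rewrite -{2}(fb _ Gu) -gmactM ?mulgKV ?groupM ?groupV.
have [l lE] := kset_hom c_eq.
exists (gcomp l iP) => x /=.
have E : gcomp s l =1 gcomp f jP.
  apply: kset_hom_ext => x' /=; rewrite lE /c.
  have [Gt tx] := tP x'; have [sb _] := bP (r x').
  by rewrite ghomE // sb -!ghomE // kdelta_act // tx.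
by have := E (iP x); rewrite /= ij.
Qed.

End PermModules.

Arguments any_stab {gT} _.

(** * The class W and its closure properties *)

Section Resolutions.

Variables (F : fieldType) (gT : finGroupType) (G : {group gT}).
Implicit Types (A B M N P Q Z : gmod F G) (C D : {set gT}).


Local Notation freemod := (permmod (stab1 1%g)).

(** Acyclicity is imposed on every syzygy: in the horseshoe lemma each of them becomes in turn the
    left-hand term of an extension along which covers must lift. *)
Fixpoint fres D n M : Prop :=
  acyclic D M /\
  if n is n'.+1 then exists P Z, [/\ permmod any_stab P, ses Z P M & fres D n' Z]
  else is_zero M.

Fixpoint res C D m n M : Prop :=
  if m is m'.+1 then
    acyclic D M /\ exists P Z, [/\ permmod (stab1 C) P, ses Z P M & res C D m' n Z]
  else fres D n M.

Lemma acyclic_iso D M N : giso M N -> acyclic D M -> acyclic D N.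
Proof.
case=> f [h [fh hf]] acM B L i s [inj_i sur_s ks]; apply: (acM _ _ (gcomp i f)).
split=> [x y /= /inj_i/(can_inj fh)//|//|v].
split=> [/ks[u <-]|[u <-]]; first by exists (h u); rewrite /= hf.
by apply/ks; exists (f u).
Qed.

Lemma ses_isor Z P M N : giso M N -> ses Z P M -> ses Z P N.
Proof. by move=> iMN; apply: ses_iso iMN; apply: giso_refl. Qed.

Lemma ses_isol Z Z' P M : giso Z Z' -> ses Z P M -> ses Z' P M.
Proof. by move=> i; apply: ses_iso i _ _; apply: giso_refl. Qed.

Lemma fres_iso D n M N : giso M N -> fres D n M -> fres D n N.
Proof.
move=> iMN; case: n => [|n] [acM b]; (split; first exact: acyclic_iso acM).
  exact: zero_iso b.
by case: b => P [Z [pP sZ rZ]]; exists P, Z; split=> //; apply: ses_isor sZ.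
Qed.

Lemma res_iso C D m n M N : giso M N -> res C D m n M -> res C D m n N.
Proof.
move=> iMN; case: m => [|m]; first exact: fres_iso.
case=> acM [P [Z [pP sZ rZ]]]; split; first exact: acyclic_iso acM.
by exists P, Z; split=> //; apply: ses_isor sZ.
Qed.

Lemma fres_res C D m n M : res C D m n M -> fres D (m + n) M.
Proof.
elim: m M => [|m IHm] M // [acM [P [Z [pP sZ rZ]]]]; split=> //.
by exists P, Z; split; [apply: permmod_any pP | | apply: IHm].
Qed.

Lemma res_shift C D m d n M : res C D (m + d) n M -> res C D m (d + n) M.
Proof.
elim: m M => [|m IHm] M; first exact: fres_res.
case=> acM [P [Z [pP sZ rZ]]]; split=> //.
by exists P, Z; split=> //; apply: IHm.
Qed.

(** P is absorbed into the first term, with the same kernel; the length grows only when there is no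
    term at all. *)
Lemma res_add C m n M P : permmod (stab1 C) P -> res C 1%g m n M ->
  exists n', res C 1%g m n' (gprod M P).
Proof.
move=> pP; case: m => [|m] /=.
  case: n => [|n] [_].
    move=> M0; exists 1%N; split; first exact: acyclic1.
    exists P, (gzero F G); split; first exact: permmod_any pP.
      apply: ses_isor (ses_zerol _ (@gzero0 F gT G)).
      exact: giso_trans (giso_zeror _ M0) (giso_prodC _ _).
    by split; [apply: acyclic1 | apply: gzero0].
  case=> Q [Z [pQ sZ rZ]]; exists n.+1; split; first exact: acyclic1.
  exists (gprod Q P), Z; split=> //; first by apply: permmod_prod (permmod_any pP).
  apply: ses_isol (ses_prod sZ (ses_zerol P (@gzero0 F gT G))).
  exact/giso_sym/giso_zeror/gzero0.
case=> _ [Q [Z [pQ sZ rZ]]]; exists n; split; first exact: acyclic1.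
exists (gprod Q P), Z; split=> //; first by apply: permmod_prod.
apply: ses_isol (ses_prod sZ (ses_zerol P (@gzero0 F gT G))).
exact/giso_sym/giso_zeror/gzero0.
Qed.

Lemma horseshoe_cover C A B M P Q ZA ZM :
  ses A B M -> ses ZA P A -> acyclic C A -> permmod (stab1 C) Q -> ses ZM Q M ->
  exists ZB, ses ZA ZB ZM /\ ses ZB (gprod P Q) B.
Proof.
case=> i [s exs] sP acA pQ [z [q exq]].
have [l lE] := permmod_lift q exs acA pQ.
exact: horseshoe exs sP exq lE.
Qed.

Lemma horseshoe_fres C A B M n b n' :
  ses A B M -> fres C n A -> res C 1%g b n' M -> (n <= b)%N ->
  exists n'', fres 1%g n'' B.
Proof.
elim: n A B M b => [|n IHn] A B M b sB [acA].
  move=> A0 rM _; exists (b + n')%N; apply: fres_iso (fres_res rM).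
  exact/giso_sym/(ses_zerol_iso A0 sB).
case=> P [ZA [pP sA rA]] ; case: b => // b [_ [Q [ZM [pQ sM rM]]]] le_nb.
have [ZB [sZ sZB]] := horseshoe_cover sB sA acA pQ sM.
have [n'' rB] := IHn _ _ _ _ sZ rA rM le_nb.
exists n''.+1; split; first exact: acyclic1.
by exists (gprod P Q), ZB; split=> //; apply: permmod_prod (permmod_any pQ).
Qed.

Lemma horseshoe_res C A B M m n b n' :
  ses A B M -> res 1%g C m n A -> res C 1%g b n' M -> (m + n <= b)%N ->
  exists n'', res C 1%g m n'' B.
Proof.
elim: m A B M b => [|m IHm] A B M b sB; first exact: horseshoe_fres sB.
case=> acA [P [ZA [pP sA rA]]]; case: b => // b [_ [Q [ZM [pQ sM rM]]]] le_nb.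
have [ZB [sZ sZB]] := horseshoe_cover sB sA acA pQ sM.
have [n'' rB] := IHm _ _ _ _ sZ rA rM le_nb.
exists n''; split; first exact: acyclic1.
exists (gprod P Q), ZB; split=> //; apply: permmod_prod => //.
by apply: permmod_sub pP => H [->|->]; left.
Qed.

(* The arbitrarily long free (when C = 1) beginning is what makes the horseshoe
   lemma apply: a free module lifts along B -> M, a permutation module does not,
   so the resolution of A must be over before that of M stops being free. *)
Definition WW C D M : Prop := forall m, exists N n, res C D m n (gprod M N).

Lemma WW_iso C D M N : giso M N -> WW C D M -> WW C D N.
Proof.
move=> iMN wM m; have [L [n rL]] := wM m; exists L, n.
by apply: res_iso rL; apply: giso_prod iMN (giso_refl _).
Qed.

Lemma WW_summand C D M N : WW C D (gprod M N) -> WW C D M.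
Proof.
move=> wM m; have [L [n rL]] := wM m; exists (gprod N L), n.
exact: res_iso (giso_sym (giso_prodA _ _ _)) rL.
Qed.

Lemma WW_retract C D M Z (s : ghom M Z) (r : ghom Z M) :
  (forall m, r (s m) = m) -> WW C D Z -> WW C D M.
Proof.
case/retract_summand=> N iN wZ; apply: (WW_summand (N := N)).
exact: WW_iso iN wZ.
Qed.

Lemma WW_ext C A B M : ses A B M -> WW 1%g C A -> WW C 1%g M -> WW C 1%g B.
Proof.
move=> sB wA wM m; have [NA [n rA]] := wA m.
(* The number of leading terms for M is chosen after the length of the resolution of A is known. *)
have [NM [n' rM]] := wM (m + n)%N.
have [n'' rB] := horseshoe_res (ses_prod sB (ses_addl NA NM)) rA rM (leqnn _).
by exists (gprod NA NM), n''.
Qed.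

Lemma res_perm C m P : permmod (stab1 C) P -> exists n, res C 1%g m n P.
Proof.
move=> pP; have Z0 n : fres 1%g n (gzero F G).
  elim: n => [|n IHn] /=; split=> //; try exact: acyclic1; first exact: gzero0.
  exists (gzero F G), (gzero F G); split=> //; first exact/permmod_zero/gzero0.
  exact/ses_zerol/gzero0.
have r0 k n : res C 1%g k n (gzero F G).
  elim: k => [|k IHk] //=; split; first exact: acyclic1.
  exists (gzero F G), (gzero F G); split=> //; first exact/permmod_zero/gzero0.
  exact/ses_zerol/gzero0.
have [n rn] := res_add pP (r0 m 0); exists n; apply: res_iso rn.
exact/giso_sym/(giso_trans (giso_zeror _ (@gzero0 F gT G)))/giso_prodC.
Qed.

Lemma WW_perm C P : permmod (stab1 C) P -> WW C 1%g P.
Proof.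
move=> /res_perm rP m; have [n rn] := rP m; exists (gzero F G), n.
exact: res_iso (giso_zeror _ (@gzero0 F gT G)) rn.
Qed.

Lemma free_split A B P : ses A B P -> freemod P -> giso B (gprod P A).
Proof.
case=> i [s exs] pP; have [t tK] := permmod_lift (gid P) exs (@acyclic1 _ _ _ A) pP.
exact: split_ses exs tK.
Qed.

(** Both sums are the pullback of P and Q over M, which splits over either of them. *)
Lemma schanuel A P B Q M : ses A P M -> ses B Q M -> freemod P -> freemod Q ->
  giso (gprod A Q) (gprod B P).
Proof.
move=> sA sB fP fQ; have [X [sX sX']] := pullback_ses sA sB.
apply: giso_trans (giso_prodC _ _) _; apply: giso_trans _ (giso_prodC _ _).
by apply: giso_trans (giso_sym (free_split sX fQ)) (free_split sX' fP).
Qed.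

(** All of [gT] replaces G: it is a union of free G-orbits, and the formula makes sense without
    membership conditions. *)
Definition freg_act (n : nat) (z : 'I_n * gT) (g : gT) := (z.1, (z.2 * g)%g).

Lemma freg_is_action n : is_action G (@freg_act n).
Proof.
split=> [g [i x] [j y] [-> /mulIg->]//|[i x] g h _ _].
by rewrite /freg_act mulgA.
Qed.

Lemma freg_free n : freemod (kset F (Action (freg_is_action n))).
Proof.
exists _, (Action (freg_is_action n)); split; last exact: giso_refl.
move=> [i x]; left; apply/setP => g; apply/gstabP/set1P => [[_ E]|->].
  by apply: (mulgI x); rewrite mulg1; apply: (congr1 snd E).
by rewrite group1 act1.
Qed.

Lemma free_cover M : exists P Z, freemod P /\ ses Z P M.
Proof.
pose n := \dim (fullv : {vspace M}); pose e := vbasis (fullv : {vspace M}).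
pose to := Action (freg_is_action n).
pose b (z : 'I_n * gT) : M := if z.2 \in G then gmact M z.2 e`_z.1 else 0.
have b_eq : {in G, forall g z, gmact M g (b z) = b (to z g)}.
  move=> g Gg [i x]; rewrite /b /= groupMr //.
  by case: ifP => Gx; rewrite ?linear0 ?gmactM.
have [f fE] := kset_hom b_eq.
have sur_f v : exists u, f u = v.
  exists (\sum_i coord e i v *: kdelta F to (i, 1%g)).
  rewrite linear_sum [v in RHS](coord_vbasis (memvf v)); apply: eq_bigr => i _.
  by rewrite linearZ fE /b /= group1 gmact1.
have [Z sZ] := surj_ses sur_f.
by exists (kset F to), Z; split=> //; apply: freg_free.
Qed.

(** Dual to [free_cover]: v is recorded through the coordinates of its translates v x^-1, among
    which those for x = 1 determine v. *)
Lemma free_embedding M : exists P Z, freemod P /\ ses M P Z.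
Proof.
pose n := \dim (fullv : {vspace M}); pose e := vbasis (fullv : {vspace M}).
pose to := Action (freg_is_action n).
pose f (v : M) : kset F to :=
  [ffun z : 'I_n * gT => if z.2 \in G then coord e z.1 (gmact M z.2^-1 v) else 0].
have lin_f : linear f.
  move=> a u v; apply/ffunP => [[i x]]; rewrite !ffunE /=.
  by case: ifP; rewrite ?linearP // scaler0 addr0.
have f_eq : {in G, forall g v, f (gmact M g v) = gmact (kset F to) g (f v)}.
  move=> g Gg v; apply/ffunP => [[i x]]; rewrite kset_actE !ffunE /=.
  rewrite groupMr ?groupV //; case: ifP => // Gx.
  by rewrite -gmactM ?groupV // invMg invgK.
have inj_f : injective (mkghom lin_f f_eq).
  move=> u v /ffunP E.
  rewrite [u](coord_vbasis (memvf u)) [v](coord_vbasis (memvf v)).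
  apply: eq_bigr => i _; congr (_ *: _).
  by have := E (i, 1%g); rewrite !ffunE /= group1 invg1 !gmact1.
have [Z sZ] := inj_ses inj_f.
by exists (kset F to), Z; split=> //; apply: freg_free.
Qed.

(** A relation, because syzygies depend on the free covers and are unique only up to free
    summands. *)
Fixpoint syz j M Z : Prop :=
  if j is j'.+1 then exists P Z', [/\ freemod P, ses Z' P M & syz j' Z' Z]
  else giso M Z.

Lemma syz_exists j M : exists Z, syz j M Z.
Proof.
elim: j M => [|j IHj] M; first by exists M; apply: giso_refl.
by have [P [Z [pP sZ]]] := free_cover M; have [Z' zZ] := IHj Z; exists Z', P, Z.
Qed.

Lemma syz_snoc j L M P N : syz j L M -> ses N P M -> freemod P -> syz j.+1 L N.
Proof.
move=> zM sN pP; elim: j L zM => [|j IHj] L.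
  move=> iLM; exists P, N; split=> //; last exact: giso_refl.
  exact: ses_isor (giso_sym iLM) sN.
by case=> Q [Z [pQ sZ zZ]]; exists Q, Z; split=> //; apply: IHj.
Qed.

Lemma cosyz j N : exists L, syz j L N.
Proof.
elim: j N => [|j IHj] N; first by exists N; apply: giso_refl.
have [P [Z [pP sZ]]] := free_embedding N.
by have [L zL] := IHj Z; exists L; apply: syz_snoc zL sZ pP.
Qed.

Lemma syz_prod j M Z M' Z' :
  syz j M Z -> syz j M' Z' -> syz j (gprod M M') (gprod Z Z').
Proof.
elim: j M M' => [|j IHj] M M'; first exact: giso_prod.
case=> P [N [pP sN zN]] [P' [N' [pP' sN' zN']]].
exists (gprod P P'), (gprod N N'); split; last exact: IHj.
  exact: permmod_prod.
exact: ses_prod.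
Qed.

Lemma syz_res C j M Z m n :
  syz j M Z -> res C 1%g m n Z -> res C 1%g (j + m) n M.
Proof.
move=> zZ rZ; elim: j M zZ => [|j IHj] M.
  by move/giso_sym=> iZM; apply: res_iso rZ.
case=> P [N [pP sN zN]]; split; first exact: acyclic1.
exists P, N; split=> //; last exact: IHj.
by apply: permmod_sub pP => H [->|->]; left.
Qed.

Lemma horseshoe_free A B M P Q ZA ZM :
  ses A B M -> ses ZA P A -> ses ZM Q M -> freemod P -> freemod Q ->
  exists Z, ses ZA Z ZM /\ ses Z (gprod P Q) B.
Proof.
by move=> sB sA sM fP fQ; apply: horseshoe_cover sB sA _ fQ sM; apply: acyclic1.
Qed.

Lemma syz_ses j A B M A' M' : ses A B M -> syz j A A' -> syz j M M' ->
  exists B', syz j B B' /\ ses A' B' M'.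
Proof.
elim: j A B M => [|j IHj] A B M sB.
  by move=> iA iM; exists B; split; [apply: giso_refl | apply: ses_iso sB => //; apply: giso_refl].
case=> P [ZA [fP sA zA]] [Q [ZM [fQ sM zM]]].
have [Z [sZ sZB]] := horseshoe_free sB sA sM fP fQ.
have [B' [zB' sB']] := IHj _ _ _ sZ zA zM.
exists B'; split=> //; exists (gprod P Q), Z; split=> //; exact: permmod_prod.
Qed.

Local Notation W := (WW 1%g 1%g).

(** One more free term is requested for M. By Schanuel's lemma the first syzygy in that resolution
    is, up to free summands, Z plus a syzygy of the complement. *)
Lemma W_syz Z P M : ses Z P M -> freemod P -> W M -> W Z.
Proof.
move=> sZ fP wM m; have [N [n [_ [Q [Z' [fQ sZ' rZ']]]]]] := wM m.+1.
have [R [ZN [fR sN]]] := free_cover N.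
have iZ := schanuel (ses_prod sZ sN) sZ' (permmod_prod fP fR) fQ.
have [n' rn] := res_add (permmod_prod fP fR) rZ'.
exists (gprod ZN Q), n'; apply: res_iso rn.
exact: giso_trans (giso_sym iZ) (giso_sym (giso_prodA _ _ _)).
Qed.

(** If the complement N of Z is embedded in a free module Q, then Z + N is the first syzygy of M +
    Q/N. *)
Lemma W_cosyz Z P M : ses Z P M -> freemod P -> W Z -> W M.
Proof.
move=> sZ fP wZ m; have [N [n rZ]] := wZ m.
have [Q [L [fQ sL]]] := free_embedding N.
exists L, n.+1; rewrite -[n.+1]add1n; apply: res_shift; rewrite addn1.
split; first exact: acyclic1.
exists (gprod P Q), (gprod Z N); split=> //; first exact: permmod_prod.
exact: ses_prod.
Qed.

(** Let X be the kernel of a free cover of B followed by B -> M. It is an extension of A by a syzygy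
    of B, and M is its cosyzygy. *)
Lemma W_quo A B M : ses A B M -> W A -> W B -> W M.
Proof.
move=> sB wA wB; have [P [Z [fP sZ]]] := free_cover B.
have [X [sX sX']] := comp_ses sZ sB.
apply: (W_cosyz sX' fP); apply: (WW_ext sX) wA; exact: W_syz sZ fP wB.
Qed.

(** The pullback of B and a free cover P of M is A + P, P being projective; it is also an extension
    of B by a syzygy of M. *)
Lemma W_sub A B M : ses A B M -> W B -> W M -> W A.
Proof.
move=> sB wB wM; have [P [Z [fP sZ]]] := free_cover M.
have [X [sX sX']] := pullback_ses sB sZ.
apply: (@WW_summand _ _ _ P); apply: WW_iso (giso_prodC _ _) _.
apply: WW_iso (free_split sX fP) _.
by apply: (WW_ext sX') wB; apply: W_syz sZ fP wM.
Qed.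

Lemma W_prod A B : W A -> W B -> W (gprod A B).
Proof. by move=> wA wB; apply: WW_ext (ses_addl A B) wA wB. Qed.

Lemma W_zero M : is_zero M -> W M.
Proof. by move=> M0; apply: WW_perm; apply: permmod_zero. Qed.

(* The sequence 0 -> Q -> Q/K x M -> M/K -> 0 is exact. *)
Lemma W_factor K Q M R (i : ghom K Q) (f : ghom Q M) (s : ghom M R) :
  gexact (gcomp f i) s -> W Q -> W R -> W K.
Proof.
move=> exs wQ wR; have [inj_fi sur_s ks] := exs.
have inj_i : injective i by move=> x y E; apply: inj_fi; rewrite /= E.
have [Q' [q exq]] := coker_exact inj_i; have [_ sur_q kq] := exq.
have [h hE] : exists h : ghom Q' R, forall x, h (q x) = s (f x).
  apply: (gfactor_surj (f := gcomp s f)) => // x /kq[u <-].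
  exact: (exact0 u exs).
have sQ : ses Q (gprod Q' M) R.
  exists (gpair q f), (gcopair (gopp h) s); split.
  - move=> x y [Eq Ef]; apply/eqP; rewrite -subr_eq0; apply/eqP.
    have /kq[u ui] : q (x - y) = 0 by rewrite linearB Eq subrr.
    rewrite -ui; have -> : u = 0; last exact: linear0.
    by apply: inj_fi; rewrite /= ui linearB Ef subrr !linear0.
  - move=> r; have [m sm] := sur_s r; exists (0, m).
    by rewrite /= linear0 oppr0 add0r.
  move=> [x m]; split=> /= [E|[y [<- <-]]]; last by rewrite hE addNr.
  have [y qy] := sur_q x.
  have /ks[u fu] : s (m - f y) = 0.
    by rewrite linearB -hE qy; move: E; rewrite addrC.
  exists (y + i u); congr pair; last by rewrite linearD [f (i u)]fu addrC subrK.
  by rewrite linearD qy (exact0 _ exq) addr0.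
have wM : W M.
  apply: (@WW_summand _ _ _ Q'); apply: WW_iso (giso_prodC _ _) _.
  exact: WW_ext sQ wQ wR.
by apply: W_sub wM wR; exists (gcomp f i), s.
Qed.

End Resolutions.

Local Notation W := (WW 1%g 1%g).
Local Notation freemod := (permmod (stab1 1%g)).

Section MkAct.

Variables (gT : finGroupType) (G : {group gT}) (X : finType).
Variable s : X -> gT -> X.
Hypotheses (s1 : forall x, s x 1%g = x)
  (sM : {in G &, forall g h x, s x (g * h)%g = s (s x g) h}).

(** An action must be injective at every element of [gT], and s is controlled on G only; hence the
    identity elsewhere. *)
Lemma mkact_subproof : is_action G (fun x g => if g \in G then s x g else x).
Proof.
split=> [g x y|x g h Gg Gh]; last by rewrite groupM // Gg Gh sM.
case: ifP => // Gg /(congr1 (s^~ g^-1%g)).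
by rewrite -!sM ?groupV // mulgV !s1.
Qed.

Definition mkact : action G X := Action mkact_subproof.

Lemma mkactE x g : g \in G -> mkact x g = s x g.
Proof. by move=> Gg; rewrite /= Gg. Qed.

End MkAct.

(** * Restriction, induction, and blocks permuted by the group *)

Section Restriction.

Variables (F : fieldType) (gT : finGroupType) (G H : {group gT}).
Hypothesis sHG : H \subset G.

Definition gres (V : gmod F G) : gmod F H :=
  @Gmod F gT H V (gmact V) (@gmact1 F gT G V)
    (sub_in2 (subsetP sHG) (@gmactM F gT G V)).

End Restriction.

Section Induction.

Variables (F : fieldType) (gT : finGroupType) (G H : {group gT}).
Hypothesis sHG : H \subset G.
Implicit Types (L : gmod F H) (V : gmod F G).

Definition rcos := {c : {set gT} | c \in rcosets H G}.
Implicit Types c : rcos.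

Definition crep c : gT := repr (val c).

Lemma rcosE c : val c = H :* crep c.
Proof.
rewrite /crep; case: c => _ /= /rcosetsP[x _ ->].
by apply/esym/rcoset_eqP/mem_repr_rcoset.
Qed.

Lemma crep_in c : crep c \in G.
Proof.
have /rcosetsP[x Gx E] := valP c; rewrite /crep E.
by apply: subsetP (mem_repr_rcoset H x); rewrite mul_subG ?sub1set.
Qed.

Lemma mem_rcos x : x \in G -> H :* x \in rcosets H G.
Proof. by move=> Gx; apply/rcosetsP; exists x. Qed.

Definition mkrcos x (Gx : x \in G) : rcos :=
  exist (fun c : {set gT} => c \in rcosets H G) (H :* x) (mem_rcos Gx).

Lemma crep_mkrcos x (Gx : x \in G) : exists2 h, h \in H & crep (mkrcos Gx) = (h * x)%g.
Proof. by case/rcosetP: (mem_repr_rcoset H x) => h Hh E; exists h. Qed.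

Definition rcos_act : action G rcos.
Proof.
apply: (@mkact gT G rcos (fun c g => insubd c (val c :* g))).
- by move=> c; apply: val_inj; rewrite val_insubd mulg1 (valP c).
- move=> g h Gg Gh c; apply: val_inj.
  have E k : k \in G -> val c :* k \in rcosets H G.
    by move=> Gk; rewrite rcosE -rcosetM mem_rcos ?groupM ?crep_in.
  rewrite [RHS]val_insubd !val_insubd !E ?groupM //.
  by rewrite -mulgA mulg_set1 E ?groupM // .
Defined.

Lemma rcos_actE c g : g \in G -> val (rcos_act c g) = H :* (crep c * g).
Proof.
move=> Gg; rewrite mkactE // val_insubd rcosE -rcosetM.
by rewrite mem_rcos ?groupM ?crep_in.
Qed.

(** The H-valued cocycle of the chosen representatives: crep c * g = ccoc c g * crep (c g). *)
Definition ccoc c g : gT := (crep c * g * (crep (rcos_act c g))^-1)%g.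

Lemma ccoc_in c g : g \in G -> ccoc c g \in H.
Proof.
by move=> Gg; rewrite /ccoc -mem_rcoset -rcosE rcos_actE // rcoset_refl.
Qed.

Lemma ccocM c g h : g \in G -> h \in G ->
  ccoc c (g * h) = (ccoc c g * ccoc (rcos_act c g) h)%g.
Proof. by move=> Gg Gh; rewrite /ccoc toM // !mulgA mulgKV. Qed.

Lemma ccoc1 c : ccoc c 1 = 1%g.
Proof. by rewrite /ccoc act1 mulg1 mulgV. Qed.

(** L tensored with kG over kH: the value of a function at c stands for the component L tensor
    [crep c]. *)
Definition Ind L : gmod F G.
Proof.
pose a g (f : {ffun rcos -> L}) := [ffun c =>
  gmact L (ccoc (rcos_act c g^-1%g) g) (f (rcos_act c g^-1%g))].
apply: (@mkgmod F gT G {ffun rcos -> L} a).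
- by move=> g b f h; apply/ffunP => c; rewrite !ffunE linearP.
- by move=> f; apply/ffunP => c; rewrite ffunE invg1 act1 ccoc1 gmact1.
- move=> g h Gg Gh f; apply/ffunP => c; rewrite !ffunE invMg toM ?groupV //.
  by rewrite ccocM // gmactM ?ccoc_in // toKV.
Defined.

Lemma Ind_actE L g (f : Ind L) c : g \in G ->
  gmact (Ind L) g f (rcos_act c g) = gmact L (ccoc c g) (f c).
Proof. by move=> Gg; rewrite [LHS]ffunE toK. Qed.

Lemma Ind_eq L g (f h : Ind L) : g \in G ->
  (forall c, gmact L (ccoc c g) (f c) = h (rcos_act c g)) -> gmact (Ind L) g f = h.
Proof.
move=> Gg E; apply/ffunP => c; rewrite -(toKV rcos_act c Gg).
by rewrite Ind_actE.
Qed.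

Lemma Ind_hom_lin L L' (f : ghom L L') :
  linear (fun u : Ind L => [ffun c => f (u c)] : Ind L').
Proof. by move=> a u v; apply/ffunP => c; rewrite !ffunE linearP. Qed.

Definition Ind_hom L L' (f : ghom L L') : ghom (Ind L) (Ind L').
Proof.
apply: (@mkghom F gT G (Ind L) (Ind L') _ (Ind_hom_lin f)) => g Gg u; apply/esym/Ind_eq => // c.
by rewrite [X in gmact _ _ X]ffunE [RHS]ffunE Ind_actE // ghomE ?ccoc_in.
Defined.

Lemma Ind_homE L L' (f : ghom L L') u c : Ind_hom f u c = f (u c).
Proof. by rewrite [LHS]ffunE. Qed.

Lemma ses_Ind A B M : ses A B M -> ses (Ind A) (Ind B) (Ind M).
Proof.
case=> i [s exs]; have [inj_i sur_s ks] := exs.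
exists (Ind_hom i), (Ind_hom s); split=> [u v /ffunP E|w|v].
- by apply/ffunP => c; apply: inj_i; have := E c; rewrite !Ind_homE.
- have /fin_all_exists[t tE] c := sur_s (w c).
  by exists [ffun c => t c]; apply/ffunP => c; rewrite Ind_homE ffunE.
split=> [/ffunP E|[u <-]]; last first.
  by apply/ffunP => c; rewrite !Ind_homE (exact0 _ exs) ffunE.
have /fin_all_exists[t tE] c : exists u, i u = v c.
  by apply/ks; have := E c; rewrite Ind_homE ffunE.
by exists [ffun c => t c]; apply/ffunP => c; rewrite Ind_homE ffunE.
Qed.

Lemma Ind_iso L L' : giso L L' -> giso (Ind L) (Ind L').
Proof.
case=> f [h [fh hf]]; exists (Ind_hom f), (Ind_hom h).
by split=> u; apply/ffunP => c; rewrite !Ind_homE.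
Qed.

Lemma Ind_zero L : is_zero L -> is_zero (Ind L).
Proof. by move=> L0 f; apply/ffunP => c; rewrite ffunE [f c]L0. Qed.

Lemma Ind_prod L L' : giso (Ind (gprod L L')) (gprod (Ind L) (Ind L')).
Proof.
apply: (giso_bij (f := gpair (Ind_hom (gfst L L')) (Ind_hom (gsnd L L')))).
  move=> u v [/ffunP E1 /ffunP E2]; apply/ffunP => c.
  have := E1 c; have := E2 c; rewrite !ffunE /=.
  by case: (u c) (v c) => [x y] [x' y'] /= -> ->.
move=> [u v]; exists [ffun c => (u c, v c)].
by congr pair; apply/ffunP => c; rewrite Ind_homE ffunE.
Qed.

Section IndPerm.
Variables (X : finType) (to : action H X).

Definition ind_act : action G (rcos * X)%type.
Proof.
apply: (@mkact gT G _ (fun z g => (rcos_act z.1 g, to z.2 (ccoc z.1 g)))).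
  by case=> c x; rewrite act1 ccoc1 act1.
move=> g h Gg Gh [c x]; congr pair; first exact: toM.
by rewrite [(c, x).1]/= ccocM // toM ?ccoc_in.
Defined.

Lemma Ind_kset : giso (Ind (kset F to)) (kset F ind_act).
Proof.
pose f (u : Ind (kset F to)) : kset F ind_act := [ffun z => u z.1 z.2].
have lin_f : linear f by move=> a u v; apply/ffunP => z; rewrite !ffunE.
have f_eq : {in G, forall g u, f (gmact _ g u) = gmact (kset F ind_act) g (f u)}.
  move=> g Gg u; apply/ffunP => z; rewrite -(toKV ind_act z Gg) kset_actE toK //.
  case: (ind_act z g^-1%g) => c x; rewrite mkactE // [LHS]ffunE [RHS]ffunE.
  by rewrite [(_, _).1]/= Ind_actE // kset_actE toK ?ccoc_in.
apply: (giso_bij (f := mkghom lin_f f_eq)) => [u v /ffunP E|v].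
  apply/ffunP => c; apply/ffunP => x.
  by have := E (c, x); rewrite !ffunE.
exists [ffun c => [ffun x => v (c, x)]].
by apply/ffunP => [[c x]]; rewrite !ffunE.
Qed.

Lemma ind_act_free :
  (forall x, stab1 1%g (gstab to x)) -> forall z, stab1 1%g (gstab ind_act z).
Proof.
move=> fr [c x]; left; apply/setP => g; apply/gstabP/set1P => [[Gg]|->].
  rewrite mkactE // => E; have Ec : rcos_act c g = c := congr1 fst E.
  have Ex : to x (ccoc c g) = x := congr1 snd E.
  have : ccoc c g \in gstab to x by apply/gstabP; split=> //; apply: ccoc_in.
  have -> : gstab to x = 1%g by case: (fr x).
  rewrite /ccoc Ec => /set1P/eqP; rewrite -eq_mulgV1 => /eqP Eg.
  by apply: (mulgI (crep c)); rewrite mulg1.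
by rewrite group1 act1.
Qed.

End IndPerm.

Lemma Ind_permmod P : permmod any_stab P -> permmod any_stab (Ind P).
Proof.
case=> X [to [_ iP]]; exists _, (ind_act to); split=> //.
exact: giso_trans (Ind_iso iP) (Ind_kset to).
Qed.

Lemma Ind_free P : freemod P -> freemod (Ind P).
Proof.
case=> X [to [fr iP]]; exists _, (ind_act to); split; first exact: ind_act_free.
exact: giso_trans (Ind_iso iP) (Ind_kset to).
Qed.

Lemma Ind_res C m n L : (forall L', acyclic C (Ind L')) ->
  res 1%g 1%g m n L -> res 1%g C m n (Ind L).
Proof.
move=> acI; elim: m L => [|m IHm] L /=; last first.
  case=> _ [P [Z [fP sZ rZ]]]; split=> //; exists (Ind P), (Ind Z).
  by split; [apply: Ind_free | apply: ses_Ind | apply: IHm].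
elim: n L => [|n IHn] L /= [_]; first by move=> L0; split=> //; apply: Ind_zero.
case=> P [Z [pP sZ rZ]]; split=> //; exists (Ind P), (Ind Z).
by split; [apply: Ind_permmod | apply: ses_Ind | apply: IHn].
Qed.

Lemma Ind_WW C L : (forall L', acyclic C (Ind L')) -> W L -> WW 1%g C (Ind L).
Proof.
move=> acI wL m; have [N [n rn]] := wL m; exists (Ind N), n.
exact: res_iso (Ind_prod _ _) (Ind_res acI rn).
Qed.

Lemma Ind_syz j L Z : syz j L Z -> syz j (Ind L) (Ind Z).
Proof.
elim: j L => [|j IHj] L /=; first exact: Ind_iso.
case=> P [Z' [fP sZ zZ]]; exists (Ind P), (Ind Z').
by split; [apply: Ind_free | apply: ses_Ind | apply: IHj].
Qed.

Section Frobenius.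
Variables (V : gmod F G) (pr : {linear V -> V}).
Hypothesis pr_eq : {in H, forall h v, pr (gmact V h v) = gmact V h (pr v)}.

(** The adjunction maps, twisted by an H-endomorphism pr of V so that their composite is the
    relative trace of pr from H to G. Where this trace is the identity, V is a summand of an induced
    module (Higman's criterion). *)
Definition to_Ind : ghom V (Ind (gres sHG V)).
Proof.
apply: (@mkghom F gT G V (Ind (gres sHG V))
  (fun v => [ffun c => pr (gmact V (crep c)^-1%g v)])).
  by move=> a u v; apply/ffunP => c; rewrite !ffunE !linearP.
move=> g Gg v; apply/esym/Ind_eq => // c; rewrite !ffunE /=.
rewrite -pr_eq ?ccoc_in //.
have Gc := crep_in c; have Gd := crep_in (rcos_act c g).
rewrite -!gmactM ?groupV ?(subsetP sHG _ (ccoc_in _ _)) //.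
by rewrite /ccoc !mulgA mulVg mul1g.
Defined.

Definition from_Ind : ghom (Ind (gres sHG V)) V.
Proof.
apply: (@mkghom F gT G (Ind (gres sHG V)) V
  (fun f => \sum_c gmact V (crep c) (f c))).
  move=> a u v; rewrite scaler_sumr -big_split /=; apply: eq_bigr => c _.
  by rewrite !ffunE linearP.
move=> g Gg f; rewrite (reindex_inj (@act_inj _ _ _ rcos_act g)) linear_sum.
apply: eq_bigr => c _; rewrite [f in LHS]/= Ind_actE //=.
have Gc := crep_in c; have Gd := crep_in (rcos_act c g).
rewrite -!gmactM ?(subsetP sHG _ (ccoc_in _ _)) //.
by rewrite /ccoc mulgKV.
Defined.

Lemma from_to_Ind v :
  from_Ind (to_Ind v) = \sum_c gmact V (crep c) (pr (gmact V (crep c)^-1%g v)).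
Proof. by apply: eq_bigr => c _; rewrite ffunE. Qed.

End Frobenius.

Lemma card_rcos : #|{: rcos}| = #|G : H|%g.
Proof. by rewrite card_sig. Qed.

Lemma Ind_res_retract V : #|G : H|%g%:R != 0 :> F ->
  exists (s : ghom V (Ind (gres sHG V))) (r : ghom (Ind (gres sHG V)) V),
    forall v, r (s v) = v.
Proof.
(* Division by the index has relative trace 1. *)
move=> nz; pose pr := mklin (linearP (#|G : H|%g%:R^-1 \*: idfun : {linear V -> V})).
have pr_eq : {in H, forall h v, pr (gmact V h v) = gmact V h (pr v)}.
  by move=> h Hh v; rewrite /= linearZ.
exists (to_Ind pr_eq), (from_Ind V) => v; rewrite from_to_Ind.
rewrite (eq_bigr (fun=> #|G : H|%g%:R^-1 *: v)); last first.
  by move=> c _; rewrite linearZ /= gmactKV ?crep_in.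
by rewrite sumr_const card_rcos -scaler_nat scalerA mulfV ?scale1r.
Qed.

End Induction.

Section Blocks.

Variables (F : fieldType) (gT : finGroupType) (G : {group gT}).
Implicit Types (V : gmod F G).

(** When the sum is the identity, this makes V a summand of a module in W. *)
Lemma W_sum (J : eqType) (l : seq J) V (U : J -> gmod F G)
    (s : forall j, ghom V (U j)) (r : forall j, ghom (U j) V) :
  (forall j, j \in l -> W (U j)) ->
  exists (Z : gmod F G) (s' : ghom V Z) (r' : ghom Z V),
    W Z /\ forall v, r' (s' v) = \sum_(j <- l) r j (s j v).
Proof.
elim: l => [|j l IHl] wU.
  exists (gzero F G), (g0map V _), (g0map _ V).
  by split=> [|v]; rewrite ?big_nil //; apply: W_zero; apply: gzero0.
have [i li|Z [s' [r' [wZ E]]]] := IHl; first by apply: wU; rewrite inE li orbT.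
exists (gprod (U j) Z), (gpair (s j) s'), (gcopair (r j) r'); split.
  by apply: W_prod wZ; apply: wU; rewrite inE eqxx.
by move=> v; rewrite big_cons /= E.
Qed.

Lemma gstab_group_set (X : finType) (to : action G X) x : group_set (gstab to x).
Proof.
apply/group_setP; split=> [|g h /gstabP[Gg gx] /gstabP[Gh hx]].
  by apply/gstabP; rewrite group1 act1.
by apply/gstabP; rewrite groupM // toM // gx hx.
Qed.

Definition gstab_group (X : finType) (to : action G X) x : {group gT} :=
  Group (gstab_group_set to x).

Hypothesis IH : forall H : {group gT}, H \proper G ->
  forall L : gmod F H, W L.

Lemma W_Ind (H : {group gT}) (sHG : H \subset G) (L : gmod F H) :
  H \proper G -> W (Ind sHG L).
Proof. by move=> pH; apply: Ind_WW (IH pH L) => L'; apply: acyclic1. Qed.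

(** The relative trace of [pr x] from the stabilizer of x is the sum of the [pr y] over the orbit of
    x. These traces factor through modules induced from proper subgroups and add up to the
    identity. *)
Lemma W_blocks V (X : finType) (to : action G X) (pr : X -> {linear V -> V}) :
  (forall v, \sum_x pr x v = v) ->
  {in G, forall g x v, gmact V g (pr x v) = pr (to x g) (gmact V g v)} ->
  (forall x, (exists2 g, g \in G & to x g != x) \/ forall v, pr x v = 0) -> W V.
Proof.
move=> sum_pr pr_eq nofix.
have sHG x : gstab_group to x \subset G.
  by apply/subsetP => g /gstabP[].
pose nf x := [exists g in G, to x g != x].
have propH x : nf x -> gstab_group to x \proper G.
  case/exists_inP=> g Gg ngx; rewrite properE sHG /=.
  by apply/subsetPn; exists g => //; apply: contra ngx => /gstabP[_ ->].
have pr_eqH x : {in gstab_group to x, forall h v,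
    pr x (gmact V h v) = gmact V h (pr x v)}.
  by move=> h /gstabP[Gh hx] v; rewrite pr_eq // hx.
have [r r_act rP] := orbit_rep to.
have orb x : from_Ind (sHG x) V \o to_Ind (sHG x) (@pr_eqH x)
             =1 fun v => \sum_(y | r y == r x) pr y v.
  move=> v; rewrite /comp from_to_Ind.
  rewrite (eq_bigr (fun c => pr (to x (crep c)) v)); last first.
    by move=> c _; rewrite pr_eq ?gmactKV ?(crep_in (sHG x)).
  pose h (c : rcos G (gstab_group to x)) := to x (crep c).
  have inj_h : injective h.
    move=> c d E; apply: val_inj; rewrite (rcosE c) (rcosE d).
    apply/rcoset_eqP; rewrite mem_rcoset; apply/gstabP.
    have Gc := crep_in (sHG x) c; have Gd := crep_in (sHG x) d.
    by rewrite groupM ?groupV // toM ?groupV // [to x _]E toK.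
  rewrite -[RHS]big_filter -[LHS](big_map h xpredT (fun y => pr y v)).
  apply/perm_big/uniq_perm.
  - by rewrite map_inj_uniq ?index_enum_uniq.
  - by rewrite filter_uniq ?index_enum_uniq.
  move=> y; rewrite mem_filter mem_index_enum andbT.
  apply/mapP/eqP => [[c _ ->]|Er]; first by rewrite r_act ?(crep_in (sHG x)).
  have [a [Ga xa]] := rP x; have [b [Gb yb]] := rP y.
  have Gab : (a^-1 * b)%g \in G by rewrite groupM ?groupV.
  exists (mkrcos (gstab_group to x) Gab); first by rewrite mem_index_enum.
  have [k /gstabP[Gk xk] Ec] := crep_mkrcos (gstab_group to x) Gab.
  rewrite /h Ec.
  rewrite toM // xk toM ?groupV //.
  by rewrite -[X in to (to X _) _]xa toK // -Er yb.
have rr y : r (r y) = r y.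
  by have [g [Gg E]] := rP y; rewrite -[in RHS]E r_act.
(* One representative per orbit; fixed points are left out, as their blocks vanish. *)
have [|Z [s' [q' [wZ E]]]] := @W_sum _ [seq x <- index_enum X | (r x == x) && nf x] V _
   (fun x => to_Ind (sHG x) (@pr_eqH x)) (fun x => from_Ind (sHG x) V).
  by move=> x; rewrite mem_filter => /andP[/andP[_ nfx] _]; apply: W_Ind (propH x nfx).
apply: (WW_retract (s := s') (r := q')) wZ => v; rewrite E big_filter -[RHS]sum_pr.
rewrite [RHS](partition_big r (fun x => r x == x)) => [|y _]; last by rewrite rr.
rewrite [LHS]big_mkcondr; apply: eq_bigr => x /eqP rx.
have [_|nfx] := ifP; first by rewrite [LHS]orb; apply: eq_bigl => y; rewrite rx.
apply: esym.
rewrite big1 // => y /eqP ry; have [g [Gg yE]] := rP y.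
have fx h : h \in G -> to x h = x.
  move=> Gh; apply/eqP; apply: contraFT nfx => nx.
  by apply/exists_inP; exists h.
have {yE} <- : x = y by rewrite -yE ry fx.
by case: (nofix x) => [[h Gh]|->//]; rewrite fx ?eqxx.
Qed.

End Blocks.

(** * Translation into matrix representations *)

Section Representations.

Variables (F : fieldType) (gT : finGroupType) (G : {group gT}).
Implicit Types (M V : gmod F G) (R : representation F G).

Lemma lin_mx m n (f : {linear 'rV[F]_m -> 'rV[F]_n}) :
  {A : 'M[F]_(m, n) | forall u, u *m A = f u}.
Proof. by exists (lin1_mx f) => u; apply: mul_rV_lin1. Qed.

Definition realizes V R : Prop :=
  exists (f : {linear V -> 'rV[F]_(rdegree R)}) (h : {linear 'rV[F]_(rdegree R) -> V}),
    [/\ cancel f h, cancel h f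
      & {in G, forall g v, f (gmact V g v) = f v *m R g}].

Lemma realize_gmod V : exists R, realizes V R.
Proof.
have [n [f [h [fh hf]]]] : exists n (f : {linear V -> 'rV[F]_n})
    (h : {linear 'rV[F]_n -> V}), cancel f h /\ cancel h f.
  pose e := vbasis (fullv : {vspace V}).
  have lin_f : linear (fun v => \row_i coord e i v).
    by move=> a u v; apply/rowP => i; rewrite !mxE linearP.
  have lin_h : linear (fun r : 'rV[F]_(\dim (fullv : {vspace V})) => \sum_i r 0 i *: e`_i).
    move=> a u v; rewrite scaler_sumr -big_split; apply: eq_bigr => k _ /=.
    by rewrite !mxE scalerDl scalerA.
  exists _, (mklin lin_f), (mklin lin_h); split=> [v|r] /=.
    rewrite [RHS](coord_vbasis (memvf v)); apply: eq_bigr => i _.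
    by rewrite mxE.
  apply/rowP => i; rewrite mxE coord_sum_free //.
  exact: basis_free (vbasisP _).
pose l g := mklin (comp_linear f (mklin (comp_linear (gmact V g) h))).
pose A g := sval (lin_mx (l g)); have AE g u : u *m A g = f (gmact V g (h u)).
  exact: svalP (lin_mx (l g)) u.
have rG : mx_repr G A.
  split=> [|x y Gx Gy]; apply/row_matrixP => i; rewrite !rowE.
    by rewrite mulmx1 AE gmact1 hf.
  by rewrite mulmxA !AE fh gmactM.
exists (Representation (MxRepresentation rG)), f, h; split=> // g Gg v.
by rewrite AE fh.
Qed.

Definition gmod_of R : gmod F G.
Proof.
apply: (@mkgmod F gT G 'rV[F]_(rdegree R) (fun g v => v *m R g)).
- by move=> g a u v; rewrite mulmxDl scalemxAl.
- by move=> v; rewrite repr_mx1 mulmx1.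
- by move=> g h Gg Gh v; rewrite repr_mxM // mulmxA.
Defined.

Lemma gmod_of_realizes R : realizes (gmod_of R) R.
Proof.
by exists (mklin (linearP (idfun : {linear 'rV[F]_(rdegree R) -> _}))),
   (mklin (linearP (idfun : {linear 'rV[F]_(rdegree R) -> _}))).
Qed.

Lemma realizes_prod M N RM RN : realizes M RM -> realizes N RN ->
  realizes (gprod M N) (dadd_grepr RM RN).
Proof.
case=> f [h [fh hf fE]] [f' [h' [fh' hf' fE']]].
have lin_f : linear (fun x : gprod M N => row_mx (f x.1) (f' x.2)).
  by move=> a [u v] [u' v'] /=; rewrite !linearP scale_row_mx add_row_mx.
have lin_h : linear (fun r : 'rV[F]_(rdegree RM + rdegree RN) =>
    (h (lsubmx r), h' (rsubmx r)) : gprod M N).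
  by move=> a u v; rewrite !linearP.
exists (mklin lin_f), (mklin lin_h); split=> [[u v]|r|g Gg [u v]] /=.
- by rewrite row_mxKl row_mxKr fh fh'.
- by rewrite hf hf' hsubmxK.
by rewrite fE // fE' // mul_row_block !mulmx0 addr0 add0r.
Qed.

Lemma realizes_perm V R : permmod any_stab V -> realizes V R ->
  is_permutation_module R.
Proof.
case=> X [to [_ [i [j [ij ji]]]]] [f [h [fh hf fE]]].
exists X, to.
pose e (r : 'rV[F]_(#|X|)) : kset F to := \sum_k r 0 k *: kdelta F to (enum_val k).
have lin_e : linear e.
  move=> a u v; rewrite /e scaler_sumr -big_split; apply: eq_bigr => k _ /=.
  by rewrite !mxE scalerDl scalerA.
pose q (u : kset F to) : 'rV[F]_(#|X|) := \row_k u (enum_val k).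
have lin_q : linear q by move=> a u v; apply/rowP => k; rewrite !mxE !ffunE.
have eE (r : 'rV_#|X|) x : e r x = r 0 (enum_rank x).
  rewrite /e sum_ffunE (bigD1 (enum_rank x)) //= big1 ?addr0.
    by rewrite !ffunE enum_rankK eqxx; apply: mulr1.
  move=> k nk; rewrite !ffunE; case: eqP => [E|_]; last exact: mulr0.
  by rewrite E enum_valK eqxx in nk.
have qe : cancel q e by move=> u; apply/ffunP => x; rewrite eE mxE enum_rankK.
have eq : cancel e q by move=> r; apply/rowP => k; rewrite mxE eE enum_valK.
have qE g u : g \in G ->
    q (gmact (kset F to) g u) = q u *m perm_module_mx F to g.
  move=> Gg; apply/rowP => k; rewrite !mxE kset_actE.
  rewrite (bigD1 (enum_rank (to (enum_val k) g^-1%g))) //= big1 ?addr0.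
    by rewrite !mxE enum_rankK toKV // enum_valK !eqxx mulr1.
  move=> l nl; rewrite !mxE eqxx /=; case: eqP => [E|]; last by rewrite mulr0.
  by rewrite E enum_rankK toK // enum_valK eqxx in nl.
pose l := mklin (comp_linear (mklin lin_q) (mklin (comp_linear i h))).
pose l' := mklin (comp_linear f (mklin (comp_linear j (mklin lin_e)))).
have [A AE] := lin_mx l; have [B BE] := lin_mx l'.
have AB : A *m B = 1%:M.
  apply/row_matrixP => k; rewrite !rowE mulmxA AE BE mulmx1.
  by rewrite /= qe ij hf.
have BA : B *m A = 1%:M.
  apply/row_matrixP => k; rewrite !rowE mulmxA BE AE mulmx1.
  by rewrite /= fh ji eq.
have dE : rdegree R = #|X|.
  apply/eqP; rewrite eqn_leq; apply/andP; split.
    by rewrite -(mxrank1 F (rdegree R)) -AB (leq_trans (mxrankM_maxl _ _)) ?rank_leq_col.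
  by rewrite -(mxrank1 F #|X|) -BA (leq_trans (mxrankM_maxl _ _)) ?rank_leq_col.
apply: (MxReprSim (B := A)) => //; first by apply/row_freeP; exists B.
move=> g Gg; apply/row_matrixP => k; rewrite !rowE !mulmxA !AE /=.
rewrite -qE // -!ghomE //; congr (q (i _)).
by apply: (can_inj fh); rewrite hf fE // hf.
Qed.

Lemma fres_resolution n M R : fres 1%g n M -> realizes M R ->
  has_finite_permutation_resolution R.
Proof.
elim: n M R => [|n IHn] M R /= [_].
  move=> M0 [f [h [fh hf _]]].
  have r0 (u : 'rV[F]_(rdegree R)) : u = 0 by rewrite -[u]hf [h u]M0 linear0.
  have R0 m (A : 'M[F]_(m, rdegree R)) : A = 0.
    by apply/row_matrixP => i; rewrite row0 [row i A]r0.
  have d0 : rdegree R = 0%N by rewrite -(mxrank1 F (rdegree R)) [1%:M]R0 mxrank0.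
  exists 0%N, (fun=> @grepr0 F gT G), (fun=> 0), 0; split.
  - split=> // i _; have ax : is_action G (fun (x : void) (_ : gT) => x).
      by split; [move=> g [] | case].
    exists void, (Action ax); apply: (MxReprSim (B := 0)); first by rewrite card_void.
      by rewrite /row_free mxrank0.
    by move=> x _; apply/matrixP => [[]].
  - by split=> [|i] g Gg; rewrite mulmx0 mul0mx.
  - by rewrite /row_full mxrank0 d0.
  - by rewrite /exact_at; apply/andP; split; apply/row_subP => -[].
  by move=> i; rewrite /exact_at; apply/andP; split; apply/row_subP => -[].
case=> P [Z [pP [i [s exs]] rZ]] [f [h [fh hf fE]]].
have [RP rP] := realize_gmod P; have [RZ rZR] := realize_gmod Z.
have [m [Q [d [e [[pQ zQ] [homd home] full ex0 ex]]]]] := IHn Z RZ rZ rZR.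
have [fP [hP [fhP hfP fPE]]] := rP; have [fZ [hZ [fhZ hfZ fZE]]] := rZR.
have [inj_i sur_s ks] := exs.
have [A AE0] := lin_mx (mklin (comp_linear fP (mklin (comp_linear i hZ)))).
have AE u : u *m A = fP (i (hZ u)) := AE0 u.
have [B BE0] := lin_mx (mklin (comp_linear f (mklin (comp_linear s hP)))).
have BE u : u *m B = f (s (hP u)) := BE0 u.
have homA : module_hom A.
  move=> g Gg; apply/row_matrixP => k; rewrite !rowE !mulmxA !AE /=.
  rewrite -fPE // -ghomE //; congr (fP (i _)).
  by apply: (can_inj fhZ); rewrite hfZ fZE // hfZ.
have homB : module_hom B.
  move=> g Gg; apply/row_matrixP => k; rewrite !rowE !mulmxA !BE /=.
  rewrite -fE // -ghomE //; congr (f (s _)).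
  by apply: (can_inj fhP); rewrite hfP fPE // hfP.
have freeA : row_free A.
  rewrite -kermx_eq0; apply/rowV0P => v /sub_kermxP E.
  by apply: (can_inj hfZ); apply: inj_i; apply: (can_inj fhP); rewrite -AE E !linear0.
have fullB : row_full B.
  rewrite -sub1mx; apply/row_subP => k.
  have [v sv] := sur_s (h (row k 1%:M)).
  apply/submxP; exists (fP v); by rewrite BE /= fhP sv hf.
have exA : (A == kermx B)%MS.
  apply/andP; split.
    apply/sub_kermxP/row_matrixP => k; rewrite row0 !rowE mulmxA AE BE /=.
    by rewrite fhP (exact0 _ exs) linear0.
  apply/row_subP => k; set u := row k _.
  have uB : u *m B = 0 by apply/sub_kermxP; apply: row_sub.
  have /ks[z iz] : s (hP u) = 0.
    by apply: (can_inj fh); rewrite linear0 -uB BE.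
  by apply/submxP; exists (fZ z); rewrite AE /= fhZ iz hfP.
(* The resolution of Z is spliced onto P: the new differential is the augmentation e followed by the
   injection A, so its kernel is that of e and its image that of A. *)
pose P' j := if j is j'.+1 then Q j' else RP.
pose d' j : 'M[F]_(rdegree (P' j.+1), rdegree (P' j)) :=
  if j is j'.+1 return 'M[F]_(rdegree (P' j.+1), rdegree (P' j))
  then d j' else e *m A.
exists m.+1, P', d', B; split=> //.
- split=> -[|j] //=; [move=> _; exact: realizes_perm rP | exact: pQ | exact: zQ].
- by split=> // -[|j] //= g Gg; rewrite mulmxA homd // -!mulmxA homA.
- rewrite /exact_at /=; apply/andP; case/andP: exA => sAB sBA; split.
    by apply: submx_trans (submxMl _ _) sAB.
  apply: submx_trans sBA _; rewrite -[X in (X <= _)%MS]mul1mx submxMr //.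
  by rewrite sub1mx.
case=> [|j] //=; rewrite /exact_at; case/andP: ex0 => de ed; apply/andP; split.
  by apply/sub_kermxP; rewrite mulmxA (sub_kermxP de) mul0mx.
apply: submx_trans ed; apply/sub_kermxP/(row_free_inj freeA).
by rewrite mul0mx -mulmxA mulmx_ker.
Qed.

End Representations.

(** * Reduction to the trivial module of a p-group *)

Section Reductions.

Variables (F : fieldType) (p : nat) (gT : finGroupType).
Hypothesis charFp : p \in [pchar F].
Implicit Types G P : {group gT}.

Definition gtriv G : gmod F G.
Proof. by apply: (@mkgmod F gT G F^o (fun _ v => v)). Defined.

Lemma fixed_vector G (V : gmod F G) (v : V) : p.-group G -> v != 0 ->
  exists2 w : V, w != 0 & {in G, forall g, gmact V g w = w}.
Proof.
move=> pG nz_v; have [R [f [h [fh hf fE]]]] := realize_gmod V.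
have R0 : (0 < rdegree R)%N.
  rewrite lt0n; apply: contraNneq nz_v => E; rewrite -[v]fh.
  suff -> : f v = 0 by rewrite linear0.
  by apply/rowP => -[i lti]; exfalso; rewrite E in lti.
have nz := rfix_pgroup_pchar charFp R R0 pG (subxx G).
pose u := nz_row (rfix_mx R G); exists (h u).
  apply: contraNneq nz => E; rewrite -nz_row_eq0 -/u -[u]hf E linear0 eqxx //.
move=> g Gg; apply: (can_inj fh); rewrite fE // hf.
by move/rfix_mxP: (nz_row_sub (rfix_mx R G)); apply.
Qed.

Lemma ses_dim G (A B M : gmod F G) : ses A B M ->
  \dim (fullv : {vspace B}) = (\dim (fullv : {vspace A}) + \dim (fullv : {vspace M}))%N.
Proof.
case=> i [s [inj_i sur_s ks]].
rewrite -(limg_ker_dim (linfun s) fullv) capfv; congr (_ + _)%N.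
  rewrite -(limg_ker_dim (linfun i) fullv) capfv.
  have -> : lker (linfun i) = 0%VS.
    by apply/eqP/lker0P => x y; rewrite !lfunE; apply: inj_i.
  rewrite dimv0 add0n; congr (\dim _); apply/vspaceP => v.
  rewrite memv_ker lfunE /=; apply/eqP/memv_imgP => [/ks[u <-]|[u _ ->]].
    by exists u; rewrite ?memvf ?lfunE.
  by rewrite lfunE; apply/ks; exists u.
congr (\dim _); apply/vspaceP => w; rewrite memvf; apply/memv_imgP.
by have [v <-] := sur_s w; exists v; rewrite ?memvf ?lfunE.
Qed.

(** A fixed vector spans a copy of k; the quotient has smaller dimension and W is closed under
    extensions. *)
Lemma W_all G : p.-group G -> W (gtriv G) -> forall V : gmod F G, W V.
Proof.
move=> pG wk V; have [n] := ubnP (\dim (fullv : {vspace V})).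
elim: n V => // n IHn V leVn.
have [E|] := eqVneq (fullv : {vspace V}) 0%VS; last rewrite -vpick0 => nz.
  by apply: W_zero => v; apply/eqP; rewrite -memv0 -E memvf.
have [w nz_w fix_w] := fixed_vector pG nz.
have lin_i : linear (fun a : gtriv G => (a : F) *: w).
  by move=> a b c; rewrite scalerDl scalerA.
have i_eq : {in G, forall g a, gmact (gtriv G) g a *: w = gmact V g ((a : F) *: w)}.
  by move=> g Gg a; rewrite linearZ /= fix_w.
have inj_i : injective (mkghom lin_i i_eq).
  by move=> a b /eqP; rewrite !mkghomE -subr_eq0 -scalerBl scaler_eq0
    (negPf nz_w) orbF subr_eq0 => /eqP.
have [Q sQ] := inj_ses inj_i.
apply: (WW_ext sQ) => //; apply: IHn; move: leVn; rewrite (ses_dim sQ).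
have -> : \dim (fullv : {vspace gtriv G}) = 1%N by rewrite dimvf /dim /= ?muln1.
by rewrite add1n ltnS.
Qed.

Lemma pgroups_suffice G (M : representation F G) :
  (forall P, p.-group P -> forall V : gmod F P, W V) ->
  exists N : representation F G, has_finite_permutation_resolution (dadd_grepr M N).
Proof.
move=> wP; have [P sylP] := Sylow_exists p G; have sPG := pHall_sub sylP.
have nz : #|G : P|%g%:R != 0 :> F.
  rewrite -(dvdn_pcharf charFp) -prime_coprime ?(pcharf_prime charFp) //.
  rewrite coprime_sym; case/and3P: sylP => _ _.
  by rewrite p'natE ?(pcharf_prime charFp) // -prime_coprime ?(pcharf_prime charFp) // coprime_sym.
pose V := gmod_of M; have [s [r rs]] := Ind_res_retract sPG V nz.
have [N [n rn]] := wP P (pHall_pgroup sylP) (gres sPG V) 0%N.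
have rI := fres_res (Ind_res (sHG := sPG) (fun L => @acyclic1 _ _ _ _) rn).
have rI' := fres_iso (Ind_prod _ _ _) rI.
have [L iL] := retract_summand rs.
have rI'' := fres_iso (giso_prod iL (giso_refl (Ind sPG N))) rI'.
have [R rR] := realize_gmod (gprod L (Ind sPG N)).
exists R; apply: fres_resolution (fres_iso (giso_sym (giso_prodA _ _ _)) rI'') _.
exact: realizes_prod (gmod_of_realizes M) rR.
Qed.

End Reductions.

(** * Inflation along a homomorphism *)

Section Inflation.

Variables (F : fieldType) (gT : finGroupType) (A B : {group gT}) (pi : gT -> gT).
Hypotheses (piAB : {in A, forall a, pi a \in B}) (pi1 : pi 1%g = 1%g).
Hypothesis piM : {in A &, {morph pi : x y / (x * y)%g}}.

(** B plays the part of the quotient A/C, which keeps all groups inside one [gT]; in the application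
    it is a complement of C. *)
Definition infl (V : gmod F B) : gmod F A.
Proof.
apply: (@mkgmod F gT A V (fun g v => gmact V (pi g) v)).
- by move=> g a u v; rewrite linearP.
- by move=> v; rewrite pi1 gmact1.
- by move=> g h Ag Ah v; rewrite piM // gmactM ?piAB.
Defined.

Definition infl_hom (U V : gmod F B) (f : ghom U V) : ghom (infl U) (infl V).
Proof.
apply: (@mkghom F gT A (infl U) (infl V) f); first exact: linearP.
by move=> g Ag u; apply: (ghomE f); apply: piAB.
Defined.

Lemma ses_infl U V M : ses U V M -> ses (infl U) (infl V) (infl M).
Proof. by case=> i [s exs]; exists (infl_hom i), (infl_hom s). Qed.

Lemma infl_iso U V : giso U V -> giso (infl U) (infl V).
Proof. by case=> f [h [fh hf]]; exists (infl_hom f), (infl_hom h). Qed.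

Lemma infl_prod U V : giso (infl (gprod U V)) (gprod (infl U) (infl V)).
Proof.
by apply: (giso_bij (f := gpair (infl_hom (gfst U V)) (infl_hom (gsnd U V))))
  => [[u v] [u' v'] [] //|[u v]]; [move=> -> -> | exists (u, v)].
Qed.

Section InflPerm.
Variables (X : finType) (to : action B X).

Definition infl_act : action A X.
Proof.
apply: (@mkact gT A X (fun x a => to x (pi a))) => [x|g h Ag Ah x].
  by rewrite pi1 act1.
by rewrite piM // toM ?piAB.
Defined.

Lemma infl_kset : giso (infl (kset F to)) (kset F infl_act).
Proof.
have piV a : a \in A -> pi a^-1 = (pi a)^-1%g.
  move=> Aa; apply: (mulgI (pi a)).
  by rewrite -piM ?groupV // !mulgV pi1.
have eqf : {in A, forall g (u : kset F to), gmact (infl (kset F to)) g u =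
   gmact (kset F infl_act) g u}.
  move=> g Ag u; apply/ffunP => x; rewrite kset_actE.
  by rewrite mkactE ?groupV // [LHS](kset_actE (pi g)) piV.
pose f : ghom (infl (kset F to)) (kset F infl_act) :=
  @mkghom F gT A (infl (kset F to)) (kset F infl_act) (fun u => u)
  (linearP (idfun : {linear {ffun X -> F^o} -> _})) eqf.
by apply: (giso_bij (f := f)) => // v; exists v.
Qed.

End InflPerm.

Lemma infl_any P : permmod any_stab P -> permmod any_stab (infl P).
Proof.
case=> X [to [_ iP]]; exists X, (infl_act to); split=> //.
exact: giso_trans (infl_iso iP) (infl_kset to).
Qed.

Variable C : {group gT}.
Hypothesis kerC : {in A, forall a, (pi a == 1%g) = (a \in C)}.
Hypothesis sCA : C \subset A.

Lemma infl_free P : freemod P -> permmod (stab1 C) (infl P).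
Proof.
case=> X [to [fr iP]]; exists X, (infl_act to); split; last first.
  exact: giso_trans (infl_iso iP) (infl_kset to).
move=> x; right; apply/setP => g; apply/gstabP/idP => [[Ag]|Cg].
  rewrite mkactE // -kerC // => xg; apply/eqP/set1gP.
  have <- : gstab to x = 1%g by case: (fr x).
  by apply/gstabP; rewrite piAB.
have Ag := subsetP sCA g Cg; split=> //; rewrite mkactE //.
by move: Cg; rewrite -kerC // => /eqP->; rewrite act1.
Qed.

Lemma infl_res m n V : res 1%g 1%g m n V -> res C 1%g m n (infl V).
Proof.
elim: m V => [|m IHm] V /=; last first.
  case=> _ [P [Z [fP sZ rZ]]]; split; first exact: acyclic1.
  exists (infl P), (infl Z).
  by split; [apply: infl_free | apply: ses_infl | apply: IHm].
elim: n V => [|n IHn] V /= [_]; first by move=> V0; split=> //; apply: acyclic1.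
case=> P [Z [pP sZ rZ]]; split; first exact: acyclic1.
exists (infl P), (infl Z).
by split; [apply: infl_any | apply: ses_infl | apply: IHn].
Qed.

Lemma infl_WW V : W V -> WW C 1%g (infl V).
Proof.
move=> wV m; have [N [n rn]] := wV m; exists (infl N), n.
exact: res_iso (infl_prod _ _) (infl_res rn).
Qed.

End Inflation.

(** * The trivial module of an abelian group with a cyclic factor *)

Section Cyclic.

Variables (F : fieldType) (gT : finGroupType) (A B : {group gT}) (x : gT).
Hypotheses (abA : abelian A) (complB : B \in [complements to <[x]> in A]%g).
Local Notation C := <[x]>%G.
Local Notation k H := (gtriv F H).

Let tiBx : (B :&: <[x]> = 1)%g.
Proof. by move: complB => /complP[<- _]; rewrite setIC. Qed.
Let defA : (B * <[x]> = A)%g.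
Proof. by move: complB; rewrite complgC => /complP[_ <-]. Qed.
Let sBA : B \subset A.
Proof. by rewrite -defA mulG_subl. Qed.
Let sCA : C \subset A.
Proof. by rewrite -defA mulG_subr. Qed.
Let Ax : x \in A.
Proof. exact: subsetP sCA _ (cycle_id x). Qed.

Let c0 : rcos A B := mkrcos B (group1 A).

Let c0_rep : crep c0 \in B.
Proof.
by have [h Bh ->] := crep_mkrcos B (group1 A); rewrite mulg1.
Qed.

(** Together with [rcos_free]: C acts regularly on the cosets of B. *)
Lemma rcos_transl c : exists2 y, y \in C & rcos_act sBA c0 y = c.
Proof.
have : crep c \in (B * C)%g by rewrite defA (crep_in sBA).
case/mulsgP=> b y Bb Cy E; exists y => //; apply: val_inj.
rewrite (rcos_actE sBA) ?(subsetP sCA) // [RHS]rcosE E !rcosetM.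
by rewrite (rcoset_id c0_rep) (rcoset_id Bb).
Qed.

Lemma rcos_free y : y \in C -> rcos_act sBA c0 y = c0 -> y = 1%g.
Proof.
move=> Cy /(congr1 val); rewrite (rcos_actE sBA) ?(subsetP sCA) // rcosetM.
rewrite (rcoset_id c0_rep) /= mulg1 => E; apply/set1gP; rewrite -tiBx inE Cy andbT.
by rewrite -E rcoset_refl.
Qed.

(** Restricted to C this module is free, since C permutes the cosets of B regularly. The obstruction
    to lifting m is the cocycle n, shown to be a coboundary. *)
Lemma Ind_acyclic (L : gmod F B) : acyclic C (Ind sBA L).
Proof.
move=> V M i s exs m fix_m; have [inj_i sur_s ks] := exs.
have [b0 sb0] := sur_s m.
have /fin_all_exists[n nE] : forall y : gT, exists u, y \in C ->
    i u = gmact V y b0 - b0.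
  move=> y; have [Cy|] := boolP (y \in C); last by exists 0.
  have /ks[u iu] : s (gmact V y b0 - b0) = 0.
    by rewrite linearB ghomE ?(subsetP sCA) // sb0 fix_m // subrr.
  by exists u.
(* The projection to the coordinate at c0 has trace 1 over C, by regularity. *)
pose th (u : Ind sBA L) : Ind sBA L := [ffun c => if c == c0 then u c else 0].
have th_sum (u : Ind sBA L) : \sum_(y in C)
    gmact (Ind sBA L) y (th (gmact (Ind sBA L) y^-1%g u)) = u.
  apply/ffunP => c; have [z Cz <-] := rcos_transl c.
  have Az := subsetP sCA z Cz.
  rewrite sum_ffunE (bigD1 z Cz) big1 ?addr0 => [|y /andP[Cy nyz]].
    rewrite Ind_actE // [th _ _]ffunE eqxx -Ind_actE //.
    by rewrite gmactKV //; apply: addr0.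
  have Ay := subsetP sCA y Cy.
  rewrite -[z](mulgKV y) toM ?groupM ?groupV // Ind_actE //.
  rewrite [th _ _]ffunE; case: eqP => [E|_]; last by rewrite linear0.
  case/eqP: nyz; apply/esym/eqP; rewrite eq_mulgV1; apply/eqP.
  by apply: rcos_free E; rewrite groupM ?groupV.
have linth : linear th.
  move=> a u v; apply/ffunP => c; rewrite !ffunE.
  by case: ifP => // _; rewrite scaler0 addr0.
pose thl := mklin linth.
(* Averaging n against th gives e with e h - e = n h, so b0 - i e is fixed by C. *)
pose e := \sum_(y in C) gmact (Ind sBA L) y (thl (n y^-1%g)).
exists (b0 - i e); split=> [|h Ch]; first by rewrite linearB (exact0 _ exs) subr0.
have Ah := subsetP sCA h Ch.
suff E : gmact (Ind sBA L) h e = e + n h.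
  rewrite linearB -ghomE // E linearD nE // opprD opprB addrCA.
  by rewrite [gmact V h b0 + _]addrC subrK addrC.
rewrite -[n h]th_sum linear_sum (reindex_inj (mulIg h^-1%g)) -big_split.
apply: eq_big => y; first by rewrite groupMr ?groupV.
rewrite groupMr ?groupV // => Cy; have Ay := subsetP sCA y Cy.
rewrite -gmactM ?groupM ?groupV // mulgKV.
have -> : n (y * h^-1)^-1%g = n y^-1%g + gmact (Ind sBA L) y^-1%g (n h).
  apply: inj_i; rewrite linearD ghomE ?groupV // !nE ?groupV ?groupM ?groupV //.
  rewrite invMg invgK gmactM ?groupV // linearB.
  by rewrite [RHS]addrC addrA subrK.
by rewrite !linearD.
Qed.

Let E := Ind sBA (k B).

Let E_actE g (f : E) c : g \in A -> gmact E g f (rcos_act sBA c g) = f c.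
Proof. by move=> Ag; rewrite Ind_actE. Qed.

(* The map Ind_B k -> Ind_B k is x - 1. *)
Lemma cyclic_seq : exists J : gmod F A, ses (k A) E J /\ ses J E (k A).
Proof.
have lin_eta : linear (fun a : k A => [ffun=> a] : E).
  by move=> a u v; apply/ffunP => c; rewrite !ffunE.
have eta_eq : {in A, forall g (a : k A), [ffun=> a] = gmact E g [ffun=> a]}.
  by move=> g Ag a; apply: esym; apply: (@Ind_eq _ _ _ _ sBA (k B)) => // c; rewrite !ffunE.
pose eta := @mkghom F gT A (k A) E _ lin_eta eta_eq.
have lin_eps : linear (fun f : E => \sum_c f c : k A).
  by move=> a u v; rewrite scaler_sumr -big_split; apply: eq_bigr => c _; rewrite !ffunE.
have eps_eq : {in A, forall g (f : E), \sum_c gmact E g f c = \sum_c f c}.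
  move=> g Ag f; rewrite (reindex_inj (@act_inj _ _ _ (rcos_act sBA) g)).
  by apply: eq_bigr => c _; rewrite E_actE.
pose eps := @mkghom F gT A E (k A) _ lin_eps eps_eq.
have lin_sg : linear (fun f : E => gmact E x f - f).
  by move=> a u v; rewrite linearP scalerBr opprD addrACA.
have sg_eq : {in A, forall g f, gmact E x (gmact E g f) - gmact E g f
     = gmact E g (gmact E x f - f)}.
  move=> g Ag f; rewrite linearB -!gmactM //.
  by rewrite (centsP abA).
pose sg := @mkghom F gT A E E _ lin_sg sg_eq.
have inj_eta : injective eta.
  by move=> a b /ffunP/(_ c0); rewrite !ffunE.
have [J [q exq]] := coker_exact inj_eta; have [_ sur_q kq] := exq.
have ker_sg f : sg f = 0 -> exists a, eta a = f.
  move=> /eqP; rewrite subr_eq0 => /eqP fx; exists (f c0).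
  apply/ffunP => c; rewrite ffunE; have [_ /cycleP[i ->] <-] := rcos_transl c.
  elim: i => [|i IHi]; first by rewrite act1.
  by rewrite expgSr toM ?groupX // -[in RHS]fx E_actE.
have [tau tauE] : exists tau : ghom J E, forall f, tau (q f) = sg f.
  apply: (gfactor_surj (f := sg)) => // f /kq[a <-].
  by apply/eqP; rewrite subr_eq0 -ghomE.
have inj_tau : injective tau.
  move=> u v Et; apply/eqP; rewrite -subr_eq0; apply/eqP.
  have [f Ef] := sur_q (u - v).
  have /ker_sg/kq : sg f = 0 by rewrite -tauE Ef linearB Et subrr.
  by rewrite Ef.
have sur_eps a : exists f, eps f = a.
  exists [ffun c => if c == c0 then a else 0].
  by rewrite mkghomE (bigD1 c0) //= big1 ?addr0 => [|c /negPf nc]; rewrite ffunE ?eqxx ?nc.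
have sq : ses (k A) E J by exists eta, q.
exists J; split=> //; exists tau, eps; split=> // f.
(* Exactness at E by counting dimensions: tau maps J injectively into the kernel U of eps, and both
   have dimension dim E - 1. *)
have [U [j exU]] := ker_exact sur_eps; have [inj_j _ kj] := exU.
have et y : eps (tau y) = 0.
  have [g <-] := sur_q y; rewrite tauE linearB ghomE //; exact: subrr.
split=> [ef|[u <-] //].
have [w wE] : exists w : ghom J U, forall y, j (w y) = tau y.
  by apply: gfactor_inj => // y; apply/kj.
have dimJU : \dim (fullv : {vspace J}) = \dim (fullv : {vspace U}).
  have := ses_dim sq; have sU : ses U E (k A) by exists j, eps.
  by rewrite (ses_dim sU) addnC => /addnI.
have /kj[u uf] := ef.
have lkw : lker (linfun w) = 0%VS.
  by apply/eqP/lker0P => a b; rewrite !lfunE => Ew; apply: inj_tau; rewrite -!wE Ew.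
have limgw : limg (linfun w) = fullv.
  apply/eqP; rewrite eqEdim subvf /= -dimJU.
  by rewrite -[X in (X <= _)%N](limg_ker_dim (linfun w)) lkw capv0 dimv0.
have : u \in limg (linfun w) by rewrite limgw memvf.
by case/memv_imgP=> y _ E'; exists y; rewrite -uf E' lfunE /= wE.
Qed.

Hypothesis IH : forall L : gmod F B, W L.

Lemma WW_C_triv : WW C 1%g (k A).
Proof.
pose pi := remgr <[x]> B; have defA' : (<[x]> * B = A)%g by case/complP: complB.
have piAB : {in A, forall a, pi a \in B} by move=> a Aa; apply: mem_remgr; rewrite defA'.
have pi1 : pi 1%g = 1%g by apply: (remgr1 (K := C)).
have nCA : C <| A by rewrite -sub_abelian_normal.
have piM : {in A &, {morph pi : y z / (y * z)%g}} by apply: (remgrM complB).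
have kerC : {in A, forall a, (pi a == 1%g) = (a \in C)}.
  move=> a Aa; apply/eqP/idP => [Ea|Ca]; last exact: (remgr1 (K := C)).
  by rewrite (divgr_eq C B a) [remgr _ _ _]Ea mulg1 mem_divgr // defA'.
have := infl_WW piAB pi1 piM kerC sCA (IH (k B)).
apply: WW_iso.
pose f := @mkghom F gT A (infl piAB pi1 piM (k B)) (k A) (fun u => u)
  (linearP (idfun : {linear F^o -> _})) (fun _ _ _ => erefl).
by apply: (giso_bij (f := f)) => // v; exists v.
Qed.

(** Inducing a free cover P of k over B covers E, hence Z, and the kernel K of Ind P -> Z is an
    extension of Z' by an induced module. On j-th syzygies the left-hand term is again induced, so
    it is C-acyclic as [WW_ext] requires. *)
Lemma syz_step j (Z Z' : gmod F A) : ses Z' E Z ->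
  (exists X, syz j Z' X /\ WW C 1%g X) ->
  exists X, syz j.+1 Z X /\ WW C 1%g X.
Proof.
move=> sZ [X' [zX' wX']]; have [P [N [fP sN]]] := free_cover (k B).
have [K [sK sK']] := comp_ses (ses_Ind sBA sN) sZ.
have [L zL] := syz_exists j N.
have [X [zX sX]] := syz_ses sK (Ind_syz sBA zL) zX'.
exists X; split; first by exists (Ind sBA P), K; split=> //; apply: Ind_free.
apply: (WW_ext sX) wX'; apply: Ind_WW (IH L) => L'; exact: Ind_acyclic.
Qed.

Lemma W_abelian_step : W (k A).
Proof.
have [J [s1 s2]] := cyclic_seq.
have goodk s : exists X, syz s.*2 (k A) X /\ WW C 1%g X.
  elim: s => [|s IHs]; first by exists (k A); split; [apply: giso_refl | apply: WW_C_triv].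
  by rewrite doubleS; apply: syz_step s2 _; apply: syz_step s1 _.
move=> m; have [X [zX wX]] := goodk m; have [N [n rn]] := wX 0%N.
(* With N a 2m-th syzygy of L, the module X + N is a 2m-th syzygy of k + L. Of the 2m free terms, m
   are counted among the leading ones and m among the others. *)
have [L zL] := cosyz m.*2 N; exists L, (m + n)%N.
apply: res_shift; rewrite addnn -[m.*2]addn0.
apply: (@syz_res _ _ _ 1%g _ _ _ 0 n (syz_prod zX zL)); exact: rn.
Qed.

End Cyclic.

Lemma sum_sig (R : nmodType) (E : finType) (D : pred E) (f : E -> R) :
  \sum_(e | D e) f e = \sum_(x : {e | D e}) f (val x).
Proof.
rewrite (reindex_omap (val : {e | D e} -> E) insub) => [|e De]; last first.
  by rewrite insubT.
by apply: eq_bigl => x; rewrite valK eqxx (valP x).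
Qed.

(** * Modules with a basis, and actions triangular in it *)

Section BasedModules.

Variables (F : fieldType) (gT : finGroupType) (G : {group gT}).

(** Explicit matrices allow tensor induction to be defined on words in the basis, and to be filtered
    by sets of words. *)
Record bmod := Bmod {
  bE : finType;
  ba : gT -> bE -> bE -> F;
  ba1 : forall e e', ba 1%g e e' = (e == e')%:R;
  baM : {in G &, forall g h e e'',
    ba (g * h)%g e e'' = \sum_e' ba g e e' * ba h e' e''} }.

Definition bm (b : bmod) : gmod F G.
Proof.
apply: (@mkgmod F gT G {ffun bE b -> F^o}
  (fun g f => [ffun e' => \sum_e f e * ba g e e'])).
- move=> g a f h; apply/ffunP => e'; rewrite !ffunE scaler_sumr -big_split.
  by apply: eq_bigr => e _; rewrite !ffunE mulrDl [in RHS]/GRing.scale /= mulrA.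
- move=> f; apply/ffunP => e'; rewrite ffunE (bigD1 e') //= big1 ?addr0.
    by rewrite ba1 eqxx mulr1.
  by move=> e /negPf ne; rewrite ba1 ne mulr0.
move=> g h Gg Gh f; apply/ffunP => e''; rewrite !ffunE.
rewrite (eq_bigr (fun e => \sum_e' f e * ba g e e' * ba h e' e'')); last first.
  by move=> e _; rewrite baM // mulr_sumr; apply: eq_bigr => e' _; rewrite mulrA.
by rewrite exchange_big; apply: eq_bigr => e' _; rewrite ffunE mulr_suml.
Defined.

Lemma bm_actE b g (f : bm b) e' : gmact (bm b) g f e' = \sum_e f e * ba g e e'.
Proof. by rewrite [LHS]ffunE. Qed.

Definition bdelta b (e : bE b) : bm b := [ffun e' => (e == e')%:R : F^o].

Lemma bdelta_act b g (e : bE b) e' : gmact (bm b) g (bdelta e) e' = ba g e e'.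
Proof.
rewrite bm_actE (bigD1 e) //= big1 ?addr0 => [|e1 /negPf ne].
  by rewrite ffunE eqxx mul1r.
by rewrite ffunE eq_sym ne mul0r.
Qed.

Lemma bm_sum b (f : bm b) : f = \sum_e f e *: bdelta e.
Proof.
apply/ffunP => e; rewrite sum_ffunE (bigD1 e) //= big1 ?addr0 => [|e1 /negPf ne].
  by rewrite !ffunE eqxx; apply/esym/mulr1.
by rewrite !ffunE ne; apply: mulr0.
Qed.

Lemma bm_hom (b1 b2 : bmod) (u : bE b1 -> bE b2 -> F) :
  {in G, forall g e e2, \sum_e' ba g e e' * u e' e2 = \sum_e' u e e' * ba g e' e2} ->
  exists f : ghom (bm b1) (bm b2), forall v e2, f v e2 = \sum_e v e * u e e2.
Proof.
move=> ueq; have lin : linear (fun v : bm b1 => [ffun e2 => \sum_e v e * u e e2] : bm b2).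
  move=> a f h; apply/ffunP => e'; rewrite !ffunE scaler_sumr -big_split.
  by apply: eq_bigr => e _; rewrite !ffunE mulrDl [in RHS]/GRing.scale /= mulrA.
have eq_f : {in G, forall g (v : bm b1),
    [ffun e2 => \sum_e gmact (bm b1) g v e * u e e2] =
    gmact (bm b2) g [ffun e2 => \sum_e v e * u e e2]}.
  move=> g Gg v; apply/ffunP => e2; rewrite bm_actE ffunE.
  transitivity (\sum_e v e * \sum_e' ba g e e' * u e' e2).
    rewrite (eq_bigr (fun e => \sum_e1 v e1 * ba g e1 e * u e e2)); last first.
      by move=> e _; rewrite bm_actE mulr_suml.
    rewrite exchange_big; apply: eq_bigr => e _; rewrite mulr_sumr.
    by apply: eq_bigr => e' _; rewrite mulrA.
  rewrite (eq_bigr (fun e => \sum_e' v e * u e e' * ba g e' e2)); last first.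
    by move=> e _; rewrite ueq // mulr_sumr; apply: eq_bigr => e' _; rewrite mulrA.
  by rewrite exchange_big; apply: eq_bigr => e' _; rewrite ffunE mulr_suml.
exists (@mkghom F gT G (bm b1) (bm b2) _ lin eq_f) => v e2.
by rewrite [LHS]ffunE.
Qed.

Lemma bm_relabel (b1 b2 : bmod) (s : bE b1 -> bE b2) : bijective s ->
  {in G, forall g e e', ba g (s e) (s e') = ba g e e'} -> giso (bm b1) (bm b2).
Proof.
case=> t st ts sE; have [|f fE] := @bm_hom b1 b2 (fun e e2 => (s e == e2)%:R).
  move=> g Gg e e2; rewrite (bigD1 (t e2)) //= big1 ?addr0; last first.
    by move=> e' ne; case: eqP => [E|]; rewrite ?mulr0 // -E st eqxx in ne *.
  rewrite [RHS](bigD1 (s e)) //= big1 ?addr0; last first.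
    by move=> e' ne; rewrite eq_sym (negPf ne) mul0r.
  by rewrite ts !eqxx mulr1 mul1r -{2}[e2]ts sE.
have fsE v e : f v (s e) = v e.
  rewrite fE (bigD1 e) //= big1 ?addr0 ?eqxx ?mulr1 // => e' ne.
  by rewrite (can_eq st) (negPf ne) mulr0.
apply: (giso_bij (f := f)) => [u v E|w].
  by apply/ffunP => e; rewrite -!fsE E.
by exists [ffun e => w (s e)]; apply/ffunP => e; rewrite -[e]ts fsE ffunE.
Qed.

Section Transport.
Variables (V : gmod F G) (E : finType).
Variables (f : {linear V -> {ffun E -> F^o}}) (h : {linear {ffun E -> F^o} -> V}).
Hypotheses (fh : cancel f h) (hf : cancel h f).

Let d (e : E) : {ffun E -> F^o} := [ffun e' => (e == e')%:R].

Let dsum (u : {ffun E -> F^o}) : u = \sum_e u e *: d e.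
Proof.
apply/ffunP => e; rewrite sum_ffunE (bigD1 e) //= big1 ?addr0 => [|e1 /negPf ne].
  by rewrite !ffunE eqxx; apply/esym/mulr1.
by rewrite !ffunE ne; apply: mulr0.
Qed.

Let actE g v e : f (gmact V g v) e = \sum_e1 f v e1 * f (gmact V g (h (d e1))) e.
Proof.
rewrite -{1}[v]fh [f v]dsum !linear_sum sum_ffunE; apply: eq_bigr => e1 _.
by rewrite -dsum !linearZ ffunE.
Qed.

Definition bmod_of : bmod.
Proof.
apply: (@Bmod E (fun g e e' => f (gmact V g (h (d e))) e')).
  by move=> e e'; rewrite gmact1 hf ffunE.
by move=> g k Gg Gk e e''; rewrite gmactM // actE.
Defined.

Lemma bmod_of_eq : {in G, forall g v, f (gmact V g v) = gmact (bm bmod_of) g (f v)}.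
Proof.
move=> g Gg v; apply/ffunP => e; apply: etrans (actE g v e) (esym _).
exact: (@bm_actE bmod_of g (f v) e).
Qed.

Definition bmod_of_hom : ghom V (bm bmod_of) :=
  @mkghom F gT G V (bm bmod_of) f (linearP f) bmod_of_eq.

End Transport.

Lemma coordinates (V : vectType F) : exists n (f : {linear V -> {ffun 'I_n -> F^o}})
  (h : {linear {ffun 'I_n -> F^o} -> V}), cancel f h /\ cancel h f.
Proof.
pose e := vbasis (fullv : {vspace V}).
have lin_f : linear (fun v : V => [ffun i => coord e i v : F^o]).
  by move=> a u v; apply/ffunP => i; rewrite !ffunE linearP.
have lin_h : linear (fun r : {ffun 'I_(\dim (fullv : {vspace V})) -> F^o} =>
    \sum_i (r i : F) *: e`_i).
  move=> a u v; rewrite scaler_sumr -big_split; apply: eq_bigr => k _ /=.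
  by rewrite !ffunE scalerDl scalerA.
exists _, (mklin lin_f), (mklin lin_h); split=> [v|r] /=.
  rewrite [RHS](coord_vbasis (memvf v)); apply: eq_bigr => i _.
  by rewrite ffunE.
apply/ffunP => i; rewrite ffunE coord_sum_free //.
exact: basis_free (vbasisP _).
Qed.

Section Restrict.
Variables (b : bmod) (D : pred (bE b)).
Hypothesis closed : {in G &, forall g h e e' e'',
  D e -> D e'' -> ~~ D e' -> ba g e e' * ba h e' e'' = 0}.

(** The truncated matrices still multiply correctly because paths that leave D and return contribute
    0. This covers both submodules and quotients spanned by basis vectors. *)
Definition brestr : bmod.
Proof.
apply: (@Bmod {e | D e} (fun g e e' => ba g (val e) (val e'))).
  by move=> e e'; rewrite ba1.
move=> g h Gg Gh e e''; rewrite baM // (bigID D) /= [X in _ + X]big1 ?addr0.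
  by rewrite sum_sig.
by move=> e' nDe; apply: closed => //; apply: valP.
Defined.

End Restrict.

Section Split.
Variables (b : bmod) (D : pred (bE b)).
Hypothesis closedD : {in G, forall g e e', D e -> ~~ D e' -> ba g e e' = 0}.

Lemma closed_sub : {in G &, forall g h e e' e'',
  D e -> D e'' -> ~~ D e' -> ba g e e' * ba h e' e'' = 0}.
Proof. by move=> g h Gg _ e e' e'' De _ nDe; rewrite closedD ?mul0r. Qed.

Lemma closed_quo : {in G &, forall g h e e' e'',
  ~~ D e -> ~~ D e'' -> ~~ ~~ D e' -> ba g e e' * ba h e' e'' = 0}.
Proof.
move=> g h _ Gh e e' e'' _ nDe /negPn De.
by rewrite (closedD Gh De nDe) mulr0.
Qed.

Definition bsub := brestr closed_sub.
Definition bquo := @brestr b (fun e => ~~ D e) closed_quo.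

Definition bsub_val (u : bm bsub) : bm b :=
  [ffun e => if insub e is Some x then u x else 0].

Lemma bsub_valE u (x : bE bsub) : bsub_val u (val x) = u x.
Proof. by rewrite ffunE valK. Qed.

Lemma bsub_val0 u e : ~~ D e -> bsub_val u e = 0.
Proof. by move=> nDe; rewrite ffunE insubN. Qed.

Lemma split_based : exists (i : ghom (bm bsub) (bm b)) (s : ghom (bm b) (bm bquo)),
  [/\ gexact i s, i =1 bsub_val & forall v x, s v x = v (val x)].
Proof.
have lin_i : linear bsub_val.
  move=> a u v; apply/ffunP => e; rewrite !ffunE.
  by case: insubP => [x _ _|_]; rewrite ?ffunE // scaler0 addr0.
have i_eq : {in G, forall g u, bsub_val (gmact (bm bsub) g u) =
    gmact (bm b) g (bsub_val u)}.
  move=> g Gg u; apply/ffunP => e'; rewrite bm_actE (bigID D) /=.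
  rewrite [X in _ = _ + X]big1 ?addr0; last first.
    by move=> e nDe; rewrite bsub_val0 // mul0r.
  have [De'|nDe'] := boolP (D e'); last first.
    rewrite bsub_val0 // big1 // => e De; by rewrite closedD // mulr0.
  rewrite -[e']/(val (exist D e' De')) bsub_valE bm_actE [RHS]sum_sig.
  by apply: eq_bigr => x _; rewrite bsub_valE.
have lin_s : linear (fun v : bm b => [ffun x => v (val x)] : bm bquo).
  by move=> a u v; apply/ffunP => x; rewrite !ffunE.
have s_eq : {in G, forall g (v : bm b), [ffun x => gmact (bm b) g v (val x)] =
    gmact (bm bquo) g [ffun x => v (val x)]}.
  move=> g Gg v; apply/ffunP => x; rewrite ffunE !bm_actE (bigID D) /=.
  rewrite big1 ?add0r; last by move=> e De; rewrite closedD ?mulr0 ?(valP x).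
  by rewrite sum_sig ffunE; apply: eq_bigr => y _; rewrite ffunE.
pose i := @mkghom F gT G (bm bsub) (bm b) _ lin_i i_eq.
pose s := @mkghom F gT G (bm b) (bm bquo) _ lin_s s_eq.
have sE v x : s v x = v (val x) by rewrite [LHS]ffunE.
exists i, s; split=> //; split=> [u v E|w|v].
- by apply/ffunP => x; rewrite -!bsub_valE -[bsub_val u]/(i u) E.
- exists [ffun e => if insub e is Some x then w x else 0].
  by apply/ffunP => x; rewrite sE ffunE valK.
split=> [sv|[u <-]]; last first.
  by apply/ffunP => x; rewrite sE bsub_val0 ?ffunE ?(valP x).
exists [ffun x => v (val x)]; apply/ffunP => e; rewrite mkghomE.
have [De|nDe] := boolP (D e).
  by rewrite -[e]/(val (exist D e De)) bsub_valE ffunE.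
rewrite bsub_val0 //.
have /ffunP/(_ (exist (fun e => ~~ D e) e nDe)) := sv.
by rewrite sE ffunE.
Qed.

Lemma ses_split_based : ses (bm bsub) (bm b) (bm bquo).
Proof. by have [i [s [ex _ _]]] := split_based; exists i, s. Qed.

End Split.

Hypothesis IH : forall H : {group gT}, H \proper G ->
  forall L : gmod F H, W L.

Lemma W_based_blocks (b : bmod) (X : finType) (to : action G X) (pi : bE b -> X) :
  {in G, forall g e e', ba g e e' != 0 -> pi e' = to (pi e) g} ->
  (forall e, exists2 g, g \in G & to (pi e) g != pi e) -> W (bm b).
Proof.
move=> piE nofix.
have lin_pr x : linear (fun f : bm b => [ffun e => if pi e == x then f e else 0] : bm b).
  move=> a u v; apply/ffunP => e; rewrite !ffunE.
  by case: ifP => // _; rewrite scaler0 addr0.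
apply: (W_blocks IH (V := bm b) (to := to) (pr := fun x => mklin (lin_pr x))).
- move=> v; apply/ffunP => e; rewrite sum_ffunE (bigD1 (pi e)) //= big1 ?addr0.
    by rewrite ffunE eqxx.
  by move=> x nx; rewrite ffunE eq_sym (negPf nx).
- move=> g Gg x v; apply/ffunP => e'; rewrite bm_actE ffunE.
  case: eqP => [E|nE].
    rewrite bm_actE; apply: eq_bigr => e _; rewrite ffunE.
    case: eqP => // ne; rewrite mul0r; have [->|nz] := eqVneq (ba g e e') 0.
      by rewrite mulr0.
    case: ne; have := piE g Gg _ _ nz; rewrite E => /act_inj.
    by [].
  rewrite big1 // => e _; rewrite ffunE; case: eqP => [Ex|_]; last by rewrite mul0r.
  have [->|nz] := eqVneq (ba g e e') 0; first by rewrite mulr0.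
  by case: nE; rewrite -Ex; apply: piE.
move=> x; have [/existsP[e /eqP <-]|] := boolP [exists e, pi e == x].
  by left; apply: nofix.
rewrite negb_exists => /forallP nx; right=> v; apply/ffunP => e.
by rewrite !ffunE (negPf (nx e)).
Qed.

(** Induction on a bound for r: the vectors of smaller rank span a submodule, and modulo them the
    blocks are truly permuted. *)
Lemma W_triangular (b : bmod) (X : finType) (to : action G X) (pi : bE b -> X)
    (r : bE b -> nat) :
  {in G, forall g e e', ba g e e' != 0 ->
     (r e' < r e)%N \/ r e' = r e /\ pi e' = to (pi e) g} ->
  (forall e, exists2 g, g \in G & to (pi e) g != pi e) -> W (bm b).
Proof.
move=> tri nofix; have [n] : exists n, forall e, (r e < n)%N.
  by exists (\max_e r e).+1 => e; rewrite ltnS leq_bigmax.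
elim: n b pi r tri nofix => [|n IHn] b pi r tri nofix rn.
  by apply: W_zero => f; apply/ffunP => e; have := rn e.
pose D : pred (bE b) := fun e => (r e < n)%N.
have clD : {in G, forall g e e', D e -> ~~ D e' -> ba g e e' = 0}.
  move=> g Gg e e' De nDe; apply: contraNeq nDe => /(tri g Gg) [lt|[E _]].
    exact: ltn_trans lt De.
  by rewrite /D E.
apply: (WW_ext (ses_split_based clD)).
  apply: (IHn (bsub clD) (fun x => pi (val x)) (fun x => r (val x))).
  - by move=> g Gg e e'; apply: tri.
  - by move=> e; apply: nofix.
  by move=> e; apply: (valP e).
have rquo (x : bE (bquo clD)) : r (val x) = n.
  apply/eqP; rewrite eqn_leq -ltnS rn leqNgt; exact: (valP x).
apply: (@W_based_blocks (bquo clD) X to (fun x => pi (val x))).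
  move=> g Gg e e' nz; have [] := tri g Gg _ _ nz; last by case.
  by rewrite !rquo ltnn.
by move=> e; apply: nofix.
Qed.

End BasedModules.

(** Matrix multiplication in a tensor product whose factors are permuted by s: a product of sums
    over letters expands into a sum over words. *)
Lemma word_mul (R : comNzRingType) (I E : finType) (s : I -> I) (X Y : I -> E -> R) :
  injective s ->
  \sum_(w : {ffun I -> E}) (\prod_c X c (w (s c))) * (\prod_c Y c (w c))
    = \prod_c \sum_e X c e * Y (s c) e.
Proof.
move=> inj_s; rewrite bigA_distr_bigA.
pose h (f : {ffun I -> E}) : {ffun I -> E} := [ffun c => f (invF inj_s c)].
rewrite (reindex h) /=; last first.
  exists (fun f : {ffun I -> E} => [ffun c => f (s c)]) => f _;
    by apply/ffunP => c; rewrite !ffunE ?invF_f ?f_invF.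
apply: eq_bigr => f _; rewrite [X in _ * X](reindex_inj inj_s) -big_split.
by apply: eq_bigr => c _; rewrite /= ffunE invF_f.
Qed.

Lemma prod_eq (R : comNzRingType) (I E : finType) (w w' : {ffun I -> E}) :
  \prod_c (w c == w' c)%:R = (w == w')%:R :> R.
Proof.
case: eqP => [<-|nw]; first by rewrite big1 // => c _; rewrite eqxx.
have /existsP[c nc] : [exists c, w c != w' c].
  rewrite -negb_forall; apply: contra_notN nw => /forallP E'.
  by apply/ffunP => c; apply/eqP.
by rewrite (bigD1 c) //= (negPf nc) mul0r.
Qed.

(** * Tensor induction *)

Section TensorInduction.

Variables (F : fieldType) (gT : finGroupType) (G A : {group gT}).
Hypothesis sAG : A \subset G.
Local Notation I := (rcos G A).
Local Notation sh := (rcos_act sAG).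

Lemma sh_inj g : injective (sh^~ g).
Proof. exact: act_inj. Qed.

Lemma sh_trans c d : exists2 g, g \in G & sh c g = d.
Proof.
have Gc := crep_in sAG c; have Gd := crep_in sAG d.
exists ((crep c)^-1 * crep d)%g; first by rewrite groupM ?groupV.
apply: val_inj; rewrite (rcos_actE sAG) ?groupM ?groupV //.
by rewrite mulKVg -rcosE.
Qed.

(* Tensor induction of the restriction of b to A. As b is a module for the whole
   of G, no cocycle is needed: the tensor factors are merely permuted. *)
Definition tau (b : bmod F G) : bmod F G.
Proof.
apply: (@Bmod F gT G {ffun I -> bE b}
  (fun g w w' => \prod_c ba g (w c) (w' (sh c g)))).
  move=> w w'; rewrite -prod_eq; apply: eq_bigr => c _.
  by rewrite ba1 act1.
move=> g h Gg Gh w w''.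
rewrite (word_mul (fun c e => ba g (w c) e) (fun c e => ba h e (w'' (sh c h))) (@sh_inj g)).
by apply: eq_bigr => c _; rewrite baM // toM.
Defined.

Lemma tau_baE b g (w w' : bE (tau b)) :
  ba g w w' = \prod_c ba g (w c) (w' (sh c g)).
Proof. by []. Qed.

Lemma tau_ba_neq0 b g (w w' : bE (tau b)) c :
  ba g w w' != 0 -> ba g (w c) (w' (sh c g)) != 0.
Proof. by move/prodf_neq0; apply. Qed.

Lemma tau_hom (b1 b2 : bmod F G) (f : ghom (bm b1) (bm b2)) :
  exists tf : ghom (bm (tau b1)) (bm (tau b2)),
    forall v w2, tf v w2 = \sum_w v w * \prod_c f (bdelta (w c)) (w2 c).
Proof.
apply: bm_hom => g Gg w w2; rewrite (eq_bigr (fun w' : {ffun I -> bE b1} =>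
  (\prod_c ba g (w c) (w' (sh c g))) * \prod_c f (bdelta (w' c)) (w2 c))) //.
rewrite (word_mul (fun c e => ba g (w c) e) (fun c e => f (bdelta e) (w2 c)) (@sh_inj g)).
apply: etrans (esym (word_mul (s := id) (fun c e => f (bdelta (w c)) e)
   (fun c e => ba g e (w2 (sh c g))) (fun _ _ => id))).
apply: eq_bigr => c _; rewrite -bm_actE -ghomE //.
rewrite [gmact _ _ _]bm_sum linear_sum sum_ffunE; apply: eq_bigr => e _.
by rewrite linearZ bdelta_act ffunE.
Qed.

(** Shows that tensor induction is independent of the basis used to define it. *)
Lemma tau_iso (b1 b2 : bmod F G) :
  giso (bm b1) (bm b2) -> giso (bm (tau b1)) (bm (tau b2)).
Proof.
case=> f [h [fh hf]]; have [tf tfE] := tau_hom f; have [th thE] := tau_hom h.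
have inv (b b' : bmod F G) (f' : ghom (bm b) (bm b')) (h' : ghom (bm b') (bm b))
    (tf' : ghom (bm (tau b)) (bm (tau b'))) (th' : ghom (bm (tau b')) (bm (tau b))) :
    cancel f' h' ->
    (forall v w2, tf' v w2 = \sum_w v w * \prod_c f' (bdelta (w c)) (w2 c)) ->
    (forall v w2, th' v w2 = \sum_w v w * \prod_c h' (bdelta (w c)) (w2 c)) ->
    cancel tf' th'.
  move=> K fE hE v; apply/ffunP => w2; rewrite hE.
  have hf1 e e2 : \sum_e' f' (bdelta e) e' * h' (bdelta e') e2 = (e == e2)%:R.
    transitivity (h' (f' (bdelta e)) e2); last by rewrite K ffunE.
    rewrite [f' _ in RHS]bm_sum linear_sum sum_ffunE; apply: eq_bigr => e' _.
    by rewrite linearZ ffunE.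
  have mulE (w : {ffun I -> bE b}) : \sum_(w' : {ffun I -> bE b'})
      (\prod_c f' (bdelta (w c)) (w' c)) * (\prod_c h' (bdelta (w' c)) (w2 c))
      = (w == w2)%:R.
    rewrite (word_mul (s := id) (fun c e => f' (bdelta (w c)) e)
      (fun c e => h' (bdelta e) (w2 c)) (fun _ _ => id)).
    rewrite (eq_bigr (fun c => (w c == w2 c)%:R)) => [|c _]; last exact: hf1.
    exact: prod_eq.
  transitivity (\sum_(w : {ffun I -> bE b}) v w * (w == w2)%:R); last first.
    rewrite (bigD1 w2) //= big1 ?addr0 ?eqxx; first exact: mulr1.
    by move=> w /negPf ->; rewrite mulr0.
  rewrite (eq_bigr (fun w' : {ffun I -> bE b'} => \sum_(w : {ffun I -> bE b}) v w *
     ((\prod_c f' (bdelta (w c)) (w' c)) * \prod_c h' (bdelta (w' c)) (w2 c)))).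
    rewrite exchange_big; apply: eq_bigr => w _.
    by rewrite -mulr_sumr mulE.
  move=> w' _; rewrite fE mulr_suml; apply: eq_bigr => w _.
  exact: esym (mulrA _ _ _).
by exists tf, th; split; [apply: inv fh tfE thE | apply: inv hf thE tfE].
Qed.

Section Tensors.
Variable b : bmod F G.

Definition tens (v : I -> bm b) : bm (tau b) :=
  [ffun w : {ffun I -> bE b} => \prod_c v c (w c) : F^o].

Lemma eq_tens u v : u =1 v -> tens u = tens v.
Proof. by move=> E; apply/ffunP => w; rewrite !ffunE; apply: eq_bigr => c _; rewrite E. Qed.

Lemma tens_act g v : g \in G -> gmact (bm (tau b)) g (tens v) =
  tens (fun c => gmact (bm b) g (v (sh c g^-1%g))).
Proof.
move=> Gg; apply/ffunP => w'; rewrite bm_actE ffunE.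
rewrite [RHS](reindex_inj (@sh_inj g)).
rewrite (eq_bigr (fun c => \sum_e v c e * ba g e (w' (sh c g)))); last first.
  by move=> c _; rewrite -bm_actE toK.
rewrite bigA_distr_bigA; apply: eq_bigr => w _.
by rewrite ffunE tau_baE -big_split.
Qed.

Lemma tens_sum (J : finType) (u : I -> J -> bm b) :
  tens (fun c => \sum_j u c j) =
  \sum_(f : {ffun I -> J}) tens (fun c => u c (f c)).
Proof.
apply/ffunP => w; rewrite ffunE sum_ffunE.
rewrite (eq_bigr (fun c => \sum_j u c j (w c))); last first.
  by move=> c _; rewrite sum_ffunE.
by rewrite bigA_distr_bigA; apply: eq_bigr => f _; rewrite ffunE.
Qed.

(** Meant for left multiplication on the cosets of A by an element normalizing A, which commutes
    with the right action of G. *)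
Lemma tens_perm (s : I -> I) : injective s ->
  {in G, forall g c, s (sh c g) = sh (s c) g} ->
  exists r : ghom (bm (tau b)) (bm (tau b)), forall v, r (tens v) = tens (fun c => v (s c)).
Proof.
move=> inj_s s_sh; pose t := invF inj_s.
have t_sh : {in G, forall g c, t (sh c g) = sh (t c) g}.
  by move=> g Gg c; apply: (inj_s); rewrite /t f_invF s_sh // f_invF.
pose k (w : {ffun I -> bE b}) := [ffun c => w (t c)].
have lin_r : linear (fun f : bm (tau b) => [ffun w => f (k w)] : bm (tau b)).
  by move=> a u v; apply/ffunP => w; rewrite !ffunE.
have r_eq : {in G, forall g (f : bm (tau b)), [ffun w => gmact (bm (tau b)) g f (k w)] =
   gmact (bm (tau b)) g [ffun w => f (k w)]}.
  move=> g Gg f; apply/ffunP => w'; rewrite ffunE bm_actE.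
  apply: etrans _ (esym (bm_actE g ([ffun w => f (k w)] : bm (tau b)) w')).
  rewrite (reindex k); last first.
    exists (fun w : {ffun I -> bE b} => [ffun c => w (s c)]) => w _;
      by apply/ffunP => c; rewrite !ffunE /t ?invF_f ?f_invF.
  apply: eq_bigr => w _; rewrite ffunE; congr (_ * _).
  rewrite !tau_baE (reindex_inj inj_s); apply: eq_bigr => c _.
  by rewrite !ffunE /t invF_f -/t -s_sh // /t invF_f.
exists (@mkghom F gT G _ _ _ lin_r r_eq) => v.
apply/ffunP => w; rewrite ffunE !ffunE (reindex_inj inj_s).
by apply: eq_bigr => c _; rewrite ffunE /t invF_f.
Qed.

End Tensors.

Section Filtration.
Variables (b : bmod F G) (D : pred (bE b)).
Hypothesis clD : {in G, forall g e e', D e -> ~~ D e' -> ba g e e' = 0}.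
Hypothesis IH : forall H : {group gT}, H \proper G ->
  forall L : gmod F H, W L.

(** These words span tau of the submodule. *)
Let D0 : pred (bE (tau b)) := fun w => [forall c, D (w c)].

Lemma closed_D0 : {in G, forall g w w', D0 w -> ~~ D0 w' -> ba g w w' = 0}.
Proof.
move=> g Gg w w' /forallP Dw; rewrite negb_forall => /existsP[c nDc].
have [d _ dc] := (sh_trans c c); apply: contraNeq nDc => nz.
have := tau_ba_neq0 (sh c g^-1%g) nz; rewrite toKV // => nz'.
by apply: contraNT nz' => nD; apply/eqP/clD.
Qed.

(** The mixed words; those left after them have no letter in D and give tau of the quotient. *)
Let D1 : pred (bE (bquo closed_D0)) := fun x => [exists c, D (val x c)].

Lemma closed_D1 : {in G, forall g w w', D1 w -> ~~ D1 w' -> ba g w w' = 0}.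
Proof.
move=> g Gg w w' /existsP[c Dc]; rewrite negb_exists => /forallP nD.
apply: contraNeq (nD (sh c g)) => nz.
have := @tau_ba_neq0 b g (val w) (val w') c nz.
by apply: contraNT => nDc; apply/eqP/clD.
Qed.

Lemma sh_set_subproof : {in G &, forall g h (S : {set I}),
  [set sh c (g * h)%g | c in S] = [set sh c h | c in [set sh c g | c in S]]}.
Proof.
move=> g h Gg Gh S; apply/setP => d; apply/imsetP/imsetP => [[c Sc ->]|[_ /imsetP[c Sc ->] ->]].
  by exists (sh c g); [apply/imsetP; exists c | apply: toM].
by exists c; last exact: esym (toM _ _ Gg Gh).
Qed.

Lemma sh_set1_subproof (S : {set I}) : [set sh c 1%g | c in S] = S.
Proof.
apply/setP => d; apply/imsetP/idP => [[c Sc ->]|Sd]; first by rewrite act1.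
by exists d; rewrite ?act1.
Qed.

Definition sh_set : action G {set I} :=
  @mkact gT G {set I} (fun S g => [set sh c g | c in S])
    sh_set1_subproof sh_set_subproof.

(* The words with letters both inside and outside D: up to words with more letters
   in D, G permutes the blocks of words sharing the positions of the letters in D,
   and it is transitive on positions. *)
Lemma W_mixed : W (bm (bsub closed_D1)).
Proof.
pose S (x : bE (bsub closed_D1)) := [set c | D (val (val x) c)].
apply: (W_triangular IH (b := bsub closed_D1) (to := sh_set)
  (pi := S) (r := fun x => #|~: S x|)).
  move=> g Gg x x' nz.
  have sub : sh_set (S x) g \subset S x'.
    rewrite mkactE //; apply/subsetP => _ /imsetP[c Sc ->]; rewrite !inE in Sc *.
    have := @tau_ba_neq0 b g (val (val x)) (val (val x')) c nz.
    by apply: contraNT => nDc; apply/eqP/clD.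
  have cS : #|sh_set (S x) g| = #|S x|.
    by rewrite mkactE // card_imset //; apply: sh_inj.
  have := subset_leqif_cards sub; rewrite cS => [[le eqS]].
  have EC : (#|S x'| + #|~: S x'| = #|S x| + #|~: S x|)%N by rewrite !cardsC.
  move: le; rewrite leq_eqVlt => /orP[/eqP E|lt].
    right; split; last by apply/esym/eqP; rewrite -eqS E.
    by apply/eqP; rewrite -(eqn_add2l #|S x'|) EC E.
  by left; rewrite -(ltn_add2l #|S x'|) EC ltn_add2r.
move=> x; have /existsP[c Dc] := valP x.
have := valP (val x); rewrite negb_forall => /existsP[d nDd].
have [g Gg cd] := sh_trans c d; exists g => //.
apply: contra nDd => /eqP E; have : d \in S x by rewrite -E mkactE //; apply/imsetP; exists c; rewrite ?inE.
by rewrite inE.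
Qed.

Lemma tau_sub_iso : giso (bm (tau (bsub clD))) (bm (bsub closed_D0)).
Proof.
have sP (w : {ffun I -> {e | D e}}) : D0 [ffun c => val (w c)].
  by apply/forallP => c; rewrite ffunE (valP (w c)).
have tP (x : {w | D0 w}) c : D (val x c) := forallP (valP x) c.
pose t (x : {w | D0 w}) : {ffun I -> {e | D e}} := [ffun c => exist D (val x c) (tP x c)].
apply: (@bm_relabel _ _ _ (tau (bsub clD)) (bsub closed_D0)
  (fun w => exist D0 _ (sP w))).
  exists t => [w|x]; first by apply/ffunP => c; apply: val_inj; rewrite [t _ c]ffunE; apply: ffunE.
  by apply: val_inj; apply/ffunP => c; rewrite [LHS]ffunE [t x c]ffunE.
move=> g Gg w w'; rewrite [RHS]tau_baE [LHS]tau_baE.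
by apply: eq_bigr => c _; rewrite !ffunE.
Qed.

Lemma tau_quo_iso : giso (bm (tau (bquo clD))) (bm (bquo closed_D1)).
Proof.
have c0 : I := mkrcos A (group1 G).
pose v (w : {ffun I -> {e | ~~ D e}}) : bE (tau b) := [ffun c => val (w c)].
have sP (w : {ffun I -> {e | ~~ D e}}) : ~~ D0 (v w).
  by rewrite negb_forall; apply/existsP; exists c0; rewrite ffunE (valP (w c0)).
pose s0 w : bE (bquo closed_D0) := exist (fun w => ~~ D0 w) _ (sP w).
have s1P w : ~~ D1 (s0 w).
  rewrite negb_exists; apply/forallP => c; rewrite [val (s0 w) c]ffunE.
  exact: (valP (w c)).
have tP (x : bE (bquo closed_D1)) c : ~~ D (val (val x) c).
  by have := valP x; rewrite negb_exists => /forallP/(_ c).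
pose t (x : bE (bquo closed_D1)) : {ffun I -> {e | ~~ D e}} :=
  [ffun c => exist (fun e => ~~ D e) (val (val x) c) (tP x c)].
apply: (@bm_relabel _ _ _ (tau (bquo clD)) (bquo closed_D1)
  (fun w => exist (fun x => ~~ D1 x) _ (s1P w))).
  exists t => [w|x].
    by apply/ffunP => c; apply: val_inj; rewrite [t _ c]ffunE; apply: ffunE.
  do 2!apply: val_inj; apply/ffunP => c; by rewrite [LHS]ffunE [t x c]ffunE.
move=> g Gg w w'; rewrite [RHS]tau_baE [LHS]tau_baE.
by apply: eq_bigr => c _; rewrite !ffunE.
Qed.

Lemma tau_filtration : exists Q X : gmod F G,
  [/\ ses (bm (tau (bsub clD))) (bm (tau b)) Q, ses X Q (bm (tau (bquo clD))) & W X].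
Proof.
exists (bm (bquo closed_D0)), (bm (bsub closed_D1)); split.
- exact: ses_isol (giso_sym tau_sub_iso) (ses_split_based closed_D0).
- exact: ses_isor (giso_sym tau_quo_iso) (ses_split_based closed_D1).
exact: W_mixed.
Qed.

End Filtration.

End TensorInduction.

(** * Bases adapted to a short exact sequence *)

Section AdaptedBases.

Variables (F : fieldType) (gT : finGroupType) (G : {group gT}).

Lemma ses_compare (U V M U1 V1 M1 : gmod F G) (i : ghom U V) (s : ghom V M)
    (i1 : ghom U1 V1) (s1 : ghom V1 M1) (f : ghom V V1) :
  gexact i s -> gexact i1 s1 -> injective f -> (forall y, exists x, f x = y) ->
  (forall v, s v = 0 <-> s1 (f v) = 0) -> giso U U1 /\ giso M M1.
Proof.
move=> exs exs1 inj_f sur_f K; have [inj_i sur_s ks] := exs.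
have [inj_i1 sur_s1 ks1] := exs1; split.
  have [g gE] : exists g : ghom U U1, forall u, i1 (g u) = f (i u).
    apply: (gfactor_inj (f := gcomp f i)) => // u; apply/ks1/K/ks; by exists u.
  apply: (giso_bij (f := g)) => [x y E|u1].
    by apply: inj_i; apply: inj_f; rewrite -!gE E.
  have [v fv] := sur_f (i1 u1).
  have /ks[u iu] : s v = 0 by apply/K; rewrite fv (exact0 _ exs1).
  by exists u; apply: inj_i1; rewrite gE iu fv.
have [g gE] : exists g : ghom M M1, forall v, g (s v) = s1 (f v).
  by apply: (gfactor_surj (f := gcomp s1 f)) => // v /K.
apply: (giso_bij (f := g)) => [x y|m1].
  have [v <-] := sur_s x; have [v' <-] := sur_s y; rewrite !gE => /eqP.
  rewrite -subr_eq0 -!linearB => /eqP/K/eqP.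
  by rewrite linearB subr_eq0 => /eqP.
have [v1 <-] := sur_s1 m1; have [v <-] := sur_f v1.
by exists (s v).
Qed.

Definition bperm (X : finType) (to : action G X) : bmod F G.
Proof.
apply: (@Bmod F gT G X (fun g x y => (to x g == y)%:R)).
  by move=> x y; rewrite act1.
move=> g h Gg Gh x y; rewrite (bigD1 (to x g)) //= big1 ?addr0.
  by rewrite eqxx mul1r toM.
by move=> z /negPf nz; rewrite eq_sym nz mul0r.
Defined.

Lemma bperm_iso (X : finType) (to : action G X) : giso (kset F to) (bm (bperm to)).
Proof.
have b_eq : {in G, forall g x, gmact (bm (bperm to)) g (@bdelta F gT G (bperm to) x)
    = @bdelta F gT G (bperm to) (to x g)}.
  by move=> g Gg x; apply/ffunP => y; rewrite bdelta_act ffunE.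
have eqf : {in G, forall g (u : kset F to), gmact (kset F to) g u =
    gmact (bm (bperm to)) g u}.
  move=> g Gg u; apply/ffunP => y; rewrite kset_actE.
  apply: etrans _ (esym (bm_actE (b := bperm to) g u y)).
  rewrite (bigD1 (to y g^-1%g)) //= big1 ?addr0; first by rewrite toKV // eqxx mulr1.
  move=> x nx; case: eqP => [E|_]; last by rewrite mulr0.
  by case/eqP: nx; rewrite -E toK.
pose f : ghom (kset F to) (bm (bperm to)) :=
  @mkghom F gT G (kset F to) (bm (bperm to)) (fun u => u)
  (linearP (idfun : {linear {ffun X -> F^o} -> _})) eqf.
by apply: (giso_bij (f := f)) => // v; exists v.
Qed.

Section Adapted.
Variables (V' V V'' : gmod F G) (i : ghom V' V) (s : ghom V V'').
Hypothesis exs : gexact i s.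
Variables (E' E'' : finType).
Variables (f' : {linear V' -> {ffun E' -> F^o}}) (h' : {linear {ffun E' -> F^o} -> V'}).
Variables (f'' : {linear V'' -> {ffun E'' -> F^o}}) (h'' : {linear {ffun E'' -> F^o} -> V''}).
Hypotheses (fh' : cancel f' h') (hf' : cancel h' f').
Hypotheses (fh'' : cancel f'' h'') (hf'' : cancel h'' f'').

(** For a linear section t of s, the coordinates of v are those of v - t (s v) in V' and of s v in
    V''. Prescribing f' lets i 1 become a basis vector when V' = k. *)
Lemma adapted_basis : exists (b : bmod F G) (D : pred (bE b))
    (clD : {in G, forall g e e', D e -> ~~ D e' -> ba g e e' = 0})
    (phi : ghom V (bm b)) (l : E' -> bE b),
  [/\ injective phi /\ forall y, exists x, phi x = y,
      giso V' (bm (bsub clD)), giso V'' (bm (bquo clD)),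
      forall e, D e <-> exists j, e = l j
    & forall u, (forall j, phi (i u) (l j) = f' u j) /\
                (forall e, ~~ D e -> phi (i u) e = 0)].
Proof.
have [inj_i sur_s ks] := exs.
have [t tK] := @linear_section _ _ _ s sur_s.
have [q qK] : exists q : {linear V -> V'}, forall v, i (q v) = v - t (s v).
  pose k := mklin (linearP (idfun \- (t \o s) : {linear V -> V})).
  apply: (linear_factor_inj (f := k)) => // v; apply/ks.
  by rewrite /= linearB tK subrr.
pose psi v : {ffun E' + E'' -> F^o} :=
  [ffun e => match e with inl j => f' (q v) j | inr j => f'' (s v) j end].
have lin_psi : linear psi.
  by move=> a u v; apply/ffunP => -[j|j]; rewrite !ffunE !linearP !ffunE.
pose xi (u : {ffun E' + E'' -> F^o}) : V :=
  i (h' [ffun j => u (inl j)]) + t (h'' [ffun j => u (inr j)]).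
have lin_xi : linear xi.
  move=> a u v; rewrite /xi.
  have -> : [ffun j => (a *: u + v) (inl j)] =
      a *: [ffun j => u (inl j)] + [ffun j => v (inl j)] :> {ffun E' -> F^o}.
    by apply/ffunP => j; rewrite !ffunE.
  have -> : [ffun j => (a *: u + v) (inr j)] =
      a *: [ffun j => u (inr j)] + [ffun j => v (inr j)] :> {ffun E'' -> F^o}.
    by apply/ffunP => j; rewrite !ffunE.
  by rewrite !linearP scalerDr addrACA.
have psiK : cancel (mklin lin_psi) (mklin lin_xi).
  move=> v; rewrite !mklinE /xi.
  have -> : [ffun j => psi v (inl j)] = f' (q v) by apply/ffunP => j; rewrite !ffunE.
  have -> : [ffun j => psi v (inr j)] = f'' (s v) by apply/ffunP => j; rewrite !ffunE.
  by rewrite fh' fh'' qK subrK.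
have sxi u : s (xi u) = h'' [ffun j => u (inr j)].
  by rewrite linearD (exact0 _ exs) add0r tK.
have qxi u : q (xi u) = h' [ffun j => u (inl j)].
  by apply: inj_i; rewrite qK sxi addrK.
have xiK : cancel (mklin lin_xi) (mklin lin_psi).
  move=> u; apply/ffunP => -[j|j]; rewrite !mklinE ffunE ?qxi ?sxi ?hf' ?hf'' ffunE //.
pose b := bmod_of psiK xiK.
pose D : pred (bE b) := fun e => if e is inl _ then true else false.
have clD : {in G, forall g e e', D e -> ~~ D e' -> ba g e e' = 0}.
  move=> g Gg [j|//] [//|j'] _ _; rewrite /b /= ffunE.
  rewrite ghomE // sxi (_ : finfun _ = 0) ?linear0 ?ffunE ?linear0 ?ffunE //.
  by apply/ffunP => j2; rewrite !ffunE.
pose phi : ghom V (bm b) := bmod_of_hom psiK xiK.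
have phiE v e : phi v e = psi v e by [].
have inj_phi : injective phi by exact: (can_inj psiK).
have sur_phi y : exists x, phi x = y by exists (xi y); apply: xiK.
have [i1 [s1 [ex1 _ s1E]]] := split_based clD.
have phi0 v : s v = 0 <-> s1 (phi v) = 0.
  split=> E.
    apply/ffunP => -[[j|j] //= nD]; rewrite s1E phiE /= ffunE E linear0 !ffunE //.
  apply: (can_inj fh''); rewrite linear0; apply/ffunP => j.
  have /ffunP/(_ (exist (fun e : bE b => ~~ D e) (inr j) isT)) := E.
  by rewrite s1E phiE !ffunE.
have [iU iM] := ses_compare exs ex1 inj_phi sur_phi phi0.
exists b, D, clD, phi, (inl : E' -> bE b); split=> //.
  by case=> j; split=> //; [exists j | case].
move=> u; have qi : q (i u) = u.
  by apply: inj_i; rewrite qK (exact0 _ exs) linear0 subr0.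
split=> [j|[j|j] // _]; rewrite phiE ffunE ?qi //.
by rewrite (exact0 _ exs) linear0 ffunE.
Qed.

End Adapted.

End AdaptedBases.

(** * Modules whose tensor induction lies in W *)

Section TensorClass.

Variables (F : fieldType) (gT : finGroupType) (G A : {group gT}).
Hypothesis sAG : A \subset G.
Hypothesis IH : forall H : {group gT}, H \proper G ->
  forall L : gmod F H, W L.
Local Notation I := (rcos G A).
Local Notation sh := (rcos_act sAG).
Local Notation tau := (tau sAG).

(** As tau is not additive, closure under extensions and quotients comes from [tau_filtration],
    whose middle layer always lies in W. *)
Definition TW (V : gmod F G) : Prop :=
  exists b, giso V (bm b) /\ W (bm (tau b)).

Lemma TW_any V b : TW V -> giso V (bm b) -> W (bm (tau b)).
Proof.
case=> b' [iV wb] iVb; apply: WW_iso wb; apply: tau_iso.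
exact: giso_trans (giso_sym iV) iVb.
Qed.

Lemma TW_filtration V' V V'' : ses V' V V'' ->
  exists (b' b b'' : bmod F G) (Q X : gmod F G),
  [/\ [/\ giso V' (bm b'), giso V (bm b) & giso V'' (bm b'')],
      ses (bm (tau b')) (bm (tau b)) Q, ses X Q (bm (tau b'')) & W X].
Proof.
case=> i [s exs].
have [n' [f' [h' [fh' hf']]]] := coordinates V'.
have [n'' [f'' [h'' [fh'' hf'']]]] := coordinates V''.
have [b [D [clD [phi [l [[inj_phi sur_phi] i' i'' _ _]]]]]] :=
  adapted_basis exs fh' hf' fh'' hf''.
have [Q [X [s1 s2 wX]]] := tau_filtration sAG clD IH.
exists (bsub clD), b, (bquo clD), Q, X; split=> //; split=> //.
exact: giso_bij inj_phi sur_phi.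
Qed.

Lemma TW_ext V' V V'' : ses V' V V'' -> TW V' -> TW V'' -> TW V.
Proof.
case/TW_filtration=> b' [b [b'' [Q [X [[i' ib i''] s1 s2 wX]]]]] t' t''.
exists b; split=> //; apply: (WW_ext s1) (TW_any t' i') _.
exact: (WW_ext s2) wX (TW_any t'' i'').
Qed.

Lemma TW_quo V' V V'' : ses V' V V'' -> TW V' -> TW V -> TW V''.
Proof.
case/TW_filtration=> b' [b [b'' [Q [X [[i' ib i''] s1 s2 wX]]]]] t' t.
exists b''; split=> //; apply: (W_quo s2) wX _.
exact: (W_quo s1) (TW_any t' i') (TW_any t ib).
Qed.

Lemma W_kset (X : finType) (to : action G X) :
  (forall x, exists2 g, g \in G & to x g != x) -> W (kset F to).
Proof.
move=> nofix; apply: WW_iso (giso_sym (bperm_iso F to)) _.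
apply: (W_based_blocks IH (b := bperm F to) (to := to) (pi := fun x => x)) => //.
by move=> g Gg x y; rewrite /=; have [//|_] := eqVneq (to x g) y; rewrite eqxx.
Qed.

Definition word_act (X : finType) (to : action G X) : action G {ffun I -> X}.
Proof.
apply: (@mkact gT G {ffun I -> X} (fun w g => [ffun c => to (w (sh c g^-1%g)) g])).
  by move=> w; apply/ffunP => c; rewrite ffunE invg1 !act1.
move=> g h Gg Gh w; apply/ffunP => c; rewrite !ffunE invMg.
by rewrite (toM _ _ Gg Gh) (toM sh) ?groupV.
Defined.

Lemma word_actE (X : finType) (to : action G X) w g c : g \in G ->
  word_act to w g (sh c g) = to (w c) g.
Proof. by move=> Gg; rewrite mkactE // ffunE toK. Qed.

Lemma sh_stab a : a \in A -> sh (mkrcos A (group1 G)) a = mkrcos A (group1 G).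
Proof.
move=> Aa; apply: val_inj; rewrite (rcos_actE sAG) ?(subsetP sAG) //.
have [h Ah ->] := crep_mkrcos A (group1 G).
by rewrite /= mulg1 !rcoset_id ?group1 ?groupM.
Qed.

(** tau(kX) is the permutation module on words in X. A word fixed by G would have an A-fixed letter
    at the position A, which A stabilizes. *)
Lemma TW_kset (X : finType) (to : action G X) :
  (forall x, exists2 a, a \in A & to x a != x) -> TW (kset F to).
Proof.
move=> nofix; exists (bperm F to); split; first exact: bperm_iso.
apply: (W_based_blocks IH (b := tau (bperm F to)) (to := word_act to) (pi := fun w => w)).
  move=> g Gg w w' nz; apply/ffunP => c; rewrite -(toKV sh c Gg); set d := sh c _.
  have := @tau_ba_neq0 _ _ _ _ sAG (bperm F to) g w w' d nz; rewrite word_actE //.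
  by rewrite [ba _ _ _]/=; have [//|_] := eqVneq (to (w d) g) (w' (sh d g)); rewrite eqxx.
move=> w; have [a Aa na] := nofix (w (mkrcos A (group1 G))).
exists a; first exact: subsetP sAG a Aa.
apply: contra na => /eqP/ffunP/(_ (mkrcos A (group1 G))).
by rewrite -{1}(sh_stab Aa) word_actE ?(subsetP sAG) // => ->.
Qed.

End TensorClass.

Section SubAction.

Variables (gT : finGroupType) (G : {group gT}) (X : finType) (to : action G X).
Variable P : pred X.
Hypothesis stP : {in G, forall g x, P x -> P (to x g)}.

Lemma restr_act_subproof (x : {x | P x}) g :
  P (if g \in G then to (val x) g else val x).
Proof. by case: ifP => Gg; [apply: stP | ]; rewrite ?(valP x). Qed.

Definition restr_act : action G {x | P x}.
Proof.
apply: (@mkact gT G {x | P x} (fun x g => exist P _ (restr_act_subproof x g))).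
  by move=> x; apply: val_inj; rewrite /= group1 act1.
by move=> g h Gg Gh x; apply: val_inj; rewrite /= groupM // Gg Gh toM.
Defined.

Lemma restr_actE x g : g \in G -> val (restr_act x g) = to (val x) g.
Proof. by move=> Gg; rewrite mkactE //= Gg. Qed.

End SubAction.

(** * Tensor induction of an extension of S by k *)

Section TensorArgument.

Variables (F : fieldType) (gT : finGroupType) (G A : {group gT}).
Hypothesis sAG : A \subset G.
Hypothesis IH : forall H : {group gT}, H \proper G ->
  forall L : gmod F H, W L.
Local Notation I := (rcos G A).
Local Notation sh := (rcos_act sAG).
Local Notation tau := (tau sAG).
Local Notation k := (gtriv F G).

Variables (Y S : gmod F G) (i : ghom k Y) (s : ghom Y S).
Hypotheses (exs : gexact i s) (tS : TW sAG S) (ntA : A :!=: 1%g).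

Let c0 : I := mkrcos A (group1 G).

(** In a basis adapted to k inside Y, a single word has all its letters in k: it is the tensor power
    of i 1. The other words are mixed or give tau(S), so the quotient lies in W. *)
Lemma tensor_line : exists (b : bmod F G) (phi : ghom Y (bm b))
    (i0 : ghom k (bm (tau b))) (K : gmod F G) (s0 : ghom (bm (tau b)) K),
  [/\ gexact i0 s0, W K & forall u, i0 u = u *: tens sAG (fun _ => phi (i 1))].
Proof.
have lin_f : linear (fun u : k => [ffun _ : unit => u] : {ffun unit -> F^o}).
  by move=> a u v; apply/ffunP => j; rewrite !ffunE.
have lin_h : linear (fun u : {ffun unit -> F^o} => u tt : k).
  by move=> a u v; rewrite !ffunE.
have fh : cancel (mklin lin_f) (mklin lin_h) by move=> u; rewrite !mklinE ffunE.
have hf : cancel (mklin lin_h) (mklin lin_f).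
  by move=> u; apply/ffunP => -[]; rewrite !mklinE ffunE.
have [n [f2 [h2 [fh2 hf2]]]] := coordinates S.
have [b [D [clD [phi [l [_ _ iS Dl phi_i]]]]]] := adapted_basis exs fh hf fh2 hf2.
have [phi1 phi0] := phi_i 1.
set v := tens sAG (fun _ : I => phi (i 1)).
pose w0 : bE (tau b) := [ffun _ => l tt].
have D0w (w : bE (tau b)) : [forall c, D (w c)] = (w == w0).
  apply/forallP/eqP => [Dw|-> c]; last by rewrite ffunE; apply/Dl; exists tt.
  by apply/ffunP => c; rewrite ffunE; have /Dl[[]] := Dw c.
have vE w : v w = (w == w0)%:R.
  rewrite ffunE -D0w; case: forallP => [Dw|].
    rewrite big1 // => c _; have /Dl[j ->] := Dw c.
    by rewrite phi1 mklinE ffunE.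
  move/forallP; rewrite negb_forall => /existsP[c nD].
  by rewrite (bigD1 c) //= phi0 ?mul0r.
have v_inv : {in G, forall g, gmact (bm (tau b)) g v = v}.
  move=> g Gg; rewrite tens_act //; apply: eq_tens => c.
  by rewrite -!ghomE.
have lin_i0 : linear (fun u : k => (u : F) *: v : bm (tau b)).
  by move=> a x y; rewrite scalerDl scalerA.
have i0_eq : {in G, forall g u, (gmact k g u : F) *: v = gmact (bm (tau b)) g ((u : F) *: v)}.
  by move=> g Gg u; rewrite linearZ v_inv.
pose i0 := @mkghom F gT G k (bm (tau b)) _ lin_i0 i0_eq.
have [i1 [s0 [ex0 _ s0E]]] := split_based (closed_D0 (sAG := sAG) clD).
exists b, phi, i0, (bm (bquo (closed_D0 (sAG := sAG) clD))), s0; split=> //; last first.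
  have sK := ses_split_based (@closed_D1 _ _ _ _ sAG b D clD).
  apply: WW_ext sK (W_mixed sAG clD IH) _.
  by apply: WW_iso (tau_quo_iso sAG clD) _; apply: TW_any tS iS.
have i0wE u w : i0 u w = u * (w == w0)%:R.
  by rewrite -vE mkghomE; apply: ffunE.
have [_ sur_s0 _] := ex0.
split=> // [x y /ffunP/(_ w0)|m].
  by rewrite !i0wE eqxx !mulr1.
split=> [E|[u <-]]; last first.
  apply/ffunP => x; rewrite s0E i0wE -D0w (negPf (valP x)).
  by rewrite mulr0 ffunE.
exists (m w0); apply/ffunP => w; rewrite i0wE.
have [->|nw] := eqVneq w w0; first exact: mulr1.
have nDw : ~~ [forall c, D (w c)] by rewrite D0w.
have /ffunP/(_ (exist (fun w : bE (tau b) => ~~ [forall c, D (w c)]) w nDw)) := E.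
by rewrite s0E ffunE /= => ->; rewrite mulr0.
Qed.

Lemma rcos_eq_act (c d : I) g : g \in G -> (crep c * g)%g \in val d -> sh c g = d.
Proof.
move=> Gg cd; apply: val_inj; rewrite (rcos_actE sAG) // (rcosE d) in cd *.
by apply/rcoset_eqP.
Qed.

(* Let x be the tensor product of the conjugates of y, and v that of the
   conjugates of i 1. Permuting the factors of x by left multiplication by g on
   A \\ G gives the tensor product of the conjugates of y * g; its expansion is
   x + v plus a sum of tensors that G permutes without fixed points. *)
Lemma TW_trivial (g : gT) (y w : Y) :
  g \in G -> g \in 'N(A)%g -> {in A, forall a, gmact Y a y = y} ->
  gmact Y g y = y + i 1 + \sum_(a in A) gmact Y a w -> W k.
Proof.
move=> Gg nAg y_inv gy.
have [b [phi [i0 [K [s0 [ex0 wK i0E]]]]]] := tensor_line.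
set v := tens sAG _ in i0E.
have Gc (c : I) : crep c \in G := crep_in sAG c.
have in_rep (t : Y) : {in A, forall a, gmact Y a t = t} ->
    forall h (c : I), h \in val c -> gmact Y h t = gmact Y (crep c) t.
  move=> t_inv h c; rewrite rcosE => /rcosetP[a Aa ->].
  by rewrite gmactM ?(subsetP sAG a Aa) // t_inv.
(* For an A-invariant t the factor at c depends on the coset only, which makes T t invariant under
   G. *)
pose T (t : Y) := tens sAG (fun c : I => phi (gmact Y (crep c) t)).
have shV h (c : I) : h \in G -> (crep (sh c h^-1) * h)%g \in val c.
  move=> Gh; rewrite -{2}(toKV sh c Gh) (rcos_actE sAG) //; exact: rcoset_refl.
have T_inv t : {in A, forall a, gmact Y a t = t} ->
    {in G, forall h, gmact (bm (tau b)) h (T t) = T t}.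
  move=> t_inv h Gh; rewrite tens_act //; apply: eq_tens => c.
  by rewrite -ghomE // -gmactM // (in_rep _ t_inv _ c) ?shV.
have Ggc (c : I) : (g * crep c)%g \in G by rewrite groupM.
pose sig (c : I) : I := mkrcos A (Ggc c).
have sigE (c : I) h : h \in val c -> (g * h)%g \in val (sig c).
  rewrite rcosE => /rcosetP[a Aa ->]; rewrite /sig /=.
  apply/rcosetP; exists (a ^ g^-1)%g; last by rewrite conjgE invgK !mulgA mulgKV.
  by rewrite memJ_norm // groupV.
have sig_sh : {in G, forall h c, sig (sh c h) = sh (sig c) h}.
  move=> h Gh c; apply: esym; apply: rcos_eq_act => //.
  have : (crep c * h)%g \in val (sh c h) by rewrite (rcos_actE sAG) ?rcoset_refl.
  move/sigE => E; have {}E : (g * (crep c * h))%g \in A :* (g * crep (sh c h)) by exact: E.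
  have [a' Aa' Ea'] := crep_mkrcos A (Ggc c).
  rewrite -[sig c]/(mkrcos A (Ggc c)) Ea' -[val _]/(A :* (g * crep (sh c h))).
  by move: E; rewrite !mem_rcoset -!mulgA (groupMl _ Aa').
have inj_sig : injective sig.
  move=> c d /(congr1 val)/= /rcoset_eqP/rcosetP[a Aa]; rewrite mulgA => E.
  have Ec : crep c = (a ^ g * crep d)%g.
    by apply: (mulgI g); rewrite E conjgE !mulgA mulgV mul1g.
  apply: val_inj; rewrite !rcosE Ec; apply/rcoset_eqP/rcosetP.
  by exists (a ^ g)%g; rewrite // memJ_norm.
have [r rE] := @tens_perm _ _ _ _ sAG b sig inj_sig sig_sh.
have rx : r (T y) = T (gmact Y g y).
  rewrite rE; apply: eq_tens => c; rewrite -gmactM //.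
  by congr (phi _); apply/esym/in_rep/sigE; rewrite ?rcosE ?rcoset_refl.
(* Labels for the summands of the factor at c: y, i 1, or the trace term w h with h in c. Allowing
   all h in [gT], with summand 0 for h outside c, makes the set of labels a G-set independent of
   c. *)
pose J : finType := (bool + gT)%type.
pose u (c : I) (j : J) : bm b := match j with
  | inl false => phi (gmact Y (crep c) y)
  | inl true => phi (i 1)
  | inr h => if h \in val c then phi (gmact Y h w) else 0 end.
have uE c : phi (gmact Y (crep c) (gmact Y g y)) = \sum_j u c j.
  rewrite gy !linearD big_sumType /= big_bool /=.
  have -> : gmact Y (crep c) (i 1) = i 1 by rewrite -ghomE.
  rewrite [_ + phi (i 1)]addrC; congr (_ + _).
  rewrite !linear_sum -big_mkcond /= (rcosE c) [RHS](reindex_inj (mulIg (crep c))) /=.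
  apply: eq_big => [a|a Aa]; first by rewrite mem_rcoset mulgK.
  by rewrite -gmactM ?(subsetP sAG a Aa).
pose lmul (j : J) (h : gT) : J := if j is inr h' then inr (h' * h)%g else j.
have lmul1 j : lmul j 1%g = j by case: j => //= h; rewrite mulg1.
have lmulM : {in G &, forall h h' j, lmul j (h * h')%g = lmul (lmul j h) h'}.
  by move=> h h' _ _ [] //= h''; rewrite mulgA.
pose lact : action G J := mkact lmul1 lmulM.
pose wact := word_act sAG lact.
have wactE (f : {ffun I -> J}) h (c : I) : h \in G -> wact f h c = lmul (f (sh c h^-1%g)) h.
  by move=> Gh; rewrite -{1}(toKV sh c Gh) word_actE // mkactE.
have u_act h (c : I) j : h \in G -> gmact (bm b) h (u c j) = u (sh c h) (lmul j h).
  move=> Gh; case: j => [[]|h'].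
  - change (gmact (bm b) h (phi (i 1)) = phi (i 1)); by rewrite -!ghomE.
  - change (gmact (bm b) h (phi (gmact Y (crep c) y)) = phi (gmact Y (crep (sh c h)) y)).
    rewrite -ghomE // -gmactM // (in_rep _ y_inv _ (sh c h)) //.
    by rewrite (rcos_actE sAG) ?rcoset_refl.
  change (gmact (bm b) h (if h' \in val c then phi (gmact Y h' w) else 0) =
    if (h' * h)%g \in val (sh c h) then phi (gmact Y (h' * h)%g w) else 0).
  have -> : ((h' * h)%g \in val (sh c h)) = (h' \in val c).
    by rewrite (rcos_actE sAG) // rcosetM (rcosE c) !mem_rcoset mulgK.
  case: ifP => h'c; last by rewrite linear0.
  rewrite -ghomE // -gmactM //; move: h'c; rewrite (rcosE c) => /rcosetP[a Aa ->].
  by rewrite groupM // (subsetP sAG).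
pose TT (f : {ffun I -> J}) := tens sAG (fun c => u c (f c)).
have TT_act : {in G, forall h f, gmact (bm (tau b)) h (TT f) = TT (wact f h)}.
  move=> h Gh f; rewrite tens_act //; apply: eq_tens => c.
  by rewrite u_act // toKV // wactE.
pose cst x : {ffun I -> J} := [ffun _ => inl x].
have cst_act x : {in G, forall h, wact (cst x) h = cst x}.
  by move=> h Gh; apply/ffunP => c; rewrite wactE // !ffunE.
pose P (f : {ffun I -> J}) := (f != cst false) && (f != cst true).
have stP : {in G, forall h f, P f -> P (wact f h)}.
  move=> h Gh f /andP[n0 n1]; rewrite /P.
  by rewrite -(cst_act false h Gh) -(cst_act true h Gh) !(inj_eq (act_inj _ _)) n0.
pose B0act := restr_act stP.
have nofix (x : {f | P f}) : exists2 h, h \in G & B0act x h != x.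
  case: (boolP [exists h in G, B0act x h != x]) => [/existsP[h /andP[]]|].
    by exists h.
  rewrite negb_exists => /forallP fixx; have {}fixx h : h \in G -> wact (val x) h = val x.
    by move=> Gh; have := fixx h; rewrite Gh negbK => /eqP/(congr1 val); rewrite restr_actE.
  have fE h (c : I) : h \in G -> val x (sh c h) = lmul (val x c) h.
    by move=> Gh; rewrite -{1}(fixx h Gh) wactE // toK.
  (* A fixed word is determined by its letter at c0. A letter [inl q] makes it constant, which P
     excludes; a letter [inr h] is moved by every a <> 1 in A, although a fixes c0. *)
  have /andP[n0 n1] := valP x; case E : (val x c0) => [q|h].
    case/negP: (if q as q return val x != cst q then n1 else n0).
    apply/eqP/ffunP => c; have [h Gh <-] := sh_trans sAG c0 c.
    by rewrite fE // E ffunE.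
  have [a Aa na] : exists2 a, a \in A & a != 1%g.
    by case/trivgPn: ntA => a Aa na; exists a.
  have := fE a c0 (subsetP sAG a Aa); rewrite sh_stab // E /= => -[/eqP].
  by rewrite -{1}[h]mulg1 (inj_eq (mulgI h)) eq_sym (negPf na).
have [t tE] := @kset_hom _ _ _ _ B0act (bm (tau b)) (fun x => TT (val x)) (fun h Gh x =>
  etrans (TT_act h Gh (val x)) (congr1 TT (esym (restr_actE stP x Gh)))).
pose sd : kset F B0act := \sum_x kdelta F B0act x.
have sd_inv : {in G, forall h, gmact (kset F B0act) h sd = sd}.
  move=> h Gh; rewrite linear_sum [RHS](reindex_inj (act_inj B0act h)).
  by apply: eq_bigr => x _; rewrite kdelta_act.
have v_sum : v = r (T y) - T y - t sd.
  have -> : r (T y) = \sum_f TT f by rewrite rx -tens_sum; apply: eq_tens => c; apply: uE.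
  rewrite (bigD1 (cst false)) //= (bigD1 (cst true)) //=; last first.
    by apply/eqP => /ffunP/(_ c0); rewrite !ffunE.
  have -> : TT (cst false) = T y by apply: eq_tens => c; rewrite ffunE.
  have -> : TT (cst true) = v by apply: eq_tens => c; rewrite ffunE.
  rewrite [T y + _]addrC addrK linear_sum (eq_bigr (fun x => TT (val x))) => [|x _]; last exact: tE.
  by rewrite -sum_sig addrK.
have rv : r v = v by rewrite rE.
(* r fixes v, so r - 1 factors through K = tau(Y)/k, which is known to lie in W. *)
have [h hE] : exists h : ghom K (bm (tau b)), forall m, h (s0 m) = r m - m.
  have [_ sur_s0 ks] := ex0.
  have lin : linear (fun m => r m - m) by exact: (linearP (r \- idfun)%R).
  have eq_rm : {in G, forall g0 m, r (gmact (bm (tau b)) g0 m) - gmact (bm (tau b)) g0 m =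
      gmact (bm (tau b)) g0 (r m - m)} by move=> g0 Gg0 m; rewrite linearB ghomE.
  apply: (@gfactor_surj _ _ _ _ _ _ s0 (mkghom lin eq_rm)) => // m /ks[c <-].
  by rewrite mkghomE i0E linearZ rv subrr.
(* An invariant vector that (h, - t) sends to r (T y) - T y - t sd = v; hence k -> tau(Y) factors as
   [W_factor] requires. *)
pose e : gprod K (kset F B0act) := (s0 (T y), sd).
have lin_j : linear (fun c : k => (c : F) *: e) by move=> a c d; rewrite scalerDl scalerA.
have eq_j : {in G, forall g0 c, (gmact k g0 c : F) *: e = gmact (gprod K (kset F B0act)) g0 ((c : F) *: e)}.
  move=> g0 Gg0 c; rewrite linearZ; congr (_ *: _).
  by rewrite gprod_actE -ghomE // T_inv // sd_inv.
pose jj : ghom k (gprod K (kset F B0act)) := mkghom lin_j eq_j.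
apply: (@W_factor _ _ _ _ _ _ _ jj (gcopair h (gopp t)) s0); last 2 first.
- exact: W_prod wK (W_kset IH nofix).
- exact: wK.
have jE c : gcomp (gcopair h (gopp t)) jj c = i0 c.
  rewrite -[LHS]/(gcopair h (gopp t) (jj c)) i0E linearZ -/v v_sum -hE //.
have [inj_i0 sur_s0 ks] := ex0; split=> // [c d|m]; first by rewrite !jE => /inj_i0.
by split=> [/ks[c <-]|[c <-]]; [exists c; rewrite jE | rewrite jE; apply/ks; exists c].
Qed.

End TensorArgument.

(** * Homogeneous cochains and Bocksteins *)

Section Cochains.

Variables (F : fieldType) (p : nat) (gT : finGroupType) (G : {group gT}).
Hypothesis p_gt1 : (1 < p)%N.

Let p_gt0 : (0 < p)%N := ltnW p_gt1.

Lemma Zp_int_dvd (m : int) : m%:~R = 0 :> 'Z_p -> (p %| m)%Z.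
Proof.
have p0 : p%:Z != 0 by case: p p_gt1.
rewrite {1}(divz_eq m p) intrD intrM -pmulrn pchar_Zp // mulr0 add0r.
have E : (m %% p)%Z = `|(m %% p)%Z|%N by rewrite gez0_abs ?modz_ge0.
have : ((m %% p)%Z < p%:Z)%R by rewrite ltz_pmod //; case: p p_gt1.
rewrite E; set r := `|_|%N; rewrite ltz_nat => lt.
rewrite -pmulrn => /(congr1 val); rewrite /= val_Zp_nat // modn_small // => r0.
by apply/dvdz_mod0P; rewrite E -/r r0.
Qed.

Definition Zi (u : 'Z_p) : int := (u : nat)%:Z.

Lemma ZiK u : (Zi u)%:~R = u :> 'Z_p.
Proof. by rewrite -pmulrn natr_Zp. Qed.

(** The inverse makes this a right action; on functions it reads (f g)(x) = f (g x). The points are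
    all of [gT], which is a free G-set. *)
Definition lact (x : gT) (g : gT) := (g^-1 * x)%g.
Definition lact2 (z : gT * gT) (g : gT) := (g^-1 * z.1, g^-1 * z.2)%g.

Lemma lact_is_action : is_action G lact.
Proof.
split=> [g x y|x g h _ _]; first exact: mulgI.
by rewrite /lact invMg mulgA.
Qed.

Lemma lact2_is_action : is_action G lact2.
Proof.
split=> [g [x y] [x' y'] [/mulgI-> /mulgI->] //|[x y] g h _ _].
by rewrite /lact2 /= invMg !mulgA.
Qed.

Definition C0 := kset F (Action lact_is_action).
Definition C1 := kset F (Action lact2_is_action).

Lemma C0_actE g (f : C0) x : gmact C0 g f x = f (g * x)%g.
Proof. by rewrite kset_actE /= /lact invgK. Qed.

Lemma C1_actE g (f : C1) x y : gmact C1 g f (x, y) = f (g * x, g * y)%g.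
Proof. by rewrite kset_actE /= /lact2 /= invgK. Qed.

Lemma cobd_subproof : exists d : ghom C0 C1, forall f x y, d f (x, y) = f y - f x.
Proof.
have lin : linear (fun f : C0 => [ffun z : gT * gT => f z.2 - f z.1] : C1).
  move=> a u v; apply/ffunP => z; rewrite !ffunE scalerBr opprD.
  by rewrite addrACA.
have eq_d : {in G, forall g (f : C0), [ffun z : gT * gT => gmact C0 g f z.2 - gmact C0 g f z.1] =
    gmact C1 g [ffun z : gT * gT => f z.2 - f z.1]}.
  by move=> g Gg f; apply/ffunP => -[x y]; rewrite C1_actE [LHS]ffunE [RHS]ffunE !C0_actE.
by exists (@mkghom F gT G C0 C1 _ lin eq_d) => f x y; rewrite [LHS]ffunE.
Qed.

Variable d : ghom C0 C1.
Hypothesis dE : forall f x y, d f (x, y) = f y - f x.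

(* If al is a homomorphism modulo p, this is the cocycle of its Bockstein. *)
Definition kap (al : gT -> int) : C1 :=
  [ffun z : gT * gT => ((al z.2 - al z.1) %/ p)%Z%:~R : F^o].

Lemma kapE al x y : kap al (x, y) = ((al y - al x) %/ p)%Z%:~R.
Proof. by rewrite ffunE. Qed.

Lemma kap_act g al : gmact C1 g (kap al) = kap (fun x => al (g * x)%g).
Proof. by apply/ffunP => -[x y]; rewrite C1_actE !kapE. Qed.

(** The multiple of p passes through the floor and leaves the coboundary of c, while m cancels in
    differences. *)
Lemma kap_shift al be (c : gT -> int) (m : int) :
  (forall x, al x = be x + p%:Z * c x + m) ->
  kap al = kap be + d [ffun x => (c x)%:~R : F^o].
Proof.
move=> E; apply/ffunP => -[x y]; rewrite [RHS]ffunE dE !kapE !ffunE !E.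
have -> : be y + p%:Z * c y + m - (be x + p%:Z * c x + m) =
    (c y - c x) * p%:Z + (be y - be x) by ring.
rewrite divzMDl; last by case: p p_gt1.
by rewrite intrD intrB addrC.
Qed.

Lemma kap_cong al be (m : 'Z_p) :
  (forall x, (al x)%:~R = (be x)%:~R + m) -> exists f, kap al = kap be + d f.
Proof.
move=> E; pose c x := ((al x - be x - Zi m) %/ p)%Z.
exists [ffun x => (c x)%:~R : F^o]; apply: (kap_shift (m := Zi m)) => x.
rewrite mulrC divzK; last first.
  by apply: Zp_int_dvd; rewrite !intrB E ZiK [_ + m]addrC addrK subrr.
by ring.
Qed.

Section Residues.

Variables (A : {group gT}) (lam : gT -> 'Z_p) (a : gT).
Hypothesis sAG : A \subset G.
Hypothesis IH : forall H : {group gT}, H \proper G ->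
  forall L : gmod F H, W L.
Hypothesis lamM : {in G, forall g x, lam (g * x)%g = lam g + lam x}.
Hypotheses (Aa : a \in A) (lam_a : lam a = 1).

Lemma lam_1 : lam 1%g = 0.
Proof. by apply: (addrI (lam 1%g)); rewrite -lamM ?mulg1 ?addr0. Qed.

Lemma lam_V : {in G, forall g, lam g^-1%g = - lam g}.
Proof.
by move=> g Gg; apply: (addrI (lam g)); rewrite -lamM // mulgV lam_1 subrr.
Qed.

Lemma lam_X n : lam (a ^+ n)%g = n%:R.
Proof.
elim: n => [|n IHn]; first by rewrite expg0 lam_1.
by rewrite expgS lamM ?(subsetP sAG) // lam_a IHn addrC natr1.
Qed.

Lemma A_neq1 : A :!=: 1%g.
Proof.
apply: contraTneq Aa => ->; rewrite inE; apply: contra_eqN lam_a => /eqP ->.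
by rewrite lam_1 eq_sym oner_eq0.
Qed.

(** The last term is the wrap-around from 0 to p - 1. *)
Lemma Zi_pred (u : 'Z_p) : Zi (u - 1) = Zi u - 1 + p%:Z * (u == 0)%:Z.
Proof.
have pE : (Zp_trunc p).+2 = p := Zp_cast p_gt1.
have [->|nz] := eqVneq u 0.
  have -> : 0 - 1 = (p.-1)%:R :> 'Z_p.
    apply: (addIr 1); by rewrite subrK natr1 prednK // pchar_Zp.
  rewrite /Zi val_Zp_nat // modn_small; last by case: p p_gt1.
  rewrite mulr1 predn_int; last exact: ltnW.
  by rewrite sub0r [RHS]addrC.
rewrite mulr0 addr0; have u0 : (0 < u)%N by rewrite lt0n; apply: contra nz => /eqP E; apply/eqP/val_inj.
have -> : u - 1 = (u.-1)%:R.
  by apply: (addIr 1); rewrite subrK natr1 prednK // natr_Zp.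
rewrite /Zi val_Zp_nat // modn_small; first by rewrite predn_int.
by rewrite prednK // ltnW // -{2}pE ltn_ord.
Qed.

(** The Bockstein cochain [ki 0] is G-invariant only modulo coboundaries. Its shifts [ki i] are
    permuted by G, and consecutive ones differ by an explicit coboundary. *)
Definition ki (i : 'Z_p) := kap (fun x => Zi (lam x - i)).

Lemma ki_act g i : g \in G -> gmact C1 g (ki i) = ki (i - lam g).
Proof.
move=> Gg; rewrite kap_act; apply/ffunP => -[x y].
by rewrite !kapE !lamM // !opprB ![lam g + _ - i]addrAC ![_ + (lam g - i)]addrC.
Qed.

Lemma ki_succ i : ki (i + 1) = ki i + d [ffun x => (lam x == i)%:R : F^o].
Proof.
rewrite /ki (kap_shift (be := fun x => Zi (lam x - i))
  (c := fun x => (lam x == i)%:Z) (m := -1)) => [|x].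
  by congr (_ + d _); apply/ffunP => x; rewrite !ffunE.
by rewrite opprD addrA Zi_pred subr_eq0 addrAC.
Qed.

Lemma ki_cong i : exists f, ki i = ki 0 + d f.
Proof.
apply: (kap_cong (m := - i)) => x.
by rewrite !ZiK subr0.
Qed.

Lemma val_1 : Zi 1 = 1.
Proof. by rewrite /Zi -[1]/(1%:R) val_Zp_nat // modn_small. Qed.

(** A coboundary is antisymmetric, whereas the floor is 0 at (1, a) and -1 at (a, 1). *)
Lemma ki_nontriv (c : F) f : c *: ki 0 = d f -> c = 0.
Proof.
move=> E; have {}E x y : c * ((Zi (lam y) - Zi (lam x)) %/ p)%Z%:~R = f y - f x.
  by have /ffunP/(_ (x, y)) := E; rewrite dE [LHS]ffunE kapE !subr0.
have := E 1%g a; have := E a 1%g; rewrite lam_1 lam_a val_1 subr0.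
have -> : ((1 : int) %/ p)%Z = 0 by rewrite divz_small // ltz_nat p_gt1.
have -> : ((0 - 1 : int) %/ p)%Z = -1.
  rewrite (_ : 0 - 1 = -1 * p%:Z + p.-1%:Z); last by rewrite predn_int //; ring.
  rewrite divzMDl ?divz_small ?addr0 //; last by case: p p_gt1.
  by rewrite ltz_nat ltn_predL.
move=> E1 /eqP; rewrite mulr0 eq_sym subr_eq0 => /eqP E2.
by move: E1; rewrite E2 subrr mulrN1 => /eqP; rewrite oppr_eq0 => /eqP.
Qed.

Definition bact (i : 'Z_p) (g : gT) : 'Z_p := i - lam g.

Lemma bact_is_action : is_action G bact.
Proof.
split=> [g i j /addIr //|i g h Gg Gh].
by rewrite /bact lamM // opprD addrA.
Qed.

Definition BB := kset F (Action bact_is_action).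

Lemma BB_actE g (b : BB) i : g \in G -> gmact BB g b i = b (i + lam g).
Proof. by move=> Gg; rewrite kset_actE /= /bact lam_V // opprK. Qed.

(** Along the powers of a, the residue of lam - i grows by 1 except where it drops from p - 1 to 0,
    at j = i. These values recover the coefficients of a combination of the [ki i]. *)
Lemma ki_step (i j : 'Z_p) :
  ki i ((a ^+ (j - 1)%R)%g, (a ^+ j)%g) = - (i == j)%:R.
Proof.
rewrite kapE !lam_X !natr_Zp addrAC Zi_pred subr_eq0.
rewrite (_ : _ - _ = - (j == i)%:Z * p%:Z + 1); last by ring.
rewrite divzMDl ?divz_small ?addr0 ?ltz_nat ?p_gt1 //; last by case: p p_gt1.
by rewrite eq_sym mulrNz.
Qed.

Lemma ki_parts (phi : 'Z_p -> F) :
  \sum_i (phi i - phi (i - 1)) *: ki i = - d [ffun x => phi (lam x) : F^o].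
Proof.
rewrite (eq_bigr (fun i => phi i *: ki i - phi (i - 1) *: ki i)); last first.
  by move=> i _; rewrite scalerBl.
rewrite sumrB [X in _ - X](reindex_inj (addIr 1)) /=.
rewrite -sumrB (eq_bigr (fun i => - d [ffun x => (phi i * (lam x == i)%:R)%R : F^o])).
  rewrite sumrN -linear_sum; congr (- d _); apply/ffunP => x.
  rewrite sum_ffunE ffunE (bigD1 (lam x)) //= big1 ?addr0 => [|i /negPf ni].
    by rewrite ffunE eqxx mulr1.
  by rewrite ffunE eq_sym ni mulr0.
move=> i _; rewrite addrK ki_succ scalerDr opprD addNKr -linearZ.
by congr (- d _); apply/ffunP => x; rewrite !ffunE.
Qed.

(* The module d C0 + F * ki 0 is the cokernel of an embedding of F[Z/p] into
   F[Z/p] x C0, where F[Z/p] maps to C1 by i |-> ki i and the embedding comes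
   from summation by parts ([ki_parts]). *)
Lemma coboundary_module : exists (K1 : gmod F G) (j : ghom K1 C1),
  [/\ TW sAG K1, injective j &
      forall v, (exists u, j u = v) <-> exists c f, v = c *: ki 0 + d f].
Proof.
have [t tE] := @kset_hom _ _ _ _ (Action bact_is_action) C1 ki
  (fun g Gg i => ki_act i Gg).
have {}tE (b : BB) : t b = \sum_i b i *: ki i.
  rewrite {1}(kset_sum b) linear_sum; apply: eq_bigr => i _.
  by rewrite linearZ tE.
pose T := gcopair t d; have TE b f : T (b, f) = t b + d f by [].
pose nf (phi : BB) : gprod BB C0 :=
  ([ffun i => phi i - phi (i - 1) : F^o], [ffun x => phi (lam x) : F^o]).
have lin_n : linear nf.
  move=> c u v; congr pair; apply/ffunP => x; rewrite !ffunE //.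
  by rewrite scalerBr opprD addrACA.
have eq_n : {in G, forall g phi, nf (gmact BB g phi) = gmact (gprod BB C0) g (nf phi)}.
  move=> g Gg phi; rewrite gprod_actE; congr pair; apply/ffunP => x.
    by rewrite [RHS]BB_actE // [LHS]ffunE [RHS]ffunE !BB_actE // addrAC.
  by rewrite [RHS]C0_actE [LHS]ffunE [RHS]ffunE BB_actE // lamM // addrC.
pose N := mkghom lin_n eq_n.
have kerT v : T v = 0 <-> exists phi, N phi = v.
  split=> [|[phi <-]]; last first.
    rewrite TE tE (eq_bigr (fun i => (phi i - phi (i - 1)) *: ki i)).
      by rewrite ki_parts addNr.
    by move=> i _; rewrite ffunE.
  case: v => b f; rewrite TE tE => Tv.
  have fE x y : f y - f x = - \sum_i b i * ki i (x, y).
    have /ffunP/(_ (x, y)) := Tv; rewrite [LHS]ffunE sum_ffunE dE [RHS]ffunE addrC.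
    move/eqP; rewrite addr_eq0 => /eqP ->; congr (- _).
    by apply: eq_bigr => i _; rewrite ffunE.
  (* By [ki_step], b is the difference of f along the powers of a; and f factors through lam,
     because each [ki i] vanishes on pairs with equal lam. *)
  exists [ffun i : 'Z_p => f (a ^+ (i : nat))%g]; congr pair; apply/ffunP => x.
    rewrite !ffunE fE (bigD1 x) //= big1 ?addr0 => [|i ni].
      by rewrite ki_step eqxx mulrN1 opprK.
    by rewrite ki_step (negPf ni) oppr0 mulr0.
  rewrite !ffunE; apply/eqP; rewrite -subr_eq0 fE big1 ?oppr0 // => i _.
  by rewrite kapE lam_X natr_Zp subrr div0z mulr0.
have inj_N : injective N.
  move=> u v /(congr1 snd)/ffunP E; apply/ffunP => i.
  by have := E (a ^+ (i : nat))%g; rewrite !ffunE lam_X natr_Zp.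
have [K1 [s1 ex1]] := coker_exact inj_N; have [_ sur1 ks1] := ex1.
have [j jE] : exists j : ghom K1 C1, forall v, j (s1 v) = T v.
  by apply: gfactor_surj => // v /ks1/kerT.
exists K1, j; split.
- have tB : TW sAG BB.
    apply: TW_kset => // i; exists a => //=.
    rewrite /bact lam_a -subr_eq0 addrAC subrr add0r oppr_eq0; exact: oner_neq0.
  have tC : TW sAG C0.
    apply: TW_kset => // x.
    exists a => //=; rewrite /lact -{2}[x]mul1g (inj_eq (mulIg x)).
    by rewrite invg_eq1; apply: contra_eqN lam_a => /eqP ->; rewrite lam_1 eq_sym oner_eq0.
  have sK : ses BB (gprod BB C0) K1 by exists N, s1.
  exact: (TW_quo IH sK tB (TW_ext IH (ses_addl _ _) tB tC)).
- move=> u v; have [u' <-] := sur1 u; have [v' <-] := sur1 v.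
  rewrite !jE => E; apply/eqP; rewrite -subr_eq0 -linearB; apply/eqP/ks1/kerT.
  by rewrite linearB E subrr.
move=> v; split=> [[u <-]|[c [f ->]]].
  have [[b f] <-] := sur1 u; rewrite jE TE tE.
  have [h hE] : exists h, \sum_i b i *: ki i = (\sum_i b i) *: ki 0 + d h.
    elim/big_rec2: _ => [|i c w _ [h ->]].
      by exists 0; rewrite linear0 scale0r addr0.
    have [e ->] := ki_cong i; exists (b i *: e + h).
    by rewrite scalerDl scalerDr !linearD linearZ addrACA.
  by exists (\sum_i b i), (h + f); rewrite hE linearD addrA.
exists (s1 (c *: kdelta F (Action bact_is_action) 0, f)); rewrite jE TE linearZ; congr (_ *: _ + _).
rewrite tE (bigD1 0) //= big1 ?addr0 => [|i /negPf ni].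
  by rewrite ffunE eqxx scale1r.
by rewrite ffunE ni scale0r.
Qed.

(** [C1] is free over A: theta is the trace of its restriction to the pairs whose first entry is the
    chosen representative of its coset. *)
Lemma invariant_trace (theta : C1) :
  {in A, forall b, gmact C1 b theta = theta} ->
  exists w : C1, theta = \sum_(b in A) gmact C1 b w.
Proof.
move=> inv; exists [ffun z => if z.1 == repr (A :* z.1)%g then theta z else 0].
apply/ffunP => -[x y]; rewrite sum_ffunE.
have /rcosetP[b Ab bE] : repr (A :* x)%g \in (A :* x)%g by rewrite mem_repr_rcoset.
rewrite (bigD1 b) //= big1 ?addr0 => [|b' /andP[Ab' nb]].
  rewrite C1_actE ffunE /= rcosetM rcoset_id // bE eqxx.
  by rewrite -{1}(inv b Ab) C1_actE.
rewrite C1_actE ffunE /= rcosetM rcoset_id // bE.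
by rewrite (inj_eq (mulIg x)) (negPf nb).
Qed.

(** [TW_trivial] is applied to Y = C1 / d C0, with the class of [ki 0] as eps and that of [kap chi]
    as y. The latter is A-invariant since translation by A changes chi by a constant modulo p; theta
    is a trace by [invariant_trace]. *)
Lemma W_of_cocycle (g : gT) (chi : gT -> int) (m : gT -> 'Z_p) (theta : C1) (f : C0) :
  g \in G -> g \in 'N(A)%g ->
  {in A, forall b x, (chi (b * x)%g)%:~R = (chi x)%:~R + m b} ->
  {in A, forall b, gmact C1 b theta = theta} ->
  kap (fun x => chi (g * x)%g) = kap chi + ki 0 + theta + d f ->
  W (gtriv F G).
Proof.
move=> Gg nAg chiA inv E.
have [Y [pi [sur_pi kpi]]] := coker_exists d.
have pi_d h : pi (d h) = 0 by apply/kpi; exists h.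
have lin_i : linear (fun c : gtriv F G => (c : F) *: pi (ki 0)).
  by move=> c u v; rewrite scalerDl scalerA.
have eq_i : {in G, forall g (c : gtriv F G), (gmact (gtriv F G) g c : F) *: pi (ki 0) =
    gmact Y g ((c : F) *: pi (ki 0))}.
  move=> h Gh c; rewrite linearZ; congr (_ *: _).
  by rewrite -ghomE // ki_act //; have [e ->] := ki_cong (0 - lam h); rewrite linearD pi_d addr0.
pose i : ghom (gtriv F G) Y := mkghom lin_i eq_i.
have iE c : i c = pi ((c : F) *: ki 0) by rewrite mkghomE linearZ.
have inj_i : injective i.
  move=> c c' E'; apply/eqP; rewrite -subr_eq0; apply/eqP.
  have /kpi[h hE] : pi ((c - c') *: ki 0) = 0 by rewrite -iE linearB E' subrr.
  exact: ki_nontriv (esym hE).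
have [S [s exs]] := coker_exact inj_i; have [_ sur_s ks] := exs.
have [K1 [j [tK inj_j jE]]] := coboundary_module.
(* S is C1 modulo K1 = d C0 + F ki 0, and A has no fixed points on the basis of C1. *)
have tS : TW sAG S.
  have tC : TW sAG C1.
    apply: TW_kset => // -[x y]; exists a => //=.
    rewrite /lact2 /= xpair_eqE -{2}[x]mul1g (inj_eq (mulIg x)) invg_eq1.
    by apply/nandP; left; apply: contra_eqN lam_a => /eqP ->; rewrite lam_1 eq_sym oner_eq0.
  apply: (TW_quo IH _ tK tC); exists j, (gcomp s pi); split=> // [w|v].
    by have [y <-] := sur_s w; have [v <-] := sur_pi y; exists v.
  rewrite -[gcomp s pi v]/(s (pi v)); split=> [/ks[c]|/jE[c [h ->]]].
    rewrite iE => E'; apply/jE; exists c.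
    have /kpi[h hE] : pi (v - c *: ki 0) = 0 by rewrite linearB E' subrr.
    by exists h; rewrite hE addrC subrK.
  by apply/ks; exists c; rewrite iE linearD pi_d addr0.
have [w wE] := invariant_trace inv.
apply: (TW_trivial IH exs tS A_neq1 (y := pi (kap chi)) (w := pi w) Gg nAg).
  move=> b Ab; rewrite -ghomE ?(subsetP sAG) // kap_act.
  have [h ->] : exists h, kap (fun x => chi (b * x)%g) = kap chi + d h.
    by apply: (kap_cong (m := m b)) => x; apply: chiA.
  by rewrite linearD pi_d addr0.
rewrite -ghomE // kap_act E !linearD pi_d addr0 iE scale1r; congr (_ + _).
rewrite wE linear_sum; apply: eq_bigr => b Ab.
by rewrite ghomE ?(subsetP sAG).
Qed.

End Residues.

End Cochains.

Section CharacterExtension.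

Variables (p : nat) (gT : finGroupType) (H : {group gT}) (chi : gT -> 'Z_p).

(* Cochains live on all of gT, so characters of its subgroups have to be extended
   to gT. *)
Definition coset_ext (x : gT) : 'Z_p := chi (x * (repr (H :* x))^-1)%g.

Lemma coset_ext_in : {in H, coset_ext =1 chi}.
Proof. by move=> h Hh; rewrite /coset_ext rcoset_id // repr_group invg1 mulg1. Qed.

Hypothesis chiM : {in H &, {morph chi : x y / (x * y)%g >-> x + y}}.

Lemma coset_extM : {in H, forall h x, coset_ext (h * x)%g = coset_ext h + coset_ext x}.
Proof.
move=> h Hh x; rewrite (coset_ext_in Hh) /coset_ext rcosetM (rcoset_id Hh).
rewrite -mulgA (chiM Hh) //; have := mem_repr_rcoset H x.
by rewrite mem_rcoset -groupV invMg invgK.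
Qed.

End CharacterExtension.

(** * The two choices of A *)

Section TwoCases.

Variables (F : fieldType) (p : nat) (gT : finGroupType) (G : {group gT}).
Hypothesis charFp : p \in [pchar F].
Hypothesis IH : forall H : {group gT}, H \proper G ->
  forall L : gmod F H, W L.
Variables (lam : gT -> 'Z_p) (a : gT).
Hypothesis lamM : {in G, forall g x, lam (g * x)%g = lam g + lam x}.
Hypotheses (Ga : a \in G) (lam_a : lam a = 1).

Let p_gt1 : (1 < p)%N := prime_gt1 (pcharf_prime charFp).

(** In x = a^i r, with r the representative of <a> x, the exponent i is determined modulo p^2. So
    lam lifts modulo p^2 along <a>, and its Bockstein has an <a>-invariant representative
    [kap al]. *)
Lemma W_cyclic_case : (p ^ 2 %| #[a]%g)%N -> W (gtriv F G).
Proof.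
move=> p2a; have sAG : <[a]>%g \subset G by rewrite cycle_subG.
have [d dE] := cobd_subproof F G.
have [i iE] : exists i : gT -> nat, forall x, x = (a ^+ i x * repr (<[a]> :* x))%g.
  apply: (fin_all_exists (P := fun x n => x = (a ^+ n * repr (<[a]> :* x))%g)) => x.
  have := mem_repr_rcoset <[a]> x; rewrite mem_rcoset -groupV invMg invgK.
  by case/cycleP=> n E; exists n; rewrite -E mulgKV.
pose al x : int := (i x)%:Z + Zi (lam (repr (<[a]> :* x)%g)).
have [f E] : exists f, kap F p G al = ki F G lam 0 + d f.
  apply: (kap_cong p_gt1 dE (m := 0)) => x.
  rewrite intrD !ZiK subr0 addr0 -pmulrn -(lam_X sAG lamM (cycle_id a) lam_a).
  by rewrite -lamM ?groupX // -iE.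
(* With chi = 0 and g = 1 the equation reduces to theta = - eps modulo coboundaries. *)
apply: (@W_of_cocycle _ _ _ _ p_gt1 _ dE <[a]> lam a sAG IH lamM (cycle_id a) lam_a
  1%g (fun _ => 0) (fun _ => 0) (- kap F p G al) f) => //.
- by rewrite addr0.
- move=> _ /cycleP[k ->]; rewrite linearN kap_act; congr (- _).
  have /dvdnP[q qE] := p2a.
  pose c x := (((i (a ^+ k * x)%g)%:Z - (i x)%:Z - k%:Z) %/ #[a]%g)%Z.
  (* Translation by a^k changes al by k plus a multiple of the order of a, hence of p^2. After
     division by p the correction is still divisible by p, so it vanishes in F. *)
  rewrite (kap_shift p_gt1 dE (be := al) (c := fun x => p%:Z * q%:Z * c x) (m := k%:Z)).
    rewrite -[RHS]addr0; congr (_ + _); rewrite (_ : finfun _ = 0) ?linear0 //.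
    apply/ffunP => x; rewrite !ffunE !intrM -pmulrn (pcharf0 charFp).
    by rewrite !mul0r.
  move=> x; rewrite /al rcosetM rcoset_id ?mem_cycle //.
  have -> : p%:Z * (p%:Z * q%:Z * c x) = c x * #[a]%g.
    by rewrite qE PoszM -mulnn PoszM; ring.
  rewrite divzK; first by ring.
  rewrite -addrA -opprD -PoszD -eqz_mod_dvd !modz_nat eqz_nat addnC.
  rewrite -eq_expg_mod_order expgD; apply/eqP.
  apply: (mulIg (repr (<[a]> :* x)%g)); rewrite -mulgA -iE.
  by have := iE (a ^+ k * x)%g; rewrite rcosetM rcoset_id ?mem_cycle.
by rewrite E opprD addrA addrNK addrK.
Qed.

(** A multiple of p added to s or t enters two quotients with opposite signs. This makes the carry
    cochain [th] below A-invariant. *)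
Lemma carry_cong (s t s' t' u : int) : (p %| s' - s)%Z -> (p %| t' - t)%Z ->
  ((s + t + u) %/ p)%Z - (s %/ p)%Z - (t %/ p)%Z =
  ((s' + t' + u) %/ p)%Z - (s' %/ p)%Z - (t' %/ p)%Z.
Proof.
move=> /dvdzP[i Ei] /dvdzP[j Ej].
have p0 : p%:Z != 0 by case: p p_gt1.
have -> : s' = i * p + s by rewrite -Ei subrK.
have -> : t' = j * p + t by rewrite -Ej subrK.
have -> : i * p + s + (j * p + t) + u = (i + j) * p + (s + t + u) by ring.
rewrite !divzMDl //; ring.
Qed.

Variables (A : {group gT}) (chi : gT -> 'Z_p) (g : gT).
Hypotheses (sAG : A \subset G) (Aa : a \in A) (Gg : g \in G) (nAg : g \in 'N(A)%g).
Hypothesis chiM : {in A, forall b x, chi (b * x)%g = chi b + chi x}.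
Hypothesis chiJ : {in A, forall b, chi (b ^ g)%g = chi b + lam b}.

(** chi (g^-1 x) = chi x + lam x + om x, and [kap] is additive up to coboundaries and carries. The
    carries form an A-invariant cochain, hence a trace. *)
Lemma W_noncentral_case : W (gtriv F G).
Proof.
have [d dE] := cobd_subproof F G.
(* The defect comes from extending chi beyond A; it is constant on cosets A x. Left translation by
   g^-1 turns b into b ^ g, since g^-1 * b = b ^ g * g^-1, whence g^-1 in place of g. *)
pose om x : 'Z_p := chi (g^-1 * x)%g - chi x - lam x.
have om_inv : {in A, forall b x, om (b * x)%g = om x}.
  move=> b Ab x; rewrite /om mulgA.
  have -> : (g^-1 * b = b ^ g * g^-1)%g by rewrite conjgE !mulgA mulgK.
  have AJ : (b ^ g)%g \in A by rewrite memJ_norm.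
  rewrite -mulgA (chiM AJ) (chiM Ab) (lamM (subsetP sAG b Ab)) chiJ //; ring.
pose be x : int := Zi (chi x) + Zi (lam x) + Zi (om x).
have [f E] : exists f, kap F p G (fun x => Zi (chi (g^-1 * x)%g)) = kap F p G be + d f.
  apply: (kap_cong p_gt1 dE (m := 0)) => x.
  by rewrite addr0 !intrD !ZiK /om; ring.
pose th : C1 F G := kap F p G be - kap F p G (fun x => Zi (chi x)) - ki F G lam 0.
pose D (al : gT -> 'Z_p) x y : int := Zi (al y) - Zi (al x).
have thE x y : th (x, y) = (((D chi x y + D lam x y + D om x y) %/ p)%Z
    - (D chi x y %/ p)%Z - (D lam x y %/ p)%Z)%:~R.
  rewrite /th /ki /kap !ffunE /= !subr0 !intrB; congr (_ - _ - _).
  by congr (_ %/ _)%Z%:~R; rewrite /be /D; ring.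
apply: (@W_of_cocycle _ _ _ _ p_gt1 _ dE A lam a sAG IH lamM Aa lam_a
  g^-1%g (fun x => Zi (chi x)) chi th f); rewrite ?groupV //.
- by move=> b Ab x; rewrite !ZiK chiM // addrC.
- move=> b Ab; apply/ffunP => -[x y].
  have dvd (al : gT -> 'Z_p) (m : 'Z_p) : (forall x, al (b * x)%g = m + al x) ->
      (p %| (Zi (al y) - Zi (al x)) - (Zi (al (b * y)%g) - Zi (al (b * x)%g)))%Z.
    by move=> alM; apply: (Zp_int_dvd p_gt1); rewrite !intrB !ZiK !alM; ring.
  have omD : D om (b * x)%g (b * y)%g = D om x y by rewrite /D !om_inv.
  rewrite C1_actE !thE omD; congr (_%:~R); apply: carry_cong.
    exact: dvd (chiM Ab).
  exact: dvd (lamM (subsetP sAG b Ab)).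
rewrite E; congr (_ + _); rewrite /th.
by rewrite -[X in _ + X]addrA -opprD [RHS]addrC subrK.
Qed.

End TwoCases.

Lemma Zp_dlog (qT : finGroupType) (z : qT) : (1 < #[z]%g)%N ->
  exists dl : qT -> 'Z_#[z]%g, (forall n, dl (z ^+ n)%g = n%:R) /\
    {in <[z]>%g &, {morph dl : u v / (u * v)%g >-> u + v}}.
Proof.
move=> z_gt1; have [i iE] : exists i : qT -> nat, forall u, u \in <[z]>%g -> u = (z ^+ i u)%g.
  apply: (fin_all_exists (P := fun u n => u \in <[z]>%g -> u = (z ^+ n)%g)) => u.
  by have [/cycleP[n ->]|] := boolP (u \in <[z]>%g); [exists n | exists 0%N].
have dlX n : (i (z ^+ n)%g)%:R = n%:R :> 'Z_#[z]%g.
  apply: val_inj; rewrite /= !val_Zp_nat //; apply/eqP.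
  by rewrite -eq_expg_mod_order -iE ?mem_cycle.
exists (fun u => (i u)%:R); split=> // _ _ /cycleP[m ->] /cycleP[n ->].
by rewrite -expgD !dlX natrD.
Qed.

(** * Nonabelian p-groups *)

Section Nonabelian.

Variables (F : fieldType) (p : nat) (gT : finGroupType) (G : {group gT}).
Hypothesis charFp : p \in [pchar F].
Hypothesis IH : forall H : {group gT}, H \proper G ->
  forall L : gmod F H, W L.

Let p_pr : prime p := pcharf_prime charFp.

(** Commutators generate G', so one lies outside N. G'/N is normal of order p in the p-group G/N,
    hence meets its center nontrivially and is contained in it. *)
Lemma noncentral_commutator : p.-group G -> ~~ abelian G ->
  exists (N : {group gT}) (a g : gT), [/\ N <| G, a \in G /\ g \in G,
    #[coset N [~ a, g]]%g = p, (G^`(1) / N = <[coset N [~ a, g]]>)%g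
    & <[coset N [~ a, g]]>%g \subset 'Z(G / N)%g].
Proof.
move=> pG nabG; have ntD : G^`(1)%g != 1%g by apply: contra nabG => /eqP/derG1P.
have pD : p.-group G^`(1)%g := pgroupS (der_sub 1 G) pG.
have [_ _ [r cD]] := pgroup_pdiv pD ntD.
have lgD : (r <= logn p #|G^`(1)%g|)%N by rewrite cD pfactorK.
have [N [sND nNG cN]] := normal_pgroup pG (der_normal 1 G) lgD.
have cDN : #|(G^`(1) / N)%g| = p.
  have nND : G^`(1)%g \subset 'N(N)%g := subset_trans (der_sub 1 G) (normal_norm nNG).
  by rewrite card_quotient // -divgS // cD cN expnSr mulKn ?expn_gt0 ?prime_gt0.
have : ~~ (G^`(1)%g \subset N).
  apply/negP => /subset_leq_card; rewrite cD cN leqNgt.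
  by rewrite ltn_exp2l ?prime_gt1 // ltnSn.
rewrite derg1 gen_subG => /subsetPn[_ /imset2P[a g Ga Gg ->] nNz].
have Dz : coset N [~ a, g] \in (G^`(1) / N)%g by rewrite mem_quotient // mem_commg.
have nz : coset N [~ a, g] != 1%g.
  apply: contra nNz => /eqP; apply: coset_idr.
  by rewrite (subsetP (normal_norm nNG)) // groupR.
have oz : #[coset N [~ a, g]]%g = p.
  have := order_dvdG Dz; rewrite cDN => /(prime_nt_dvdP p_pr) -> //.
  by rewrite order_eq1.
have zE : (G^`(1) / N = <[coset N [~ a, g]]>)%g.
  by apply/esym/eqP; rewrite eqEcard cycle_subG Dz cDN -orderE oz leqnn.
exists N, a, g; split=> //; rewrite -zE; apply: prime_meetG; first by rewrite cDN.
apply: meet_center_nil; first exact: pgroup_nil (quotient_pgroup _ pG).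
  exact: quotient_normal (der_normal 1 G).
by rewrite -cardG_gt1 cDN prime_gt1.
Qed.

Lemma W_nonabelian : p.-group G -> ~~ abelian G -> W (gtriv F G).
Proof.
move=> pG nabG.
have [N [a [g [nNG [Ga Gg] oz zE cz]]]] := noncentral_commutator pG nabG.
have p_gt1 := prime_gt1 p_pr.
have := @Zp_dlog _ (coset N [~ a, g]); rewrite oz => /(_ p_gt1)[dl [dlX dlM]].
have nN h : h \in G -> h \in 'N(N)%g by apply: subsetP (normal_norm nNG) h.
have sDG := der_sub 1 G.
have Dz c : c \in G^`(1)%g -> coset N c \in <[coset N [~ a, g]]>%g.
  by move=> Dc; rewrite -zE mem_quotient.
have Dc h k : h \in G -> k \in G -> [~ h, k]%g \in G^`(1)%g.
  by move=> Gh Gk; rewrite mem_commg.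
have cent c h : c \in G^`(1)%g -> h \in G -> coset N (c ^ h)%g = coset N c.
  move=> D_c Gh; have Gc := subsetP sDG c D_c.
  rewrite morphJ ?nN //=; apply/conjg_fixP/commgP.
  have /centerP[_ ] := subsetP cz _ (Dz c D_c); apply.
  exact: mem_quotient.
(* lam0 h and chi0 b are the exponents, modulo N, of [a, g] in [h, g] and in the
   G^`(1)-component of b. *)
pose lam0 h := dl (coset N [~ h, g]).
(* [h k, g] = [h, g]^k [k, g], and conjugation is trivial on G'/N. *)
have lam0M : {in G &, {morph lam0 : x y / (x * y)%g >-> x + y}}.
  move=> h k Gh Gk; rewrite /lam0 commMgJ morphM ?nN ?groupJ ?groupR //=.
  by rewrite cent ?dlM ?Dz ?Dc.
have lam0D c : c \in G^`(1)%g -> lam0 c = 0.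
  move=> D_c; have Gc := subsetP sDG c D_c.
  rewrite /lam0 commgEl morphM ?nN ?groupV ?groupJ //= cent // morphV ?nN //= mulVg.
  by rewrite -[1%g](expg0 (coset N [~ a, g])) dlX.
pose lam := coset_ext G lam0.
have lamE : {in G, lam =1 lam0} := @coset_ext_in p gT G lam0.
have lamM := coset_extM lam0M.
have lam_a : lam a = 1 by rewrite lamE // /lam0 -[coset N _]expg1 dlX.
have lam0X n : lam0 (a ^+ n)%g = n%:R.
  rewrite -lamE ?groupX //.
  by apply: (lam_X (A := <[a]>) (G := G)); rewrite ?cycle_subG ?cycle_id.
have [ap|nap] := eqVneq (a ^+ p)%g 1%g; last first.
  apply: (W_cyclic_case charFp IH lamM Ga lam_a).
  have /p_natP[k ak] : p.-nat #[a]%g by apply: mem_p_elt pG Ga.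
  rewrite ak dvdn_exp2l // ltnNge; apply: contra nap => k1.
  by rewrite -order_dvdn ak (dvdn_exp2l p k1).
pose A := (<[a]> <*> G^`(1))%G.
have nDG : G \subset 'N(G^`(1))%g := der_norm 1 G.
have AE : A = (<[a]> * G^`(1))%g :> {set gT}.
  by rewrite /= norm_joinEl // cycle_subG (subsetP nDG).
have sDA : G^`(1)%g \subset A := joing_subr _ _.
have sAG : A \subset G by rewrite join_subG cycle_subG Ga.
have Aa : a \in A by rewrite (subsetP (joing_subl _ _)) ?cycle_id.
have nAG : G \subset 'N(A)%g.
  by apply: normal_norm; apply: sub_der1_normal.
have AP b : b \in A -> exists i c, c \in G^`(1)%g /\ b = (a ^+ i * c)%g.
  by rewrite AE => /mulsgP[_ c /cycleP[i ->] D_c ->]; exists i, c.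
pose chi0 b := dl (coset N ((a ^+ (lam0 b : nat))^-1 * b)%g).
(* lam0 recovers i only modulo p, which is enough because a^p = 1. *)
have chi0E i c : c \in G^`(1)%g -> chi0 (a ^+ i * c)%g = dl (coset N c).
  move=> D_c; have Gc := subsetP sDG c D_c.
  rewrite /chi0 lam0M ?groupX // lam0X lam0D // addr0.
  by rewrite val_Zp_nat // expg_mod // mulKg.
have chi0M : {in A &, {morph chi0 : x y / (x * y)%g >-> x + y}}.
  move=> _ _ /AP[i [c [D_c ->]]] /AP[j [c' [D_c' ->]]].
  have Dca : (c ^ (a ^+ j))%g \in G^`(1)%g by rewrite memJ_norm // (subsetP nDG _ (groupX j Ga)).
  have -> : (a ^+ i * c * (a ^+ j * c') = a ^+ (i + j) * (c ^ (a ^+ j) * c'))%g.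
    by rewrite expgD conjgE !mulgA mulgK.
  rewrite !chi0E //; last exact: groupM Dca D_c'.
  rewrite morphM ?nN ?(subsetP sDG _ D_c') ?(subsetP sDG _ Dca) //=.
  rewrite dlM ?Dz //.
  by rewrite cent ?groupX.
have chiE := @coset_ext_in p gT A chi0.
apply: (W_noncentral_case charFp IH lamM lam_a sAG Aa Gg (subsetP nAG g Gg)
  (coset_extM chi0M)) => b Ab.
have Gb := subsetP sAG b Ab; have Dbg := Dc b g Gb Gg.
have Abg := subsetP sDA _ Dbg.
(* b ^ g = b [b, g], where [b, g] lies in G' and has logarithm lam b. *)
rewrite conjg_mulR (chiE _ Ab) (chiE _ (groupM Ab Abg)) chi0M //.
rewrite -[[~ b, g]%g]mul1g -(expg0 a) chi0E //; congr (_ + _).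
exact: esym (lamE b Gb).
Qed.

End Nonabelian.

Definition triv_act (gT : finGroupType) (G : {group gT}) : action G unit :=
  mkact (fun x : unit => erefl x) (fun g h _ _ x => erefl x).

Lemma gtriv_kset (F : fieldType) (gT : finGroupType) (G : {group gT}) :
  giso (gtriv F G) (kset F (triv_act G)).
Proof.
set to := triv_act G.
have lin_f : linear (fun u : gtriv F G => [ffun _ => u] : kset F to).
  by move=> a u v; apply/ffunP => x; rewrite !ffunE.
have f_eq : {in G, forall g (u : gtriv F G), [ffun _ => gmact (gtriv F G) g u] =
    gmact (kset F to) g ([ffun _ => u] : kset F to)}.
  by move=> g Gg u; apply/ffunP => x; rewrite kset_actE !ffunE.
apply: (giso_bij (f := mkghom lin_f f_eq)) => [u v /ffunP/(_ tt)|w].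
  by rewrite !mkghomE !ffunE.
by exists (w tt); apply/ffunP => -[]; rewrite mkghomE ffunE.
Qed.

(** * Induction on the order of the p-group *)

Section Main.

Variables (F : fieldType) (p : nat) (gT : finGroupType).
Hypothesis charFp : p \in [pchar F].

Lemma W_pgroup (P : {group gT}) : p.-group P -> forall V : gmod F P, W V.
Proof.
have [n] := ubnP #|P|; elim: n P => // n IHn P /ltnSE leP pP.
have IH (H : {group gT}) : H \proper P -> forall L : gmod F H, W L.
  move=> prH; apply: IHn (pgroupS (proper_sub prH) pP).
  exact: leq_trans (proper_card prH) leP.
apply: (W_all charFp pP).
have [abP|] := boolP (abelian P); last exact: (W_nonabelian charFp IH pP).
have [P1|ntP] := eqVneq (P : {set gT}) 1%g.
  apply: WW_perm; apply: permmod_iso (giso_sym (gtriv_kset F P)) _.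
  exists unit, (triv_act P).
  split=> [x|]; last exact: giso_refl.
  by left; apply/setP => g; rewrite inE andbT -[RHS](congr1 (fun S : {set gT} => g \in S) P1).
(* A cyclic subgroup of maximal order is a direct factor of an abelian group. *)
have [x Px ox] := exponent_witness (pgroup_nil pP).
have /splitsP[B cB] := abelian_splits Px (esym ox) abP.
apply: (W_abelian_step abP cB); apply: IH.
have [tiB defP] := complP cB.
rewrite properEneq; apply/andP; split; last by rewrite -defP mulG_subr.
apply: contraNneq ntP => BP; rewrite trivg_exponent ox.
by rewrite orderE -(setIidPl (_ : <[x]>%g \subset B)) ?tiB ?cards1 // BP cycle_subG.
Qed.

End Main.

Local Close Scope ring_scope.
Local Close Scope group_scope.

Theorem theorem2 (gT : finGroupType) (G : {group gT}) (k : fieldType) (p : nat)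
    (charkp : p \in [pchar k]%R) (p_dvd_G : p %| #|G|)
    (M : representation k G) :
  exists N : representation k G,
    has_finite_permutation_resolution (dadd_grepr M N).
Proof. exact (pgroups_suffice charkp M (W_pgroup charkp)). Qed.
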